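(* Let $(\mathbf{T},d,r,\mu)$ be an IP-tree equipped with a planar order $\psi$, a branch weight function $\lambda$ and branchpoint weight functions $\{\beta_a\}_a$, and let $(T_n)_{n\ge1}$ be an extremal tree growth chain with uniform backward dynamics whose law is the law $\rho_{\mathbf{T}}$ of the sequence obtained from these data by the sampling construction below. Let $(T_n^{\mathrm{trim}},d_n^{\mathrm{trim}},r_n,\mu_n^{\mathrm{trim}})$ be the trimmed and rescaled version of $T_n$. Then $$(T_n^{\mathrm{trim}},d_n^{\mathrm{trim}},r_n,\mu_n^{\mathrm{trim}})\longrightarrow(\mathbf{T},d,r,\mu)\quad\text{as }n\to\infty$$ almost surely in the Gromov–Prokhorov topology.
   Context: Plane trees: finite sets of words over $\mathbb{N}_0$ containing the empty word (root), closed under deleting the last letter and under decreasing a positive last letter; children are ordered left to right by their last letter; a leaf is a non-root vertex of degree 1; $\mathbb{T}_n$: plane trees with $n$ leaves, no vertex of degree 2, root of degree 1. A tree growth chain with uniform backward dynamics is a Markov chain $(T_n)$, $T_n\in\mathbb{T}_n$, such that for $n\ge2$, conditionally on $T_n$, removing a uniform leaf and its edge and suppressing degree-2 vertices yields a tree with the law of $T_{n-1}$; extremal means its law is not a non-trivial convex combination of two other such laws. Real trees: complete separable metric spaces with unique arcs $[x,y]$ isometric to intervals, rooted at $r$, with Borel probability $\mu$; $x\preceq y$ iff $x\in[r,y]$; $F_{\mathbf{T}}(x)=\{y:x\in[r,y]\}$; subtrees of $x$: components of $F_{\mathbf{T}}(x)\setminus\{x\}$ with $x$ added; leaf: non-root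 point whose removal leaves the tree connected; branchpoint: removal gives $\ge3$ components; atoms: $\mu(\{a\})>0$; $\mu=\mu_{\mathrm{atoms}}+\mu_s+\mu_\ell$ (atomic, diffuse on non-leaves with support chosen among degree-2 points, diffuse on leaves). IP-tree: every leaf in the closed support of $\mu$ and $d(r,x)+\mu(F_{\mathbf{T}}(x))=1$ for all branchpoints $x$ and all $x$ in the closed support of $\mu$. Planar order: measurable maps $\psi_n$ from $\mathbf{T}^n$ to labelled rooted plane trees with the combinatorial structure of $\operatorname{span}(r,x_1,\dots,x_n)$ (plus a new root edge if the root has degree $>1$), the vertex of $x_i$ labelled $i$, and $\psi_n(x_1,\dots,x_n)$ embedding into $\psi_{n+m}(x_1,\dots,x_{n+m})$ respecting plane order and labels. Branch weight function: measurable $\lambda:\mathbf{T}\to[0,1]$; branchpoint weight function for atom $a$: a map $\beta_a$ from subtrees of $a$ to $[0,1]$. Sampling construction: $(\xi_i)$ i.i.d. $\mu$, $(U_i)$ i.i.d. uniform; $S_n=\psi_n(\xi_1,\dots,\xi_n)$; to each labelled non-leaf vertex, and to each leaf carrying more than one label, attach one new leaf per label; the new leaf $i$ is placed left of the (single) subtree if $\xi_i\in\operatorname{supp}\mu_s$ and $U_i\le\lambda(\xi_i)$, right otherwise; if $\xi_i=a$ is an atom, left of the subtree corresponding to subtree $\mathbf{S}$ of $a$ iff $U_i\le\beta_a(\mathbf{S})$; if $\xi_i=\xi_j$, leaf $i$ left of leaf $j$ iff $U_i<U_j$; then erase labels to get $T_n$. Trimming: $T_n^{\mathrm{trim}}$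 is $T_n$ with all leaves and their edges removed, root $r_n$; $\mu_n^{\mathrm{trim}}$ gives mass $1/n$, for each leaf $x$ of $T_n$, to the neighbour of $x$; edge $(x,y)$ of $T_n^{\mathrm{trim}}$ has length $|\mu_n^{\mathrm{trim}}(F(x))-\mu_n^{\mathrm{trim}}(F(y))|$, $F(z)$ being $z$ together with its descendants in $T_n^{\mathrm{trim}}$, and $d_n^{\mathrm{trim}}$ is the path metric. Gromov–Prokhorov distance between $(M_1,d_1,r_1,\mu_1)$ and $(M_2,d_2,r_2,\mu_2)$: infimum of $\varepsilon>0$ for which there are a measurable $R\subseteq M_1\times M_2$ and a coupling $\nu$ of $\mu_1,\mu_2$ with $\nu(R)\ge1-\varepsilon$ and $\sup_{(x,y),(x',y')\in R}|d_1(x,x')-d_2(y,y')|\le\varepsilon$. *)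

(* Defs.v *)
From HB Require Import structures.
From mathcomp Require Import all_boot all_order all_algebra.
From mathcomp Require Import finmap.
From mathcomp Require Import all_classical all_reals all_analysis.
Set Implicit Arguments. Unset Strict Implicit. Unset Printing Implicit Defensive.
Import Order.TTheory GRing.Theory Num.Theory.
Import numFieldNormedType.Exports.
Local Open Scope classical_set_scope.
Local Open Scope ring_scope.

Definition word := seq nat.
HB.instance Definition _ := Choice.on word.
HB.instance Definition _ := isPointed.Build word [::].
HB.instance Definition _ := @isMeasurable.Build default_measure_display
  word (@discrete_measurable word) (@discrete_measurable0 word)
  (@discrete_measurableC word) (@discrete_measurableU word).

Definition ptree := {fset word}.
Local Open Scope fset_scope.

Definition parent (w : word) : word := take (size w).-1 w.
Definition decr_last (w : word) : word := rcons (parent w) (last 0%N w).-1.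
Definition is_child (v w : word) : bool := (size w == (size v).+1) && prefix v w.

Definition is_plane_tree (W : ptree) : Prop :=
  [::] \in W /\
  (forall w, w \in W -> w != [::] -> parent w \in W) /\
  (forall w, w \in W -> w != [::] -> (0 < last 0%N w)%N -> decr_last w \in W).

Definition nchildren (W : ptree) (v : word) : nat := count (is_child v) W.
Definition deg (W : ptree) (v : word) : nat := nchildren W v + (v != [::]).
Definition is_leaf (W : ptree) (v : word) : bool :=
  [&& v \in W, v != [::] & deg W v == 1%N].
Definition nleaves (W : ptree) : nat := count (is_leaf W) W.

Definition in_Tn (n : nat) (W : ptree) : Prop :=
  is_plane_tree W /\ nleaves W = n /\
  (forall v, v \in W -> deg W v != 2%N) /\ deg W [::] = 1%N.

Fixpoint lcp (u v : word) : word :=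
  match u, v with
  | a :: u', b :: v' => if a == b then a :: lcp u' v' else [::]
  | _, _ => [::]
  end.
Definition left_of (u v : word) : bool :=
  let k := size (lcp u v) in
  [&& (k < size u)%N, (k < size v)%N & (nth 0%N u k < nth 0%N v k)%N].

(* removal of the leaf l (and its edge), followed by suppression of the
   resulting degree-2 vertex (only the former parent of l can have degree 2) *)
Definition shift_after (p : word) (k : nat) (w : word) : word :=
  if [&& prefix p w, (size p < size w)%N & (k < nth 0%N w (size p))%N]
  then set_nth 0%N w (size p) (nth 0%N w (size p)).-1 else w.
Definition suppress (p : word) (w : word) : word :=
  if prefix (rcons p 0%N) w then p ++ drop (size p).+1 w else w.
Definition remove_leaf (W : ptree) (l : word) : ptree :=
  let p := parent l in
  let W1 := [fset shift_after p (last 0%N l) w | w in W & w != l] in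
  if (p != [::]) && (deg W1 p == 2%N)
  then [fset suppress p w | w in W1 & w != p] else W1.

Definition removal_count (t t' : ptree) : nat :=
  count (fun l => is_leaf t l && (remove_leaf t l == t')) t.

Local Close Scope fset_scope.

Section Chains.
Variable R : realType.

Definition fdd_event (Om : Type) (X : nat -> Om -> ptree) (s : seq ptree) : set Om :=
  [set om | forall k, (k < size s)%N -> X k.+1 om = nth fset0 s k].

(* Markov chain with T_n in T_n such that, conditionally on T_n, removing a
   uniform leaf of T_n gives the law of T_{n-1}; equivalently, the joint law
   of (T_1,...,T_n) is P(T_n = t_n) * prod_{k=2}^n c(t_k,t_{k-1})/k. *)
Definition ubd_chain (dO : measure_display) (Om : measurableType dO)
  (P : probability Om R) (X : nat -> Om -> ptree) : Prop :=
  (forall n om, (0 < n)%N -> in_Tn n (X n om)) /\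
  (forall n t, measurable [set om | X n om = t]) /\
  (forall s : seq ptree, (0 < size s)%N ->
     P (fdd_event X s) =
     (P [set om | X (size s) om = last fset0 s] *
      (\prod_(2 <= k < (size s).+1)
         ((removal_count (nth fset0 s k.-1) (nth fset0 s k.-2))%:R / k%:R : R))%:E)%E).

(* extremal: the law (determined by the finite-dimensional distributions) is
   not a non-trivial convex combination of two other such laws *)
Definition extremal_ubd_chain (dO : measure_display) (Om : measurableType dO)
  (P : probability Om R) (X : nat -> Om -> ptree) : Prop :=
  ubd_chain P X /\
  forall (d1 : measure_display) (Om1 : measurableType d1) (P1 : probability Om1 R)
         (X1 : nat -> Om1 -> ptree)
         (d2 : measure_display) (Om2 : measurableType d2) (P2 : probability Om2 R)
         (X2 : nat -> Om2 -> ptree) (a : R),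
    ubd_chain P1 X1 -> ubd_chain P2 X2 -> 0 < a < 1 ->
    (forall s, P (fdd_event X s) =
               (a%:E * P1 (fdd_event X1 s) + (1 - a)%:E * P2 (fdd_event X2 s))%E) ->
    forall s, P1 (fdd_event X1 s) = P2 (fdd_event X2 s).

End Chains.

Section RealTrees.
Variables (R : realType) (dT : measure_display) (T : measurableType dT).
Variable (d : T -> T -> R).

Definition is_metric : Prop :=
  (forall x y, 0 <= d x y) /\ (forall x y, d x y = 0 <-> x = y) /\
  (forall x y, d x y = d y x) /\ (forall x y z, d x z <= d x y + d y z).
Definition d_cauchy (u : nat -> T) : Prop :=
  forall e, 0 < e -> exists N, forall m n, (N <= m)%N -> (N <= n)%N -> d (u m) (u n) < e.
Definition d_complete : Prop :=
  forall u, d_cauchy u -> exists x, forall e, 0 < e ->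
    exists N, forall n, (N <= n)%N -> d (u n) x < e.
Definition d_separable : Prop :=
  exists D : nat -> T, forall x e, 0 < e -> exists n, d x (D n) < e.
Definition geodesic (x y : T) (f : R -> T) : Prop :=
  f 0 = x /\ f (d x y) = y /\
  forall s t, 0 <= s <= d x y -> 0 <= t <= d x y -> d (f s) (f t) = `|s - t|.
Definition arc (x y : T) (g : R -> T) : Prop :=
  g 0 = x /\ g 1 = y /\
  (forall t, 0 <= t <= 1 -> forall e, 0 < e -> exists del, 0 < del /\
     forall s, 0 <= s <= 1 -> `|s - t| < del -> d (g s) (g t) < e) /\
  (forall s t, 0 <= s <= 1 -> 0 <= t <= 1 -> g s = g t -> s = t).
Definition unique_arcs : Prop :=
  forall x y, exists f, geodesic x y f /\
    forall g, arc x y g ->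
      [set g t | t in [set t | 0 <= t <= 1]] = [set f t | t in [set t | 0 <= t <= d x y]].
Definition real_tree : Prop :=
  is_metric /\ d_complete /\ d_separable /\ unique_arcs.

Definition d_open (A : set T) : Prop :=
  forall x, A x -> exists e, 0 < e /\ forall y, d x y < e -> A y.
Definition borel_of_d : Prop := (@measurable _ T) = <<s d_open >>.

Definition seg (x y : T) : set T :=
  [set z | exists f, geodesic x y f /\ exists t, 0 <= t <= d x y /\ f t = z].

Variable r : T.
Definition Fset (x : T) : set T := [set y | seg r y x].
(* connected component of y in S (real trees: connected = arc-connected) *)
Definition comp (S : set T) (y : T) : set T := [set z | S z /\ seg y z `<=` S].
Definition is_subtree (x : T) (S : set T) : Prop :=
  exists y, Fset x y /\ y <> x /\ S = comp (Fset x `\ x) y `|` [set x].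
(* leaf: non-root point whose removal leaves the tree connected *)
Definition is_leafT (x : T) : Prop :=
  x <> r /\ forall y z, y <> x -> z <> x -> ~ seg y z x.
(* branchpoint: removal gives >= 3 components *)
Definition is_branchpoint (x : T) : Prop :=
  exists y1 y2 y3, [/\ y1 <> x, y2 <> x & y3 <> x] /\ [/\ seg y1 y2 x, seg y1 y3 x & seg y2 y3 x].
(* degree 2: removal gives exactly 2 components *)
Definition is_deg2 (x : T) : Prop :=
  exists y1 y2, [/\ y1 <> x, y2 <> x, seg y1 y2 x &
    forall z, z <> x -> ~ seg z y1 x \/ ~ seg z y2 x].

Variable mu : probability T R.
Definition is_atom (a : T) : Prop := (0 < mu [set a])%E.
Definition dball (x : T) (e : R) : set T := [set y | d x y < e].
Definition closed_support : set T :=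
  [set x | forall e, 0 < e -> (0 < mu (dball x e))%E].

Definition IP_tree : Prop :=
  (forall x, is_leafT x -> closed_support x) /\
  (forall x, is_branchpoint x \/ closed_support x ->
     ((d r x)%:E + mu (Fset x) = 1)%E).

(* Ss : the chosen support of the diffuse non-leaf part mu_s of mu, made of
   degree-2 points *)
Definition mus_support (Ss : set T) : Prop :=
  measurable Ss /\ (forall x, Ss x -> is_deg2 x /\ ~ is_atom x) /\
  exists N, measurable N /\ mu N = 0%E /\
    (forall x, ~ is_atom x -> ~ is_leafT x -> ~ Ss x -> N x).

Definition branch_weight (lam : T -> R) : Prop :=
  measurable_fun setT lam /\ forall x, 0 <= lam x <= 1.
Definition branchpoint_weights (beta : T -> set T -> R) : Prop :=
  forall a, is_atom a -> forall S, is_subtree a S -> 0 <= beta a S <= 1.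

(* labelled plane trees: the vertex lab i carries label i *)
Definition lptree (n : nat) := (ptree * ('I_n -> word))%type.

Definition cylinders (n : nat) : set (set ('I_n -> T)) :=
  [set [set x | forall i, A i (x i)] | A in [set A : 'I_n -> set T | forall i, measurable (A i)]].

Definition span n (x : 'I_n -> T) : set T := [set z | exists i, seg r (x i) z].
Definition root_deg_gt1 n (x : 'I_n -> T) : Prop :=
  exists y1 y2, [/\ span x y1, span x y2, y1 <> r, y2 <> r & seg y1 y2 r].
Definition span_bp n (x : 'I_n -> T) (z : T) : Prop :=
  span x z /\ exists y1 y2 y3, [/\ span x y1, span x y2, span x y3,
    [/\ y1 <> z, y2 <> z & y3 <> z] & [/\ seg y1 y2 z, seg y1 y3 z & seg y2 y3 z]].
Definition span_vertex n (x : 'I_n -> T) (z : T) : Prop :=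
  z = r \/ (exists i, z = x i) \/ span_bp x z.

(* t has the combinatorial structure of span(r,x_1,...,x_n) (plus a new root
   edge if r has degree > 1 in the span), with x_i at the vertex labelled i *)
Definition comb_structure n (x : 'I_n -> T) (t : lptree n) : Prop :=
  is_plane_tree t.1 /\
  exists phi : T -> word,
    let V w := w \in t.1 /\ (root_deg_gt1 x -> w != [::]) in
    [/\ (forall z, span_vertex x z -> V (phi z)),
        (forall w, V w -> exists z, span_vertex x z /\ phi z = w),
        (forall z z', span_vertex x z -> span_vertex x z' ->
            (prefix (phi z) (phi z') <-> seg r z' z)) &
        (forall i, phi (x i) = t.2 i)].

Definition planar_order (psi : forall n, ('I_n -> T) -> lptree n) : Prop :=
  (forall n x, comb_structure x (psi n x)) /\
  (forall n (v : lptree n), <<s (cylinders (n:=n)) >> [set x | psi n x = v]) /\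
  (forall n m (x : 'I_(n + m) -> T),
     let t1 := psi n (fun i => x (lshift m i)) in
     let t2 := psi (n + m) x in
     exists e : word -> word,
       [/\ (forall w, w \in t1.1 -> e w \in t2.1),
           (forall u v, u \in t1.1 -> v \in t1.1 -> e u = e v -> u = v),
           (forall u v, u \in t1.1 -> v \in t1.1 -> prefix u v = prefix (e u) (e v)),
           (forall u v, u \in t1.1 -> v \in t1.1 -> left_of u v = left_of (e u) (e v)) &
           (forall i, e (t1.2 i) = t2.2 (lshift m i))]).

Definition lab_nat n (l : 'I_n -> word) (i : nat) : word :=
  oapp l [::] (insub i : option 'I_n).

Definition sample (psi : forall n, ('I_n -> T) -> lptree n) (lam : T -> R)
  (beta : T -> set T -> R) (Ss : set T)
  (n : nat) (xs : nat -> T) (us : nat -> R) : ptree :=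
  let t := psi n (fun i : 'I_n => xs i) in
  let W := t.1 in
  let lab := lab_nat t.2 in
  let idx := iota 0 n in
  let labs v := [seq i <- idx | lab i == v] in
  (* a new leaf per label at labelled non-leaf vertices and at leaves with
     more than one label *)
  let attached v := (size (labs v) != 0%N) && (~~ is_leaf W v || (1 < size (labs v))%N) in
  let k v := nchildren W v in
  (* the subtree of the atom a containing (the points below) child word c *)
  let rep c := nth 0%N [seq j <- idx | prefix c (lab j)] 0 in
  let subtree_at a c := comp (Fset a `\ a) (xs (rep c)) `|` [set a] in
  (* number of original children to the left of new leaf i *)
  let pos i :=
    let a := xs i in let v := lab i in
    if `[< is_atom a >] then
      count (fun j => beta a (subtree_at a (rcons v j)) < us i) (iota 0 (k v))
    else if `[< Ss a >] then (if us i <= lam a then 0%N else k v) else k v in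
  let before j i := (pos j < pos i)%N ||
      ((pos j == pos i) && ((us j < us i) || ((us j == us i) && (j < i)%N))) in
  let rank_leaf i := (pos i + count (fun j => (lab j == lab i) && before j i) idx)%N in
  let rank_child v j :=
    (j + count (fun i => [&& lab i == v, attached v & (pos i <= j)%N]) idx)%N in
  let newword (w : word) : word :=
    [seq rank_child (take m w) (nth 0%N w m) | m <- iota 0 (size w)] in
  ([fset newword w | w in W] `|`
   [fset rcons (newword (lab i)) (rank_leaf i) | i in idx & attached (lab i)])%fset.

Definition iid_sample (dO : measure_display) (Om : measurableType dO)
  (P : probability Om R) (xi : nat -> Om -> T) (U : nat -> Om -> R) : Prop :=
  (forall i, measurable_fun setT (xi i)) /\ (forall i, measurable_fun setT (U i)) /\
  forall n (A : nat -> set T) (B : nat -> set R),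
    (forall i, measurable (A i)) -> (forall i, measurable (B i)) ->
    P [set om | forall i, (i < n)%N -> A i (xi i om) /\ B i (U i om)] =
    (\prod_(i < n) (fine (mu (A i)) *
        fine (lebesgue_measure (B i `&` [set t | 0 <= t <= 1]))))%:E.

End RealTrees.

Section Trim.
Variable R : realType.

Definition muF_trim (n : nat) (W : ptree) (u : word) : R :=
  (count (fun x => is_leaf W x && prefix u (parent x)) W)%:R / n%:R.
Definition mu_trim (n : nat) (W : ptree) : set word -> \bar R :=
  fun A => ((count (fun x => is_leaf W x && `[< A (parent x) >]) W)%:R / n%:R)%:E.
Definition edge_len (n : nat) (W : ptree) (p : word) : R :=
  `|muF_trim n W (parent p) - muF_trim n W p|.
Definition d_trim (n : nat) (W : ptree) (u v : word) : R :=
  let m := size (lcp u v) in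
  \sum_(m.+1 <= j < (size u).+1) edge_len n W (take j u) +
  \sum_(m.+1 <= j < (size v).+1) edge_len n W (take j v).

Definition gp_close (d1 d2 : measure_display) (M1 : measurableType d1)
  (M2 : measurableType d2) (dist1 : M1 -> M1 -> R) (dist2 : M2 -> M2 -> R)
  (mu1 : set M1 -> \bar R) (mu2 : set M2 -> \bar R) (e : R) : Prop :=
  exists (Rel : set (M1 * M2)) (nu : {measure set (M1 * M2) -> \bar R}),
    [/\ measurable Rel,
        (forall A, measurable A -> nu (A `*` setT) = mu1 A),
        (forall B, measurable B -> nu (setT `*` B) = mu2 B),
        ((1 - e)%:E <= nu Rel)%E &
        forall p q, Rel p -> Rel q -> `|dist1 p.1 q.1 - dist2 p.2 q.2| <= e].

(* Gromov-Prokhorov distance between (M1,dist1,r1,mu1) and (M2,dist2,r2,mu2)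
   (the roots do not enter the definition) *)
Definition gp_dist (d1 d2 : measure_display) (M1 : measurableType d1)
  (M2 : measurableType d2) (dist1 : M1 -> M1 -> R) (r1 : M1) (mu1 : set M1 -> \bar R)
  (dist2 : M2 -> M2 -> R) (r2 : M2) (mu2 : set M2 -> \bar R) : R :=
  inf [set e | 0 < e /\ gp_close dist1 dist2 mu1 mu2 e].

End Trim.

(* Main.v *)
(* Distances in the trimmed tree telescope: between the neighbours of leaves i <> j they
   equal 2 m(F(z)) - m_i - m_j, where z is the meet of xi_i and xi_j, m is the empirical
   measure of the samples and m_i is the empirical mass below the neighbour of leaf i,
   which lies between m(F(xi_i)) and m(F(z')) for the meet z' of xi_i with any other
   sample. In an IP-tree the same formula with mu instead of m gives d(xi_i, xi_j). So
   everything reduces to the uniform closeness of m(F(x)) and mu(F(x)) for x below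
   samples in finitely many small blocks that carry almost all of mu. On a segment
   [r, q] the sets F(x) are superlevel sets of the Gromov product with q, and
   Glivenko-Cantelli applies; finitely many segments suffice. Hence closeness is implied
   by the empirical frequencies of finitely many fixed sets, whose deviations have
   exponentially small probability. These bounds transfer to T_n, and Borel-Cantelli
   concludes. *)

Require Import Defs.
From HB Require Import structures.
From mathcomp Require Import all_boot all_order all_algebra.
From mathcomp Require Import finmap.
From mathcomp Require Import all_classical all_reals all_analysis.
From mathcomp Require Import lra ring zify.
Import Order.TTheory GRing.Theory Num.Theory.
Import numFieldNormedType.Exports.
Set Implicit Arguments. Unset Strict Implicit. Unset Printing Implicit Defensive.
Local Open Scope classical_set_scope.
Local Open Scope ring_scope.

(** * Real trees *)

(** The chain and the samples live on different probability spaces and share only the laws of finite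
    paths, so an almost sure statement about the samples does not carry over as such. What carries
    over is the probability that a single tree is bad, for one n at a time; this is why summable
    bounds are needed rather than a qualitative Glivenko-Cantelli theorem. Plane trees form a
    countable set, so the bad events are measurable without any measurability of the
    Gromov-Prokhorov distance. The distance formula in terms of mu is available only where the IP
    equation holds. Such points are stable under meets ([special_meet]), and meets are the only
    further points that enter. Uniform closeness has two asymmetric halves. An upper bound for
    m(F(x)) survives the enlargement of F(x) to F of a point on a nearby segment. A lower bound does
    not: x itself must then lie on one of the finitely many segments. This can be arranged when
    mu(F(x)) is bounded below, and small masses need no lower bound. *)

Section RealTreeGeometry.
Variables (R : realType) (dT : measure_display) (T : measurableType dT).
Variable (d : T -> T -> R).
Hypothesis Ht : real_tree d.

(** Segments as equations between distances, within reach of linear arithmetic; [segP] is the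
    dictionary. *)
Definition btw (x z y : T) : Prop := d x z + d z y = d x y.

Lemma d_ge0 x y : 0 <= d x y.
Proof. by case: Ht => -[h _] _; exact: h. Qed.
Lemma d0P x y : d x y = 0 <-> x = y.
Proof. by case: Ht => -[_ [h _]] _; exact: h. Qed.
Lemma dxx x : d x x = 0.
Proof. exact/d0P. Qed.
Lemma dC x y : d x y = d y x.
Proof. by case: Ht => -[_ [_ [h _]]] _; exact: h. Qed.
Lemma d_tri y x z : d x z <= d x y + d y z.
Proof. by case: Ht => -[_ [_ [_ h]]] _; exact: h. Qed.

Lemma ex_geodesic x y : exists f, geodesic d x y f.
Proof. by case: Ht => _ [_ [_ /(_ x y)[f [gf _]]]]; exists f. Qed.

Lemma geodesic_btw x y f t : geodesic d x y f -> 0 <= t <= d x y ->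
  d x (f t) = t /\ d (f t) y = d x y - t.
Proof.
move=> [f0 [fd fi]] ht; have D := d_ge0 x y.
split.
  rewrite -[in LHS]f0 fi ?lexx ?D //.
  by rewrite sub0r normrN ger0_norm //; case/andP: ht.
rewrite -[in LHS]fd fi ?lexx ?D //.
by rewrite distrC ger0_norm // subr_ge0; case/andP: ht.
Qed.

(** Geodesics [x, z] and [z, y] concatenate: across the junction, the triangle inequality through z
    bounds distances from above, and the distance from x to y bounds them from below. *)
Lemma btw_geodesic x z y : btw x z y ->
  exists f, geodesic d x y f /\ f (d x z) = z.
Proof.
rewrite /btw => b; have [f gf] := ex_geodesic x z; have [g gg] := ex_geodesic z y.
have p1 := d_ge0 x z; have p2 := d_ge0 z y.
pose k := fun t => if t <= d x z then f t else g (t - d x z).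
have kz : k (d x z) = z by rewrite /k lexx; case: gf => _ [].
exists k; split => //; split; first by rewrite /k p1; case: gf.
split.
  rewrite /k; case: ifPn => [le|_]; last first.
    by rewrite -b [_ + _ - _]addrAC subrr add0r; case: gg => _ [].
  have e0 : d z y = 0 by lra.
  have -> : d x y = d x z by lra.
  by case: gf => _ [-> _]; apply/d0P.
have main s t : 0 <= s -> t <= d x y -> s <= d x z -> d x z < t ->
    d (f s) (g (t - d x z)) = t - s.
  move=> s0 t0 sl tl.
  have [a1 a2] : d x (f s) = s /\ d (f s) z = d x z - s.
    by apply: (geodesic_btw gf); rewrite s0.
  have [b1 b2] : d z (g (t - d x z)) = t - d x z /\
      d (g (t - d x z)) y = d z y - (t - d x z).
    by apply: (geodesic_btw gg); lra.
  have := d_tri z (f s) (g (t - d x z)).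
  have := d_tri (f s) x y; have := d_tri (g (t - d x z)) (f s) y.
  lra.
move=> s t /andP[s0 s1] /andP[t0 t1]; rewrite /k.
case: leP => sl; case: leP => tl.
- by case: gf => _ [_ ->] //; apply/andP.
- by rewrite main // distrC ger0_norm //; lra.
- by rewrite dC main // ger0_norm //; lra.
- case: gg => _ [_ ->]; [|by lra|by lra].
  by congr (`|_|); lra.
Qed.

Lemma segP x y z : seg d x y z <-> btw x z y.
Proof.
split=> [[f [gf [t [ht <-]]]]|b].
  have [h1 h2] := geodesic_btw gf ht; rewrite /btw; lra.
have [f [gf fz]] := btw_geodesic b.
exists f; split => //; exists (d x z); split => //.
have := d_ge0 z y; have := d_ge0 x z; move: b; rewrite /btw; lra.
Qed.

Lemma geodesic_arc x y f : 0 < d x y -> geodesic d x y f ->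
  Defs.arc d x y (fun t => f (t * d x y)).
Proof.
move=> D [f0 [fd fi]]; split; first by rewrite mul0r.
split; first by rewrite mul1r.
have sc (t : R) : 0 <= t <= 1 -> 0 <= t * d x y <= d x y by nra.
split=> [t ht e e0|s t hs ht].
  exists (e / d x y); split; first exact: divr_gt0.
  move=> s hs st; rewrite fi ?sc //.
  rewrite -mulrBl normrM (gtr0_norm D) -ltr_pdivlMr //.
move/(congr1 (fun z => d (f (s * d x y)) z)); rewrite dxx fi ?sc //.
move/esym/eqP; rewrite normr_eq0 subr_eq0 => /eqP st.
by apply: (mulIf _ st); rewrite gt_eqF.
Qed.

(** Unique arcs only give equal images. A point of a geodesic is the value at its distance from x,
    so equal images force equal parametrisations. *)
Lemma geodesic_unique x y f z : geodesic d x y f -> btw x z y -> f (d x z) = z.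
Proof.
move=> gf b.
(* A constant path is not injective, so the case x = y cannot go through [geodesic_arc]. *)
have [D0|D0] := eqVneq (d x y) 0.
  have xz : d x z = 0 by have := d_ge0 x z; have := d_ge0 z y; move: b; rewrite /btw; lra.
  by rewrite xz; case: gf => -> _; apply/d0P.
have D : 0 < d x y by rewrite lt_neqAle eq_sym D0 d_ge0.
case: Ht => _ [_ [_ /(_ x y)[f0 [gf0 uf0]]]].
have on_f0 g t : geodesic d x y g -> 0 <= t <= d x y -> g t = f0 t.
  move=> gg ht.
  have : [set (fun t => g (t * d x y)) t | t in [set t | 0 <= t <= 1]] (g t).
    exists (t / d x y) => /=; last by rewrite divfK // gt_eqF.
    by case/andP: ht => h0 h1; rewrite ler_pdivrMr // mul1r h1 divr_ge0 // ltW.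
  rewrite (uf0 _ (geodesic_arc D gg)) => -[s hs e].
  have [e1 _] := geodesic_btw gg ht; have [e2 _] := geodesic_btw gf0 hs.
  by rewrite -e -[in RHS]e1 -[in RHS]e e2.
have [g [gg <-]] := btw_geodesic b.
have hz : 0 <= d x z <= d x y.
  have := d_ge0 z y; have := d_ge0 x z; move: b; rewrite /btw; lra.
by rewrite (geodesic_btw gg hz).1 !on_f0.
Qed.

Lemma btw_chain x y z z' : btw x z y -> btw x z' y -> d x z <= d x z' ->
  btw x z z'.
Proof.
move=> b b' le; have [f gf] := ex_geodesic x y.
have : d (f (d x z)) (f (d x z')) = d x z' - d x z; last first.
  by rewrite (geodesic_unique gf b) (geodesic_unique gf b') /btw; lra.
case: gf => _ [_ ->].
- by rewrite distrC ger0_norm; lra.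
- have := d_ge0 z y; have := d_ge0 x z; move: b; rewrite /btw; lra.
- have := d_ge0 z' y; have := d_ge0 x z'; move: b'; rewrite /btw; lra.
Qed.

Lemma btw_trans x z' z y : btw x z' z -> btw x z y -> btw x z' y.
Proof.
rewrite /btw => b1 b2; have := d_tri z' x y; have := d_tri z z' y; lra.
Qed.

(* The last common point of the geodesics [r, x] and [r, y]: the concatenation
   of the two remaining pieces is injective, hence is the arc from x to y. *)
Lemma ex_meet r x y : exists m, [/\ btw r m x, btw r m y & btw x m y].
Proof.
have [f gf] := ex_geodesic r x; have [g gg] := ex_geodesic r y.
pose S := [set s : R | 0 <= s <= d r x /\ s <= d r y /\ f s = g s].
have p1 := d_ge0 r x; have p2 := d_ge0 r y.
have S0 : S 0 by split; [lra|split=> //]; case: gf => ->; case: gg => ->.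
have hsS : has_sup S.
  by split; [exists 0|exists (d r x) => s [/andP[_ h] _]].
pose a := sup S.
have a0 : 0 <= a by apply: ub_le_sup => //; case: hsS.
have ax : a <= d r x by apply: ge_sup; [exists 0|move=> s [/andP[_ h] _]].
have ay : a <= d r y by apply: ge_sup; [exists 0|move=> s [_ []]].
have fg : f a = g a.
  apply/d0P/eqP; rewrite eq_le d_ge0 andbT; apply/ler_addgt0Pl => e e0.
  have [s [hs [hs' es]] sa] := sup_adherent (divr_gt0 e0 (ltr0n _ 2)) hsS.
  have sle : s <= a by apply: ub_le_sup => //; case: hsS.
  have := d_tri (f s) (f a) (g a).
  have -> : d (f a) (f s) = a - s.
    by case: gf => _ [_ ->]; rewrite ?a0 ?ax // ger0_norm // subr_ge0.
  rewrite es; have -> : d (g s) (g a) = a - s.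
    case: gg => _ [_ ->]; rewrite ?a0 ?ay //; last by lra.
    by rewrite distrC ger0_norm // subr_ge0.
  rewrite -/a in sa; lra.
have hax : 0 <= a <= d r x by rewrite a0.
have hay : 0 <= a <= d r y by rewrite a0.
have [fx1 fx2] := geodesic_btw gf hax.
have [gy1 gy2] := geodesic_btw gg hay.
have b1 : btw r (f a) x by rewrite /btw; lra.
have b2 : btw r (f a) y by rewrite fg /btw; lra.
exists (f a); split=> //.
have [ex|nx] := eqVneq a (d r x).
  have -> : f a = x by rewrite ex; case: gf => _ [].
  by rewrite /btw dxx add0r.
have [ey|ny] := eqVneq a (d r y).
  have -> : f a = y by rewrite fg ey; case: gg => _ [].
  by rewrite /btw dxx addr0.
have {}nx : a < d r x by rewrite lt_neqAle nx.
have {}ny : a < d r y by rewrite lt_neqAle ny.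
pose L := d r x + d r y - 2 * a.
pose k (u : R) := if u <= d r x - a then f (d r x - u) else g (u - d r x + 2 * a).
have L0 : 0 < L by rewrite /L; lra.
(* The Lipschitz bound will give the continuity of the concatenated path. *)
have kk (s t : R) : 0 <= s <= L -> 0 <= t <= L -> s <= t -> d (k s) (k t) <= t - s.
  rewrite /L /k => hs ht st; case: (leP s (d r x - a)) => sl; case: (leP t (d r x - a)) => tl.
  - case: gf => _ [_ ->]; [|by lra|by lra].
    by rewrite ger0_norm; lra.
  - apply: (le_trans (d_tri (f a) _ _)).
    rewrite [in X in _ + X]fg; case: gf => _ [_ ->]; [|by lra|by lra].
    case: gg => _ [_ ->]; [|by lra|by lra].
    by rewrite [X in _ + X]distrC !ger0_norm; lra.
  - by lra.
  - case: gg => _ [_ ->]; [|by lra|by lra].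
    by rewrite distrC ger0_norm; lra.
have kinj (s t : R) : 0 <= s <= L -> 0 <= t <= L -> s < t -> k s = k t -> False.
  rewrite /L /k => hs ht st; case: (leP s (d r x - a)) => sl; case: (leP t (d r x - a)) => tl.
  - case: gf => _ [_ gi] e; have := gi (d r x - s) (d r x - t).
    rewrite e dxx ger0_norm => [h|]; last by lra.
    have : 0 = d r x - s - (d r x - t) by apply: h; lra.
    lra.
  (* A coincidence of the two pieces happens at a common distance v from r, so v lies in [S],
     against v > a. *)
  - move=> e; set v := t - d r x + 2 * a in e.
    have hv : 0 <= v <= d r y by rewrite /v; lra.
    have hs2 : 0 <= d r x - s <= d r x by lra.
    have [e1 _] := geodesic_btw gf hs2; have [e2 _] := geodesic_btw gg hv.
    have ev : d r x - s = v by rewrite -e1 e e2.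
    have : v <= a.
      apply: ub_le_sup; first by case: hsS.
      split; first by rewrite -ev.
      by split; [case/andP: hv|rewrite -[in LHS]ev].
    rewrite /v; lra.
  - by move=> _; lra.
  - case: gg => _ [_ gi] e.
    have := gi (t - d r x + 2 * a) (s - d r x + 2 * a).
    rewrite e dxx ger0_norm => [h|]; last by lra.
    have : 0 = t - d r x + 2 * a - (s - d r x + 2 * a) by apply: h; lra.
    lra.
have sc (t : R) : 0 <= t <= 1 -> 0 <= t * L <= L by move=> ?; nra.
have ar : Defs.arc d x y (fun t => k (t * L)).
  split; first by rewrite mul0r /k subr_ge0 (ltW nx) subr0; case: gf => _ [].
  split.
    rewrite mul1r /k /L; case: leP => [?|_]; first by exfalso; lra.
    have -> : d r x + d r y - 2 * a - d r x + 2 * a = d r y by lra.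
    by case: gg => _ [].
  split=> [t ht e e0|s t hs ht].
    exists (e / L); split; first exact: divr_gt0.
    move=> s hs; rewrite ltr_pdivlMr // => lt.
    apply: le_lt_trans lt.
    have -> : `|s - t| * L = `|s * L - t * L| by rewrite -mulrBl normrM (gtr0_norm L0).
    case: (leP s t) => st.
      rewrite distrC ger0_norm ?subr_ge0 ?ler_pM2r //.
      by apply: kk; rewrite ?sc // ler_pM2r.
    rewrite dC ger0_norm ?subr_ge0 ?ler_pM2r ?(ltW st) //.
    by apply: kk; rewrite ?sc // ler_pM2r // ltW.
  move=> e; case: (ltgtP s t) => // st.
    by case: (kinj _ _ (sc _ hs) (sc _ ht) _ e); rewrite ltr_pM2r.
  by case: (kinj _ _ (sc _ ht) (sc _ hs) _ (esym e)); rewrite ltr_pM2r.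
case: Ht => _ [_ [_ /(_ x y)[f0 [gf0 uf0]]]].
have : [set (fun t => k (t * L)) t | t in [set t | 0 <= t <= 1]] (f a).
  exists ((d r x - a) / L).
    by rewrite /= divr_ge0 ?ler_pdivrMr // ?mul1r; rewrite /L; lra.
  rewrite divfK ?gt_eqF // /k lexx.
  by congr f; lra.
rewrite (uf0 _ ar) => -[t ht <-].
have [h1 h2] := geodesic_btw gf0 ht; rewrite /btw; lra.
Qed.

End RealTreeGeometry.

(** * Uniform convergence of empirical masses *)

Section RealProbability.
Variables (R : realType) (dT : measure_display) (T : measurableType dT).
Variable mu : probability T R.

Local Notation m A := (fine (mu A)).

Lemma prob_le A B : measurable A -> measurable B -> A `<=` B -> m A <= m B.
Proof.
by move=> mA mB AB; apply: fine_le; rewrite ?fin_num_measure // le_measure ?inE.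
Qed.

Lemma prob_le1 A : measurable A -> m A <= 1.
Proof. by move=> mA; rewrite -lee_fin fineK ?fin_num_measure // probability_le1. Qed.

Lemma prob_bigcup_le (F : nat -> set T) (c : R) : (forall n, measurable (F n)) ->
  nondecreasing_seq F -> (forall n, m (F n) <= c) -> m (\bigcup_n F n) <= c.
Proof.
move=> mF nF Fc; have mU : measurable (\bigcup_n F n) by exact: bigcupT_measurable.
rewrite -lee_fin fineK ?fin_num_measure //.
have cv : mu \o F @ \oo --> mu (\bigcup_n F n) by apply: nondecreasing_cvg_mu.
rewrite -(cvg_lim _ cv) //; apply: lime_le; first exact: (cvgP _ cv).
by apply: nearW => n /=; have := Fc n; rewrite -lee_fin fineK ?fin_num_measure.
Qed.

Lemma prob_bigcap_ge (F : nat -> set T) (c : R) : (forall n, measurable (F n)) ->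
  nonincreasing_seq F -> (forall n, c <= m (F n)) -> c <= m (\bigcap_n F n).
Proof.
move=> mF nF Fc; have mU : measurable (\bigcap_n F n) by exact: bigcapT_measurable.
rewrite -lee_fin fineK ?fin_num_measure //.
have cv : mu \o F @ \oo --> mu (\bigcap_n F n).
  by apply: nonincreasing_cvg_mu => //; rewrite ltey_eq fin_num_measure.
rewrite -(cvg_lim _ cv) //; apply: lime_ge; first exact: (cvgP _ cv).
by apply: nearW => n /=; have := Fc n; rewrite -lee_fin fineK ?fin_num_measure.
Qed.

Definition close_on (emp : set T -> R) (l : seq (set T)) (e : R) : Prop :=
  forall A, A \in l -> `|emp A - m A| <= e.


Lemma ex_inv_lt (e : R) : 0 < e -> exists n, n.+1%:R^-1 < e.
Proof.
move=> e0; exists (Num.truncn e^-1).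
have := truncn_itv (ltW (etrans (invr_gt0 e) e0)) => /andP[_ h].
by rewrite -[ltRHS]invrK ltf_pV2 ?posrE ?invr_gt0.
Qed.

Section TailFunction.
Variables (f : T -> R) (C : R).
Hypothesis mge : forall s, measurable [set y | s <= f y].
Hypothesis mgt : forall s, measurable [set y | s < f y].
Hypothesis f0 : forall y, 0 <= f y.
Hypothesis fC : forall y, f y <= C.

Local Notation G s := (m [set y | s <= f y]).

Lemma tail_anti s t : s <= t -> G t <= G s.
Proof. by move=> st; apply: prob_le => // y /=; exact: le_trans. Qed.

Lemma tail_left_cont s c : (forall t, t < s -> c <= G t) -> c <= G s.
Proof.
move=> H; rewrite (_ : [set y | s <= f y] = \bigcap_n [set y | s - n.+1%:R^-1 <= f y]).
  apply: prob_bigcap_ge => //.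
    move=> a b ab; apply/subsetPset => y /=; apply: le_trans.
    by rewrite lerD2l lerN2 lef_pV2 ?posrE // ler_nat ltnS.
  by move=> n; apply: H; rewrite ltrBlDr ltrDl.
apply/seteqP; split=> y /= h; first by move=> n _ /=; apply: le_trans h; rewrite gerBl.
apply/ler_addgt0Pl => e e0; have [n ne] := ex_inv_lt e0.
by move: (h n Logic.I) ne => /=; move: (n.+1%:R^-1 : R) => v; lra.
Qed.

Lemma strict_tail_le s c : (forall t, s < t -> G t <= c) -> m [set y | s < f y] <= c.
Proof.
move=> H; rewrite (_ : [set y | s < f y] = \bigcup_n [set y | s + n.+1%:R^-1 <= f y]).
  apply: prob_bigcup_le => //.
    move=> a b ab; apply/subsetPset => y /=; apply: le_trans.
    by rewrite lerD2l lef_pV2 ?posrE // ler_nat ltnS.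
  by move=> n; apply: H; rewrite ltrDl.
apply/seteqP; split=> y /= h; last first.
  by case: h => n _ /=; apply: lt_le_trans; rewrite ltrDl.
have [n ne] : exists n, n.+1%:R^-1 < f y - s by apply: ex_inv_lt; rewrite subr_gt0.
by exists n => //=; move: ne; move: (n.+1%:R^-1 : R) => v; lra.
Qed.

(** The upper p-quantile of f. The supremum is attained ([tail_quantile]) because closed tails are
    left continuous in the threshold. *)
Definition quantile (p : R) : R := sup [set s | p <= G s].

Section Quantile.
Variable p : R.
Hypotheses (p0 : 0 < p) (p1 : p <= 1).

Lemma has_sup_quantile : has_sup [set s | p <= G s].
Proof.
split.
  exists 0; rewrite /= (_ : [set y | 0 <= f y] = setT) ?probability_setT //.
  by apply/seteqP; split=> // y _; exact: f0.
exists C => s /= h; rewrite leNgt; apply/negP => Cs.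
move: h; rewrite (_ : [set y | s <= f y] = set0) ?measure0; first by rewrite /= leNgt p0.
by apply/seteqP; split=> y //= /(le_trans) /(_ (fC y)); rewrite leNgt Cs.
Qed.

Lemma le_quantile s : p <= G s -> s <= quantile p.
Proof. by move=> h; apply: ub_le_sup => //; case: has_sup_quantile. Qed.

Lemma tail_quantile : p <= G (quantile p).
Proof.
apply: tail_left_cont => t tq.
have [s /= ps ts] := sup_adherent (etrans (subr_gt0 t (quantile p)) tq) has_sup_quantile.
apply: le_trans ps _; apply: tail_anti.
by move: ts; rewrite -/(quantile p); lra.
Qed.

Lemma strict_tail_quantile : m [set y | quantile p < f y] <= p.
Proof.
apply: strict_tail_le => t qt; rewrite leNgt; apply/negP => /ltW /le_quantile.
by rewrite leNgt qt.
Qed.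

End Quantile.

(** Closed and open tails are both listed: the law of f may have an atom at a quantile, where the
    closed tail has mass at least l/M and the open one at most l/M. *)
Definition tail_brackets (M : nat) : seq (set T) :=
  [seq [set y | quantile (l%:R / M%:R) <= f y] | l <- iota 1 M] ++
  [seq [set y | quantile (l%:R / M%:R) < f y] | l <- iota 1 M].

Lemma tail_brackets_measurable M A : A \in tail_brackets M -> measurable A.
Proof. by rewrite mem_cat => /orP[] /mapP[l _ ->]. Qed.

(** If l/M <= G s < (l+1)/M, the set of y with s <= f y contains the closed tail at the quantile of
    l/M and lies in the open tail at the quantile of (l+1)/M. At l = 0 and at l = M one bracket is
    missing, but there the bounds 0 and 1 suffice. *)
Lemma tail_uniform M (emp : set T -> R) e : (0 < M)%N ->
    (forall A B, A `<=` B -> emp A <= emp B) ->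
    (forall A, 0 <= emp A <= 1) -> close_on emp (tail_brackets M) e ->
  forall s, `|emp [set y | s <= f y] - G s| <= e + M%:R^-1.
Proof.
move=> M0 mono e01 cl s; have M0' : 0 < M%:R :> R by rewrite ltr0n.
have e0 : 0 <= e.
  by apply: le_trans (cl [set y | quantile (1%:R / M%:R) <= f y] _); rewrite ?normr_ge0 // mem_cat;
    apply/orP; left; apply/mapP; exists 1%N; rewrite // mem_iota /= add1n ltnS.
have G0 : 0 <= G s by apply: fine_ge0.
have G1 : G s <= 1 by apply: prob_le1.
pose l := Num.truncn (G s * M%:R).
have /andP[l1 l2] : l%:R <= G s * M%:R < l.+1%:R by apply: truncn_itv; rewrite mulr_ge0 // ltW.
have lM : (l <= M)%N by rewrite -(ler_nat R); apply: le_trans l1 _; rewrite ler_piMl // ltW.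
have E : l.+1%:R / M%:R = l%:R / M%:R + M%:R^-1 :> R by rewrite -natr1 mulrDl mul1r.
have {}l1 : l%:R / M%:R <= G s by rewrite ler_pdivrMr.
have {}l2 : G s < l.+1%:R / M%:R by rewrite ltr_pdivlMr.
have mem k : (0 < k)%N -> (k <= M)%N ->
    `|emp [set y | quantile (k%:R / M%:R) <= f y] - m [set y | quantile (k%:R / M%:R) <= f y]| <= e /\
    `|emp [set y | quantile (k%:R / M%:R) < f y] - m [set y | quantile (k%:R / M%:R) < f y]| <= e.
  move=> k0 kM; have ik : k \in iota 1 M by rewrite mem_iota k0 add1n ltnS.
  by split; apply: cl; rewrite mem_cat; apply/orP; [left|right]; apply/mapP; exists k.
have pk k : (0 < k)%N -> (k <= M)%N -> 0 < (k%:R / M%:R : R) <= 1.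
  by move=> k0 kM; rewrite divr_gt0 ?ltr0n // ler_pdivrMr // mul1r ler_nat.
have /andP[es0 es1] := e01 [set y | s <= f y].
have lower : G s - e - M%:R^-1 <= emp [set y | s <= f y].
  have [l0|l0] := posnP l.
    by move: l2; rewrite l0 mul1r; lra.
  have [+ _] := mem _ l0 lM; rewrite ler_norml => /andP[h _].
  have /andP[q0 q1] := pk _ l0 lM.
  have sq := le_quantile q0 q1 l1; have tq := tail_quantile q0 q1.
  have : emp [set y | quantile (l%:R / M%:R) <= f y] <= emp [set y | s <= f y].
    by apply: mono => y /=; exact: le_trans.
  lra.
have upper : emp [set y | s <= f y] <= G s + e + M%:R^-1.
  have [lM'|lM'] := leqP M l.
    have eq : l = M by apply/eqP; rewrite eqn_leq lM.
    have : 0 <= M%:R^-1 :> R by rewrite invr_ge0 ltW.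
    by move: l1; rewrite eq divff ?gt_eqF //; lra.
  have [_] := mem l.+1 isT lM'; rewrite ler_norml => /andP[_ h].
  have /andP[q0 q1] := pk l.+1 isT lM'.
  have tq := strict_tail_quantile q0 q1.
  have tq' := tail_quantile q0 q1.
  have : emp [set y | s <= f y] <= emp [set y | quantile (l.+1%:R / M%:R) < f y].
    apply: mono => y /=; apply: lt_le_trans; rewrite ltNge; apply/negP => /tail_anti.
    lra.
  lra.
by rewrite ler_norml; lra.
Qed.

End TailFunction.
End RealProbability.

(** * Gromov products and the IP equation *)

Section RootedTree.
Variables (R : realType) (dT : measure_display) (T : measurableType dT).
Variable (d : T -> T -> R).
Hypothesis Ht : real_tree d.
Variable r : T.

Definition gromov (q y : T) : R := (d r y + d r q - d y q) / 2.

Lemma FsetP x y : Fset d r x y <-> btw d r x y.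
Proof. exact: segP. Qed.

Lemma Fset_root : Fset d r r = setT.
Proof. by apply/seteqP; split=> // y _; apply/FsetP; rewrite /btw dxx // add0r. Qed.

Lemma btw_root x : btw d r r x.
Proof. by rewrite /btw dxx // add0r. Qed.

Lemma btw_end x y : btw d x y y.
Proof. by rewrite /btw dxx // addr0. Qed.

Lemma Fset_sub x y : btw d r x y -> Fset d r y `<=` Fset d r x.
Proof. by move=> xy z /FsetP yz; apply/FsetP; exact: (btw_trans Ht xy yz). Qed.

Lemma gromov_meet q y m : btw d r m q -> btw d r m y -> btw d q m y ->
  gromov q y = d r m.
Proof.
by rewrite /gromov /btw (dC Ht y q) (dC Ht q m) => *; lra.
Qed.

(** The meet m of q and y lies on [r, q], as x does; if [d r x <= d r m], then x lies on [r, m] and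
    so on [r, y]. *)
Lemma Fset_gromov q x : btw d r x q -> Fset d r x = [set y | d r x <= gromov q y].
Proof.
move=> xq; apply/seteqP; split=> y /=.
  move/FsetP; move: xq; rewrite /gromov /btw.
  have := d_tri Ht x y q; rewrite (dC Ht y x); lra.
have [m [mq my qy]] := ex_meet Ht r q y.
rewrite (gromov_meet mq my qy) => le; apply/FsetP.
exact: (btw_trans Ht (btw_chain Ht xq mq le) my).
Qed.

Lemma btw_total x y w : btw d r x w -> btw d r y w -> btw d r x y \/ btw d r y x.
Proof.
move=> xw yw; case: (leP (d r x) (d r y)) => [|/ltW] le.
  by left; exact: (btw_chain Ht xw yw le).
by right; exact: (btw_chain Ht yw xw le).
Qed.

Lemma gromov_lip q x y : `|gromov q x - gromov q y| <= d x y.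
Proof.
rewrite /gromov ler_norml.
have := d_tri Ht x r y; have := d_tri Ht y r x.
have := d_tri Ht y x q; have := d_tri Ht x y q.
rewrite (dC Ht y x); lra.
Qed.

Lemma dist_lip q x y : `|d q x - d q y| <= d x y.
Proof.
rewrite ler_norml.
have := d_tri Ht x q y; have := d_tri Ht y q x; rewrite (dC Ht y x); lra.
Qed.

Lemma meet_below x y z m : btw d r m x -> btw d r m y -> btw d x m y ->
  btw d r z x -> btw d r z y -> btw d r z m.
Proof.
move=> mx my xy zx zy; apply: (btw_chain Ht zx mx).
rewrite -(gromov_meet mx my xy).
by have /FsetP := zy; rewrite (Fset_gromov zx).
Qed.

(** A meet other than x, y and r separates these three points. This brings meets under the IP
    equation, which is only given at branchpoints and on the closed support. *)
Lemma meet_branchpoint x y m : btw d r m x -> btw d r m y -> btw d x m y ->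
  [\/ m = x, m = y, m = r | is_branchpoint d m].
Proof.
move=> mx my xy.
have [e|/eqP nx] := eqVneq m x; first by constructor 1.
have [e|/eqP ny] := eqVneq m y; first by constructor 2.
have [e|/eqP nr] := eqVneq m r; first by constructor 3.
constructor 4; exists x, y, r; split.
  by split; exact: nesym.
by split; apply/(segP Ht) => //; move: mx my; rewrite /btw !(dC Ht _ r) !(dC Ht _ m); lra.
Qed.

Section Borel.
Hypothesis Hb : borel_of_d d.

Lemma d_open_measurable A : d_open d A -> measurable A.
Proof. by move=> oA; rewrite Hb; exact: sub_sigma_algebra. Qed.

Section Lipschitz.
Variable f : T -> R.
Hypothesis flip : forall x y, `|f x - f y| <= d x y.

Lemma lip_lt_measurable s : measurable [set y | f y < s].
Proof.
apply: d_open_measurable => x /= fx; exists (s - f x); split; first by lra.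
by move=> y xy; have := flip x y; rewrite ler_norml; lra.
Qed.

Lemma lip_gt_measurable s : measurable [set y | s < f y].
Proof.
apply: d_open_measurable => x /= fx; exists (f x - s); split; first by lra.
by move=> y xy; have := flip x y; rewrite ler_norml; lra.
Qed.

Lemma lip_ge_measurable s : measurable [set y | s <= f y].
Proof.
rewrite -[X in measurable X]setCK; apply: measurableC.
rewrite (_ : ~` _ = [set y | f y < s]); first exact: lip_lt_measurable.
by apply/seteqP; split=> y /=; rewrite ltNge => /negP.
Qed.

End Lipschitz.

Lemma gromov_ge_measurable q s : measurable [set y | s <= gromov q y].
Proof. exact: lip_ge_measurable (gromov_lip q) _. Qed.

Lemma gromov_gt_measurable q s : measurable [set y | s < gromov q y].
Proof. exact: lip_gt_measurable (gromov_lip q) _. Qed.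

Lemma Fset_measurable x : measurable (Fset d r x).
Proof. by rewrite (Fset_gromov (btw_end r x)); exact: gromov_ge_measurable. Qed.

Lemma dball_measurable x e : measurable (dball d x e).
Proof. exact: lip_lt_measurable (dist_lip x) _. Qed.

Variable mu : probability T R.

Definition massF x : R := fine (mu (Fset d r x)).
(** The IP equation at x. In an IP-tree it holds at the root, at branchpoints, on the closed
    support, and at meets of special points ([special_meet]). *)
Definition special x : Prop := d r x + massF x = 1.

Lemma massF_ge0 x : 0 <= massF x.
Proof. by apply: fine_ge0. Qed.

Lemma special_root : special r.
Proof. by rewrite /special /massF dxx // Fset_root probability_setT add0r. Qed.

Hypothesis HIP : IP_tree d r mu.

Lemma special_IP x : is_branchpoint d x \/ closed_support d mu x -> special x.
Proof.
move=> /(proj2 HIP) H; rewrite /special /massF.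
have : (d r x)%:E + (fine (mu (Fset d r x)))%:E = 1%E :> \bar R.
  by rewrite fineK // fin_num_measure //; exact: Fset_measurable.
by rewrite -EFinD => -[].
Qed.

Lemma special_meet x y m : special x -> special y ->
  btw d r m x -> btw d r m y -> btw d x m y -> special m.
Proof.
move=> sx sy mx my xy; case: (meet_branchpoint mx my xy) => [->|->|->|b] //.
  exact: special_root.
by apply: special_IP; left.
Qed.

Lemma special_dist x y m : special x -> special y ->
  btw d r m x -> btw d r m y -> btw d x m y ->
  d x y = 2 * massF m - massF x - massF y.
Proof.
move=> sx sy mx my xy; have sm := special_meet sx sy mx my xy.
move: sx sy sm mx my xy; rewrite /special /btw (dC Ht x m) => *; lra.
Qed.

(** Trades x on [r, y] for a special point m on [r, z] at the cost [d y z]: m is x itself if x lies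
    between r and the meet of y and z, and that meet otherwise. *)
Lemma special_near x y z : special x -> special y -> special z ->
    btw d r x y ->
  exists m, [/\ btw d r m z, btw d r m x, special m & d r x <= d r m + d y z].
Proof.
move=> sx sy sz xy; have [m [my mz yz]] := ex_meet Ht r y z.
have dyz : d r y <= d r m + d y z.
  move: my mz yz; rewrite /btw (dC Ht y m).
  by have := d_ge0 Ht m z; lra.
case: (leP (d r x) (d r m)) => le.
  exists x; split => //; last by rewrite lerDl d_ge0.
  - exact: (btw_trans Ht (btw_chain Ht xy my le) mz).
  - exact: btw_end.
exists m; split=> //.
- exact: (btw_chain Ht my xy (ltW le)).
- exact: special_meet my mz yz.
- by move: xy; rewrite /btw; have := d_ge0 Ht x y; lra.
Qed.

Definition gc (emp : set T -> R) (e : R) (q : T) : Prop :=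
  forall s, `|emp [set y | s <= gromov q y] - fine (mu [set y | s <= gromov q y])| <= e.

Lemma gc_lower emp e q x : gc emp e q -> btw d r x q ->
  massF x - e <= emp (Fset d r x).
Proof.
by move=> g xq; rewrite /massF (Fset_gromov xq); have := g (d r x); rewrite ler_norml; lra.
Qed.

(** F(x) is contained in F(m) for a special m on [r, q] even if x is off that segment; by the IP
    equation the masses differ by the difference of heights, at most [d y q]. *)
Lemma gc_upper (emp : set T -> R) e q x y :
    (forall A B, A `<=` B -> emp A <= emp B) -> gc emp e q ->
    special x -> special y -> special q -> btw d r x y -> d y q <= e ->
  emp (Fset d r x) <= massF x + 2 * e.
Proof.
move=> mono g sx sy sq xy yq.
have [m [mq mx sm le]] := special_near sx sy sq xy.
apply: le_trans (mono _ _ (Fset_sub mx)) _.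
have := g (d r m); rewrite -(Fset_gromov mq) -/(massF m) ler_norml.
move: sx sm; rewrite /special; lra.
Qed.

End Borel.
End RootedTree.

(** * Finitely many segments for heavy descendant sets *)

Section Tops.
Variables (R : realType) (dT : measure_display) (T : measurableType dT).
Variable (d : T -> T -> R).
Hypothesis Ht : real_tree d.
Hypothesis Hb : borel_of_d d.
Variable r : T.
Variable mu : probability T R.
Local Notation m A := (fine (mu A)).
Local Notation massF := (massF d r mu).

Lemma gromov_ge0 q y : 0 <= gromov d r q y.
Proof. by rewrite /gromov; have := d_tri Ht r y q; rewrite (dC Ht y r); lra. Qed.

Lemma gromov_le q y : gromov d r q y <= d r q.
Proof. by rewrite /gromov; have := d_tri Ht q r y; rewrite (dC Ht q y); lra. Qed.

(** On a chain, distances are differences of heights, so points whose heights approach the supremum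
    form a Cauchy sequence; completeness gives the limit. *)
Lemma tree_chain_sup (A : set T) : A !=set0 ->
    (forall x y, A x -> A y -> btw d r x y \/ btw d r y x) ->
    (forall x, A x -> d r x <= 1) ->
  exists y, [/\ (forall x, A x -> btw d r x y), d r y <= 1 &
    forall s, s < d r y -> exists2 x, A x & s < d r x].
Proof.
move=> [a0 Aa0] tot le1.
have hsA : has_sup [set d r x | x in A].
  by split; [exists (d r a0); exists a0|exists 1 => _ [x Ax <-]; exact: le1].
pose H := sup [set d r x | x in A].
have leH x : A x -> d r x <= H.
  by move=> Ax; apply: ub_le_sup; [case: hsA|exists x].
have H1 : H <= 1 by apply: ge_sup; [case: hsA|move=> _ [x Ax <-]; exact: le1].
have ex n : exists x, A x /\ H - n.+1%:R^-1 < d r x.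
  have n0 : 0 < n.+1%:R^-1 :> R by [].
  by have [_ [x Ax <-] h] := sup_adherent n0 hsA; exists x.
have [u Hu] := choice ex.
have dist x y : A x -> A y -> d x y = `|d r x - d r y|.
  move=> Ax Ay; case: (tot _ _ Ax Ay); rewrite /btw => h.
    by rewrite distrC ger0_norm; have := d_ge0 Ht x y; lra.
  by rewrite (dC Ht x y) ger0_norm; have := d_ge0 Ht y x; lra.
have cu : d_cauchy d u.
  move=> e e0; have [N Ne] := @ex_inv_lt R e e0; exists N => i j Ni Nj.
  have [Ai hi] := Hu i; have [Aj hj] := Hu j.
  have li := leH _ Ai; have lj := leH _ Aj.
  have inv k : (N <= k)%N -> k.+1%:R^-1 <= N.+1%:R^-1 :> R.
    by move=> ?; rewrite lef_pV2 ?posrE // ler_nat ltnS.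
  move: (inv _ Ni) (inv _ Nj) Ne hi hj; rewrite (dist _ _ Ai Aj).
  move: (N.+1%:R^-1 : R) (i.+1%:R^-1 : R) (j.+1%:R^-1 : R) => v1 v2 v3 *.
  by rewrite ltr_norml; lra.
have [y Hy] := (proj1 (proj2 Ht)) _ cu.
have approx e : 0 < e -> exists n, d (u n) y < e /\ H - e < d r (u n).
  move=> e0; have [N1 N1e] := @ex_inv_lt R e e0; have [N2 N2e] := Hy _ e0.
  exists (maxn N1 N2); split; first by apply: N2e; rewrite leq_maxr.
  have [_] := Hu (maxn N1 N2); apply: le_lt_trans; rewrite lerD2l lerN2.
  by apply: le_trans (ltW N1e); rewrite lef_pV2 ?posrE // ler_nat ltnS leq_maxl.
have yH : d r y = H.
  apply/eqP; rewrite eq_le; apply/andP; split; apply/ler_addgt0Pl => e e0.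
    have [n [h1 h2]] := approx _ e0; have := leH _ (Hu n).1.
    have := d_tri Ht (u n) r y; lra.
  have e2 : 0 < e / 2 by lra.
  have [n [h1 h2]] := approx _ e2.
  have := d_tri Ht y r (u n); rewrite (dC Ht y); lra.
exists y; split.
- move=> x Ax; rewrite /btw; apply/eqP; rewrite eq_le (d_tri Ht x) andbT yH.
  apply/ler_addgt0Pl => e e0; have e2 : 0 < e / 2 by lra.
  have [n [h1 h2]] := approx _ e2.
  have := dist _ _ Ax (Hu n).1; have := d_tri Ht (u n) x y.
  have := leH _ Ax; have := leH _ (Hu n).1.
  by case: (ger0P (d r x - d r (u n))) => h *; lra.
- by rewrite yH.
- move=> s; rewrite yH => sH; have [n [_ h]] := approx (H - s) (etrans (subr_gt0 s H) sH).
  by exists (u n); [exact: (Hu n).1|lra].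
Qed.

Section Threshold.
Variable eta : R.
Hypothesis eta0 : 0 < eta.

(** The height bound holds at every special point and keeps chains bounded. *)
Definition heavy (x : T) : Prop := d r x <= 1 /\ eta <= massF x.

(** Heaviness survives the limit y: along [r, y] the mass of F is a tail of the Gromov product with
    y, and tails are left continuous. *)
Lemma heavy_chain_sup (A : set T) : A !=set0 ->
    (forall x y, A x -> A y -> btw d r x y \/ btw d r y x) ->
    (forall x, A x -> heavy x) ->
  exists y, heavy y /\ forall x, A x -> btw d r x y.
Proof.
move=> A0 tot hA.
have [y [By y1 ys]] := tree_chain_sup A0 tot (fun x Ax => (hA x Ax).1).
exists y; split=> //; split=> //.
rewrite /massF (Fset_gromov Ht (btw_end Ht r y)).
apply: tail_left_cont => [s|t ty]; first exact: gromov_ge_measurable.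
have [x Ax tx] := ys _ ty.
apply: le_trans (hA x Ax).2 _; rewrite /massF (Fset_gromov Ht (By _ Ax)).
by apply: tail_anti (ltW tx) => s; exact: gromov_ge_measurable.
Qed.

Lemma heavy_max x : heavy x -> exists y, [/\ heavy y, btw d r x y &
  forall z, heavy z -> btw d r y z -> z = y].
Proof.
move=> hx; pose X := {z : T | heavy z /\ btw d r x z}.
pose Rl (a b : X) := `[< btw d r (sval a) (sval b) >].
have anti (a b : T) : btw d r a b -> btw d r b a -> a = b.
  move=> ab ba; apply/(d0P Ht); have := d_ge0 Ht a b.
  by move: ab ba; rewrite /btw (dC Ht b a); lra.
have [|||A tot|t Ht'] := @Zorn X Rl.
- by move=> t; apply/asboolP; exact: btw_end.
- by move=> a b c /asboolP ab /asboolP bc; apply/asboolP; exact: btw_trans ab bc.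
- move=> [a Ha] [b Hb'] /asboolP /= ab /asboolP /= ba.
  have e := anti _ _ ab ba; subst b.
  by congr exist; exact: Prop_irrelevance.
- have [[a Aa]|nA] := pselect (A !=set0); last first.
    exists (exist _ x (conj hx (btw_end Ht r x))) => s As.
    by case: nA; exists s.
  pose A' := [set sval s | s in A].
  have [||| y [hy By]] := @heavy_chain_sup A'.
  + by exists (sval a), a.
  + move=> _ _ [s As <-] [t At <-].
    by have [/asboolP h|/asboolP h] := tot s t As At; [left|right].
  + by move=> _ [s As <-]; case: (svalP s).
  have xy : btw d r x y.
    have ay : btw d r (sval a) y by apply: By; exists a.
    exact: (btw_trans Ht (proj2 (svalP a)) ay).
  exists (exist _ y (conj hy xy)) => s As; apply/asboolP => /=.
  by apply: By; exists s.
exists (sval t); case: (svalP t) => ht xt; split=> // z hz tz.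
have := Ht' (exist _ z (conj hz (btw_trans Ht xt tz))).
by move=> /(_ (asboolT tz)) /(congr1 sval).
Qed.

(** Distinct maximal heavy points have disjoint descendant sets, each of mass at least [eta], so
    there are at most 1/eta of them. *)
Lemma heavy_finite_tops : exists Y : seq T,
  forall x, heavy x -> exists2 y, y \in Y & btw d r x y.
Proof.
pose U (l : seq T) := [set z | exists2 y, y \in l & Fset d r y z].
have UC y l : U (y :: l) = Fset d r y `|` U l.
  apply/seteqP; split=> z.
    move=> [w]; rewrite inE => /orP[/eqP->|wl] h; first by left.
    by right; exists w.
  move=> [h|[w wl h]]; first by exists y; rewrite ?mem_head.
  by exists w; rewrite // inE wl orbT.
have mU l : measurable (U l).
  elim: l => [|y l IH]; first by rewrite (_ : U [::] = set0) //; apply/seteqP; split=> z [].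
  by rewrite UC; apply: measurableU => //; exact: Fset_measurable.
apply: contrapT => nY.
have step N : exists l : seq T, [/\ size l = N,
    (forall y, y \in l -> heavy y /\ forall z, heavy z -> btw d r y z -> z = y) &
    eta * N%:R <= m (U l)].
  elim: N => [|N [l [sl hl ml]]].
    by exists [::]; split=> //; rewrite mulr0; exact: fine_ge0.
  have [x hx nx] : exists2 x, heavy x & forall y, y \in l -> ~ btw d r x y.
    apply: contrapT => h; apply: nY; exists l => x hx.
    apply: contrapT => h'; apply: h; exists x => // y yl xy.
    by apply: h'; exists y.
  have [y [hy xy ymax]] := heavy_max hx.
  exists (y :: l); split; first by rewrite /= sl.
    by move=> w; rewrite inE => /orP[/eqP->|/hl //].
  rewrite UC measureU //; last first.
    - rewrite -subset0 => z [/(FsetP Ht) yz [w wl /(FsetP Ht) wz]].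
      have [yw|wy] := btw_total Ht yz wz.
        by apply: (nx w wl); exact: btw_trans xy yw.
      have e := (hl _ wl).2 _ hy wy.
      by apply: (nx w wl); rewrite -e.
    - exact: Fset_measurable.
  rewrite fineD ?fin_num_measure //; last exact: Fset_measurable.
  by rewrite -natr1 mulrDr mulr1 addrC lerD //; case: hy.
have [l [_ _ h]] := step (Num.truncn eta^-1).+1.
have h1 := prob_le1 mu (mU l).
have /andP[_ h2] := truncn_itv (ltW (etrans (invr_gt0 eta) eta0)).
have := le_trans h h1; apply/negP; rewrite -ltNge.
by rewrite -ltr_pdivrMl // mulr1.
Qed.

End Threshold.
End Tops.

Lemma find_iotaP (p : pred nat) (K k : nat) : (k < K)%N ->
  find p (iota 0 K) = k <-> p k /\ forall j, (j < k)%N -> ~~ p j.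
Proof.
move=> kK; split.
  move=> fk; have h : has p (iota 0 K) by rewrite has_find fk size_iota.
  split; first by have := nth_find 0%N h; rewrite fk nth_iota.
  move=> j jk; have := @before_find _ 0%N p (iota 0 K) j.
  by rewrite fk => /(_ jk); rewrite nth_iota ?add0n ?(ltn_trans jk) // => ->.
move=> [pk nj]; have h : has p (iota 0 K).
  by apply/hasP; exists k; rewrite // mem_iota.
have lt : (find p (iota 0 K) < K)%N by move: h; rewrite has_find size_iota.
case: (ltngtP (find p (iota 0 K)) k) => // fk.
  by have := nth_find 0%N h; rewrite nth_iota // add0n; apply: contraTeq; rewrite (negbTE (nj _ fk)).
have := before_find 0%N fk; rewrite nth_iota ?add0n ?pk //.
Qed.

Lemma measure_bigcup0 (R : realType) (dT : measure_display) (T : measurableType dT)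
    (mu : {measure set T -> \bar R}) (F : nat -> set T) :
  (forall n, measurable (F n)) -> (forall n, mu (F n) = 0%E) -> mu (\bigcup_n F n) = 0%E.
Proof.
move=> mF F0; apply/eqP; rewrite eq_le measure_ge0 andbT.
apply: le_trans (measure_sigma_subadditive _ _ _ (@subset_refl _ _)) _ => //.
  exact: bigcupT_measurable.
by rewrite eseries0.
Qed.

(** * Small blocks and uniform closeness *)

Section Blocks.
Variables (R : realType) (dT : measure_display) (T : measurableType dT).
Variable (d : T -> T -> R).
Hypothesis Ht : real_tree d.
Hypothesis Hb : borel_of_d d.
Variable r : T.
Variable mu : probability T R.
Local Notation m A := (fine (mu A)).
Local Notation massF := (massF d r mu).
Local Notation S := (closed_support d mu).

(** By separability the complement is a countable union of null balls, with centres in the dense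
    sequence and radii of the form 1/(k+1). *)
Lemma closed_support_full : measurable S /\ m S = 1.
Proof.
have [D HD] := proj1 (proj2 (proj2 Ht)).
pose v k : R := k.+1%:R^-1.
have v0 k : 0 < v k by rewrite /v invr_gt0.
pose V n k := if `[< mu (dball d (D n) (v k)) = 0%E >] then dball d (D n) (v k) else set0.
have mV n k : measurable (V n k).
  by rewrite /V; case: ifPn => _ //; exact: dball_measurable.
have SV : ~` S = \bigcup_n \bigcup_k V n k.
  apply/seteqP; split=> y.
    move=> nSy; apply: contrapT => nV; apply: nSy => e e0.
    rewrite lt_neqAle measure_ge0 andbT; apply/negP => /eqP e'.
    apply: nV; have e2 : 0 < e / 2 by lra.
    have [k ke] := ex_inv_lt e2; rewrite -/(v k) in ke.
    have [n yn] := HD y _ (v0 k).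
    have sub : dball d (D n) (v k) `<=` dball d y e.
      by move=> z; rewrite /dball /= => h; have := d_tri Ht (D n) y z; lra.
    exists n => //; exists k => //; rewrite /V asboolT /dball /=.
      by rewrite (dC Ht).
    apply/eqP; rewrite eq_le measure_ge0 andbT e'.
    by apply: le_measure; rewrite ?inE //; exact: dball_measurable.
  move=> [n _ [k _]]; rewrite /V; case: ifPn => // /asboolP nul; rewrite /dball /= => yb Sy.
  have e0 : 0 < v k - d (D n) y by lra.
  have := Sy _ e0; apply/negP; rewrite -leNgt -nul.
  apply: le_measure; rewrite ?inE; [exact: dball_measurable|exact: dball_measurable|].
  by move=> z; rewrite /dball /= => yz; have := d_tri Ht y (D n) z; lra.
have mS : measurable S.
  rewrite -[X in measurable X]setCK SV; apply: measurableC.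
  by apply: bigcupT_measurable => n; exact: bigcupT_measurable.
split=> //; rewrite -[X in mu X]setCK SV probability_setC; last first.
  by apply: bigcupT_measurable => n; exact: bigcupT_measurable.
rewrite measure_bigcup0 ?sube0 // => n; first exact: bigcupT_measurable.
apply: measure_bigcup0 => // k; rewrite /V; case: ifPn => [/asboolP //|_].
exact: measure0.
Qed.

(** A block collects the points of the closed support with the same first ball in a finite list of
    balls of radius e/2. The value K marks the remainder. Blocks of mass 0 are moved there too:
    later, every other block that contains a sample must contain a second one. *)
Lemma ex_small_blocks (e : R) : 0 < e -> exists (K : nat) (kappa : T -> nat),
  [/\ forall k, measurable [set y | kappa y = k],
      forall y, (kappa y <= K)%N,
      1 - e <= m [set y | (kappa y < K)%N],
      forall y, (kappa y < K)%N -> S y /\ 0 < m [set z | kappa z = kappa y] &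
      forall y z, kappa y = kappa z -> (kappa y < K)%N -> d y z < e].
Proof.
move=> e0; have [D HD] := proj1 (proj2 (proj2 Ht)).
have [mS mS1] := closed_support_full.
have e2 : 0 < e / 2 by lra.
pose b n := dball d (D n) (e / 2).
have mb n : measurable (b n) by exact: dball_measurable.
pose E n := S `&` \bigcup_(k in `I_n) b k.
have mE n : measurable (E n).
  by apply: measurableI => //; apply: bigcup_measurable.
have [K HK] : exists K, 1 - e < m (E K).
  apply: contrapT => nK.
  have : m (\bigcup_n E n) <= 1 - e.
    apply: prob_bigcup_le => //.
      move=> i j ij; apply/subsetPset; apply: setIS.
      by apply: bigcup_sub => k /= ki y; exists k => //=; exact: leq_trans ki ij.
    by move=> n; rewrite leNgt; apply/negP => h; apply: nK; exists n.
  rewrite (_ : \bigcup_n E n = S) ?mS1; first by lra.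
  apply/seteqP; split=> y; first by move=> [n _ []].
  move=> Sy; have [n yn] := HD y _ e2; exists n.+1 => //; split=> //.
  by exists n => /=; rewrite ?ltnSn // /b /dball /= (dC Ht).
pose k0 y := if `[< E K y >] then find (fun k => `[< b k y >]) (iota 0 K) else K.
have k0E k : (k < K)%N -> [set y | k0 y = k] = (E K `&` b k) `\` \bigcup_(j in `I_k) b j.
  move=> kK; apply/seteqP; split=> y; rewrite /k0 /=.
    case: asboolP => [Ey /(find_iotaP _ kK)[/asboolP bk nj]|_ e']; last first.
      by move: kK; rewrite -e' ltnn.
    by split=> // -[j /= /nj /asboolP].
  move=> [[Ey bk] nj]; rewrite asboolT //; apply/(find_iotaP _ kK); split.
    exact/asboolP.
  by move=> j jk; apply/asboolP => bj; apply: nj; exists j.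
have k0lt y : E K y -> (k0 y < K)%N.
  move=> Ey; rewrite /k0 asboolT // -[X in (_ < X)%N](size_iota 0) -has_find.
  apply/hasP; case: Ey => _ [k /= kK bk]; exists k; last exact/asboolP.
  by rewrite mem_iota.
have mk0 k : (k < K)%N -> measurable [set y | k0 y = k].
  move=> kK; rewrite k0E //; apply: measurableD; first exact: measurableI.
  exact: bigcup_measurable.
pose kappa y := if (k0 y < K)%N && (0 < m [set z | k0 z = k0 y]) then k0 y else K.
have kE k : (k < K)%N -> [set y | kappa y = k] =
    if 0 < m [set z | k0 z = k] then [set z | k0 z = k] else set0.
  move=> kK; apply/seteqP; split=> y; rewrite /kappa /=.
    case: ifPn => [/andP[_ h] e'|_ e']; first by rewrite -e' h.
    by move: kK; rewrite -e' ltnn.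
  by case: ifPn => //= h e'; rewrite e' kK h.
have kle y : (kappa y <= K)%N by rewrite /kappa; case: ifPn => // /andP[/ltnW].
have mk k : (k < K)%N -> measurable [set y | kappa y = k].
  by move=> kK; rewrite kE //; case: ifP => // _; exact: mk0.
have ltE : [set y | (kappa y < K)%N] = \bigcup_(k in `I_K) [set y | kappa y = k].
  by apply/seteqP; split=> y /= => [h|[k /= kK ->] //]; exists (kappa y).
have mlt : measurable [set y | (kappa y < K)%N].
  by rewrite ltE; apply: bigcup_measurable => k /= /mk.
have klt y : (kappa y < K)%N -> (k0 y < K)%N /\ kappa y = k0 y.
  by rewrite /kappa; case: ifPn => [/andP[]|_]; rewrite ?ltnn.
exists K, kappa; split=> //.
- move=> k; case: (ltngtP k K) => [/mk //|kK|->].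
    rewrite (_ : [set _ | _] = set0) //; apply/seteqP; split=> y //= e'.
    by have := kle y; rewrite e' leqNgt kK.
  rewrite (_ : [set _ | _] = ~` [set y | (kappa y < K)%N]); first exact: measurableC.
  apply/seteqP; split=> y /=; first by move=> ->; rewrite ltnn.
  by move=> /negP; rewrite -leqNgt => h; apply/eqP; rewrite eqn_leq kle.
(* Moving the null blocks into the remainder loses no mass. *)
- pose N k := if (k < K)%N && ~~ (0 < m [set z | k0 z = k]) then [set z | k0 z = k] else set0.
  have mN k : measurable (N k) by rewrite /N; case: ifPn => // /andP[/mk0].
  have N0 : mu (\bigcup_k N k) = 0%E.
    apply: measure_bigcup0 => // k; rewrite /N; case: ifPn => [/andP[kK]|_]; last exact: measure0.
    rewrite -leNgt -lee_fin fineK; last by rewrite fin_num_measure; last exact: mk0.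
    move=> h.
    by apply/eqP; rewrite eq_le h /= measure_ge0.
  have : (mu (E K) <= mu ([set y | (kappa y < K)%N] `|` \bigcup_k N k))%E.
    apply: le_measure; rewrite ?inE //.
      by apply: measurableU => //; exact: bigcupT_measurable.
    move=> y /k0lt k0K; rewrite /kappa /=.
    have [h|h] := boolP (0 < m [set z | k0 z = k0 y]).
      by left; rewrite /= !k0K.
    by right; exists (k0 y) => //; rewrite /N k0K h.
  move/le_trans => /(_ _ (measureU2 _ _ _)) => h.
  apply: le_trans (ltW HK) _; apply: fine_le; rewrite ?fin_num_measure //.
  rewrite -[X in (_ <= X)%E]adde0 -N0; apply: h => //.
  exact: bigcupT_measurable.
- move=> y yK; have [k0K e'] := klt y yK.
  have : [set z | k0 z = k0 y] y by [].
  rewrite k0E // => -[[[Sy _] _] _]; split=> //.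
  rewrite (kE _ yK) e'; case: ifPn => // h.
  by move: yK; rewrite /kappa (negbTE h) andbF ltnn.
- move=> y z e' yK; have [k0K ey] := klt y yK.
  have zK : (kappa z < K)%N by rewrite -e'.
  have [_ ez] := klt z zK.
  have : [set z | k0 z = k0 y] y by [].
  have : [set z | k0 z = k0 y] z by rewrite /= -ez -e'.
  rewrite k0E // => -[[_ bz] _] [[_ by'] _].
  move: bz by'; rewrite /b /dball /=.
  by have := d_tri Ht (D (k0 y)) y z; rewrite (dC Ht y (D _)); lra.
Qed.

(* For x near a block representative q, the meet of x and q lies on [r, q] and bounds
   the empirical mass of F(x) from above. It is useless for a lower bound when x
   branches off [r, q]; if F(x) is heavy, x lies below one of finitely many tops. *)
Lemma uniform_Fset (HIP : IP_tree d r mu) (e : R) : 0 < e ->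
  exists (K : nat) (kappa : T -> nat),
  [/\ forall k, measurable [set y | kappa y = k],
      forall y, (kappa y <= K)%N,
      1 - e <= m [set y | (kappa y < K)%N],
      forall y, (kappa y < K)%N -> S y /\ 0 < m [set z | kappa z = kappa y] &
      forall y z, kappa y = kappa z -> (kappa y < K)%N -> d y z < e] /\
  exists l : seq (set T), (forall A, A \in l -> measurable A) /\
    forall emp : set T -> R, (forall A B, A `<=` B -> emp A <= emp B) ->
      (forall A, 0 <= emp A <= 1) -> close_on mu emp l e ->
    forall x y, special d r mu x -> btw d r x y -> (kappa y < K)%N ->
      `|emp (Fset d r x) - massF x| <= 4 * e.
Proof.
move=> e0; have [K [kappa Hk]] := ex_small_blocks e0.
exists K, kappa; split=> //; case: Hk => mk kle mlt kS kd.
(* For an empty block the point [r] is an arbitrary choice: the bounds below use only the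
   representative of a block that contains y. *)
have exc k : exists c, (exists y, kappa y = k) -> kappa c = k.
  by have [[y h]|h] := pselect (exists y, kappa y = k); [exists y|exists r].
have [c Hc] := choice exc.
have [Y HY] := heavy_finite_tops Ht Hb r mu e0.
have [n ne] := ex_inv_lt e0.
pose br q := tail_brackets mu (gromov d r q) n.+1.
(* The tops serve the lower bound, the block representatives the upper one. *)
pose Q := Y ++ [seq c k | k <- iota 0 K].
exists (flatten [seq br q | q <- Q]); split.
  move=> A /flatten_mapP[q _]; apply: tail_brackets_measurable => s.
    exact: gromov_ge_measurable.
  exact: gromov_gt_measurable.
move=> emp mono e01 cl.
(* One [e] comes from the brackets, the other bounds the quantile mesh 1/(n+1). *)
have gcQ q : q \in Q -> gc d r mu emp (2 * e) q.
  move=> qQ s; have := @tail_uniform _ _ _ mu _ _ (gromov_ge_measurable Ht r Hb q)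
    (gromov_ge0 Ht r q) (gromov_le Ht r q) n.+1 emp e isT mono e01.
  have clq : close_on mu emp (br q) e.
    by move=> A Aq; apply: cl; apply/flatten_mapP; exists q.
  move=> /(_ clq s) h; apply: le_trans h _.
  by move: ne; move: (n.+1%:R^-1 : R) => v; lra.
move=> x y sx xy yK; have [Sy _] := kS y yK.
have sy : special d r mu y by apply: special_IP => //; right.
have kc : kappa (c (kappa y)) = kappa y by apply: Hc; exists y.
have [Sc _] := kS (c (kappa y)) (etrans (congr1 (fun k => k < K)%N kc) yK).
have sc : special d r mu (c (kappa y)) by apply: special_IP => //; right.
have cQ : c (kappa y) \in Q.
  by rewrite mem_cat; apply/orP; right; apply/mapP; exists (kappa y); rewrite // mem_iota.
have up : emp (Fset d r x) <= massF x + 2 * (2 * e).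
  apply: (gc_upper Ht Hb HIP mono (gcQ _ cQ) sx sy sc xy).
  have := kd y (c (kappa y)) (esym kc) yK; lra.
have lo : massF x - 2 * e <= emp (Fset d r x).
  (* If F(x) is light, the lower bound is negative and [emp] is not. *)
  have [h|h] := lerP e (massF x); last first.
    by have /andP[+ _] := e01 (Fset d r x); lra.
  have x1 : d r x <= 1.
    by move: sx; rewrite /special; have := massF_ge0 d r mu x; lra.
  have [q qY xq] := HY x (conj x1 h).
  apply: (gc_lower Ht _ xq); apply: gcQ.
  by rewrite mem_cat qY.
by rewrite ler_norml; lra.
Qed.

End Blocks.

(** * Plane trees with leaves attached *)

Section Words.
Implicit Types u v w p : seq nat.

Lemma prefix_takeE p w : prefix p w = (take (size p) w == p).
Proof. by rewrite prefixE. Qed.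

Lemma prefix_antisym p w : prefix p w -> prefix w p -> p = w.
Proof.
move=> pw wp; move: (size_prefix pw) (size_prefix wp) => h1 h2.
have sz : size p = size w by apply/eqP; rewrite eqn_leq h1.
by move: pw; rewrite prefix_takeE sz take_size => /eqP.
Qed.

Lemma parent_prefix w : prefix (parent w) w.
Proof. exact: prefix_take. Qed.

Lemma parent_rcons w x : parent (rcons w x) = w.
Proof. by rewrite /parent size_rcons /= -cats1 take_size_cat. Qed.

Lemma prefix_parent p w : prefix p w -> p <> w -> prefix p (parent w).
Proof.
case/lastP: w => [|w x]; first by rewrite prefixs0 => /eqP.
rewrite parent_rcons => pw ne.
have lt : (size p < size (rcons w x))%N.
  rewrite ltn_neqAle size_prefix // andbT; apply/eqP => e; apply: ne.
  by move: pw; rewrite prefix_takeE e take_size => /eqP.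
move: pw; rewrite !prefix_takeE -cats1 take_cat.
move: lt; rewrite size_rcons ltnS leq_eqVlt => /orP[/eqP e|->//].
by rewrite e ltnn subnn take0 cats0 take_size.
Qed.

Lemma lcp_prefixl u v : prefix (lcp u v) u.
Proof.
elim: u v => [|a u IH] [|b v] //=; case: eqP => //= _.
by rewrite eqxx IH.
Qed.

Lemma lcpC u v : lcp u v = lcp v u.
Proof.
elim: u v => [|a u IH] [|b v] //=; rewrite eq_sym.
by case: eqP => // ->; rewrite IH.
Qed.

Lemma lcp_prefixr u v : prefix (lcp u v) v.
Proof. by rewrite lcpC lcp_prefixl. Qed.

Lemma prefix_lcp p u v : prefix p u -> prefix p v -> prefix p (lcp u v).
Proof.
elim: p u v => [|c p IH] [|a u] [|b v] //=; first by rewrite prefix0s.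
move=> /andP[/eqP<- pu] /andP[/eqP<- pv]; rewrite eqxx /= eqxx /=.
exact: IH.
Qed.

Lemma is_child_parent v w : is_child v w -> parent w = v.
Proof.
by move=> /andP[/eqP sz]; rewrite prefix_takeE /parent sz => /eqP.
Qed.

End Words.

Section TrimDistance.
Variables (R : realType) (n : nat) (W : ptree).

Lemma muF_trim_anti u v : prefix u v -> muF_trim R n W v <= muF_trim R n W u.
Proof.
move=> uv; rewrite /muF_trim ler_wpM2r ?invr_ge0 // ler_nat.
apply: sub_count => w /andP[-> vw] /=.
exact: prefix_trans uv vw.
Qed.

Lemma sum_edge_len u m : (m <= size u)%N ->
  \sum_(m.+1 <= j < (size u).+1) edge_len R n W (take j u) =
  muF_trim R n W (take m u) - muF_trim R n W u.
Proof.
move=> mu; pose f j := - muF_trim R n W (take j u).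
rewrite big_add1 /= (eq_big_nat _ _ (F2 := fun j => f j.+1 - f j)).
  by rewrite telescope_sumr // /f take_size opprK addrC.
move=> j /andP[mj ju]; rewrite /edge_len.
have -> : parent (take j.+1 u) = take j u.
  by rewrite (take_nth 0%N ju) parent_rcons.
rewrite ger0_norm ?subr_ge0; first by rewrite /f opprK addrC.
by apply: muF_trim_anti; rewrite -(take_takel u (leqnSn j)) prefix_take.
Qed.

Lemma d_trimE u v : d_trim R n W u v =
  2 * muF_trim R n W (lcp u v) - muF_trim R n W u - muF_trim R n W v.
Proof.
rewrite /d_trim !sum_edge_len ?size_prefix ?lcp_prefixl ?lcp_prefixr //.
have := lcp_prefixl u v; have := lcp_prefixr u v; rewrite !prefix_takeE => /eqP-> /eqP->.
lra.
Qed.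

End TrimDistance.

(** * Leaves, meets and masses after attachment *)

Section Attach.
Variables (R : realType) (W : ptree) (lab : nat -> word) (n : nat).
Variables (pos : nat -> nat) (us : nat -> R).

Let idx := iota 0 n.
(** Up to [attach], these definitions repeat the body of [sample] with tree, labels and positions as
    parameters, so that [sampleE] holds by conversion. *)
Definition labels_at v := [seq i <- idx | lab i == v].
Definition attached v :=
  (size (labels_at v) != 0%N) && (~~ is_leaf W v || (1 < size (labels_at v))%N).
(** The index breaks ties, so this is a strict total order for every [us], not only almost
    surely. *)
Definition before j i := (pos j < pos i)%N ||
  ((pos j == pos i) && ((us j < us i) || ((us j == us i) && (j < i)%N))).
Definition rank_leaf i :=
  (pos i + count (fun j => (lab j == lab i) && before j i) idx)%N.
Definition rank_child v j :=
  (j + count (fun i => [&& lab i == v, attached v & (pos i <= j)%N]) idx)%N.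
Definition newword (w : word) : word :=
  [seq rank_child (take m w) (nth 0%N w m) | m <- iota 0 (size w)].
Definition attach : ptree :=
  ([fset newword w | w in W] `|`
   [fset rcons (newword (lab i)) (rank_leaf i) | i in idx & attached (lab i)])%fset.

Lemma before_trans i j k : before i j -> before j k -> before i k.
Proof.
rewrite /before => /orP[h1|/andP[/eqP e1 h1]] /orP[h2|/andP[/eqP e2 h2]].
- by rewrite (ltn_trans h1 h2).
- by rewrite -e2 h1.
- by rewrite e1 h2.
- rewrite e1 e2 eqxx ltnn /=.
  move: h1 h2 => /orP[h1|/andP[/eqP-> h1]] /orP[h2|/andP[/eqP<- h2]].
  + by rewrite (lt_trans h1 h2).
  + by rewrite h1.
  + by rewrite h2.
  + by rewrite eqxx (ltn_trans h1 h2) orbT.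
Qed.

Lemma before_irr i : before i i = false.
Proof. by rewrite /before !ltnn !ltxx !andbF. Qed.

Lemma before_total i j : i <> j -> before i j || before j i.
Proof.
move=> ij; rewrite /before; case: (ltngtP (pos i) (pos j)) => //= _.
case: (ltgtP (us i) (us j)) => //= _.
by case: (ltngtP i j).
Qed.

Lemma count_lt (p q : pred nat) i : i \in idx -> subpred p q -> q i -> ~~ p i ->
  (count p idx < count q idx)%N.
Proof.
move=> ii pq qi npi.
have -> : count q idx = (count p idx + count (predD q p) idx)%N.
  rewrite -count_predUI [X in (_ + X)%N](_ : _ = 0%N) ?addn0.
    by apply: eq_count => j /=; case pj: (p j) => //=; exact: pq.
  by apply/eqP; rewrite -leqn0 leqNgt -has_count; apply/hasPn => j _ /=; case: (p j).
rewrite -[X in (X < _)%N]addn0 ltn_add2l -has_count.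
by apply/hasP; exists i; rewrite //= npi.
Qed.

Lemma rank_child_lt v j k : (j < k)%N -> (rank_child v j < rank_child v k)%N.
Proof.
move=> jk; rewrite /rank_child -addSn leq_add //.
apply: sub_count => i /and3P[-> -> h] /=; exact: leq_trans h (ltnW jk).
Qed.

Lemma rank_child_inj v : injective (rank_child v).
Proof.
move=> j k e; case: (ltngtP j k) => // h.
  by have := rank_child_lt v h; rewrite e ltnn.
by have := rank_child_lt v h; rewrite e ltnn.
Qed.

Lemma rank_leaf_lt i j : i \in idx -> lab i = lab j -> before i j ->
  (rank_leaf i < rank_leaf j)%N.
Proof.
move=> ii e b; rewrite /rank_leaf -addnS leq_add //.
  by move: b; rewrite /before => /orP[/ltnW //|/andP[/eqP-> _]].
apply: (count_lt ii); rewrite ?before_irr ?andbF // ?e ?eqxx //.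
by move=> k /andP[-> h]; exact: before_trans h b.
Qed.

Lemma rank_leaf_inj i j : i \in idx -> j \in idx -> lab i = lab j ->
  rank_leaf i = rank_leaf j -> i = j.
Proof.
move=> ii jj e er; apply/eqP/negPn/negP => /eqP ne.
have /orP[b|b] := before_total ne.
  by have := rank_leaf_lt ii e b; rewrite er ltnn.
by have := rank_leaf_lt jj (esym e) b; rewrite er ltnn.
Qed.

(** If [pos i <= j], leaf i and all leaves before it are counted in the rank of child j. Otherwise
    all leaves counted for child j precede leaf i. *)
Lemma rank_leaf_child i j : i \in idx -> attached (lab i) ->
  rank_leaf i <> rank_child (lab i) j.
Proof.
move=> ii ai; case: (leqP (pos i) j) => h.
  suff : (rank_leaf i < rank_child (lab i) j)%N by move=> + e; rewrite e ltnn.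
  rewrite /rank_leaf /rank_child -addnS leq_add //.
  apply: (count_lt ii); rewrite ?before_irr ?andbF ?eqxx ?ai //=.
  move=> k /andP[-> b] /=; apply: leq_trans h.
  by move: b; rewrite /before => /orP[/ltnW //|/andP[/eqP-> _]].
suff : (rank_child (lab i) j < rank_leaf i)%N by move=> + e; rewrite e ltnn.
rewrite /rank_leaf /rank_child -addSn leq_add //.
apply: sub_count => k /and3P[-> _ kj] /=.
by rewrite /before (leq_ltn_trans kj h).
Qed.

Lemma size_newword w : size (newword w) = size w.
Proof. by rewrite size_map size_iota. Qed.

(** A letter of [newword w] depends only on the prefix of w that ends there. Hence [newword]
    preserves and reflects prefixes and commutes with [parent] and [lcp]. *)
Lemma newword_take k w : newword (take k w) = take k (newword w).
Proof.
case: (leqP (size w) k) => [h|/ltnW h].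
  by rewrite !take_oversize // size_newword.
rewrite /newword size_takel // -map_take take_iota (minn_idPl h).
apply/eq_in_map => m; rewrite mem_iota /= add0n => mk.
by rewrite take_takel ?nth_take // ltnW.
Qed.

Lemma newword_rcons w x : newword (rcons w x) = rcons (newword w) (rank_child w x).
Proof.
have {1}-> : newword (rcons w x) =
    rcons (take (size w) (newword (rcons w x))) (nth 0%N (newword (rcons w x)) (size w)).
  rewrite -take_nth ?size_newword ?size_rcons // take_oversize //.
  by rewrite size_newword size_rcons.
rewrite -newword_take -(cats1 w x) take_size_cat //; congr rcons.
rewrite /newword (nth_map 0%N) ?size_iota ?size_cat ?addn1 // nth_iota ?ltnS ?addn1 // add0n.
by rewrite take_size_cat // nth_cat ltnn subnn.
Qed.

Lemma newword_inj : injective newword.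
Proof.
elim/last_ind => [|w x IH] v e.
  by have := congr1 size e; rewrite !size_newword; case: v {e}.
case/lastP: v e => [|v y] e.
  by have := congr1 size e; rewrite !size_newword size_rcons.
move: e; rewrite !newword_rcons => /rcons_inj[/IH <-] /rank_child_inj ->.
by [].
Qed.

Lemma prefix_newword p w : prefix (newword p) (newword w) = prefix p w.
Proof.
rewrite !prefix_takeE size_newword -newword_take.
by rewrite (inj_eq newword_inj).
Qed.

Lemma parent_newword w : parent (newword w) = newword (parent w).
Proof. by rewrite /parent size_newword newword_take. Qed.

Lemma lcp_newword u v : lcp (newword u) (newword v) = newword (lcp u v).
Proof.
apply: prefix_antisym; last first.
  by apply: prefix_lcp; rewrite prefix_newword ?lcp_prefixl ?lcp_prefixr.
have := lcp_prefixl (newword u) (newword v); have := lcp_prefixr (newword u) (newword v).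
move: (lcp (newword u) (newword v)) => p.
rewrite (prefix_takeE p (newword v)) (prefix_takeE p (newword u)) => /eqP ev /eqP eu.
have -> : p = newword (take (size p) u) by rewrite newword_take.
rewrite prefix_newword; apply: prefix_lcp; first exact: prefix_take.
by rewrite -prefix_newword newword_take eu -{1}ev prefix_take.
Qed.

Lemma newword_neq_leaf w i : i \in idx -> attached (lab i) ->
  newword w <> rcons (newword (lab i)) (rank_leaf i).
Proof.
move=> ii ai; case/lastP: w => [|w x].
  by move/(congr1 size); rewrite size_rcons.
rewrite newword_rcons => /rcons_inj[/newword_inj -> e].
exact: (rank_leaf_child ii ai (esym e)).
Qed.

(** The leaf contributed by sample i: the newly attached one, or the labelled vertex itself if that
    is a leaf with a single label. Accordingly [base i] is the vertex whose image is the neighbour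
    of this leaf. *)
Definition leafw i : word :=
  if attached (lab i) then rcons (newword (lab i)) (rank_leaf i) else newword (lab i).
Definition base i : word := if attached (lab i) then lab i else parent (lab i).

Lemma parent_leafw i : parent (leafw i) = newword (base i).
Proof.
by rewrite /leafw /base; case: ifP => _; rewrite ?parent_rcons ?parent_newword.
Qed.

Hypothesis Wpar : forall w, w \in W -> w != [::] -> parent w \in W.
Hypothesis labW : forall i, i \in idx -> lab i \in W.

Lemma detached_leaf i : i \in idx -> ~~ attached (lab i) -> is_leaf W (lab i).
Proof.
move=> ii; rewrite /attached negb_and negb_or !negbK => /orP[|/andP[]//].
rewrite size_eq0 /labels_at -[_ == [::]]negbK -has_filter => /negP[].
by apply/hasP; exists i.
Qed.

Lemma detached_unique i j : i \in idx -> j \in idx -> ~~ attached (lab i) ->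
  lab i = lab j -> i = j.
Proof.
move=> ii jj na e; apply/eqP/negPn/negP => ne; move: na; rewrite /attached.
suff h : (1 < size (labels_at (lab i)))%N by rewrite h orbT andbT -lt0n (ltnW h).
change (size [:: i; j] <= size (labels_at (lab i)))%N; apply: uniq_leq_size.
  by rewrite /= inE ne.
by move=> k; rewrite !inE => /orP[/eqP->|/eqP->]; rewrite mem_filter ?ii ?jj ?e eqxx.
Qed.

Lemma leaf_no_child v w : is_leaf W v -> w \in W -> is_child v w = false.
Proof.
move=> /and3P[_ v0]; rewrite /deg v0 addn1 eqSS => h wW; apply/negP => c.
by move: h; rewrite eqn0Ngt -has_count => /hasP[]; exists w.
Qed.

Lemma W_take k w : w \in W -> take k w \in W.
Proof.
move=> wW; have [h|/ltnW h] := leqP (size w) k; first by rewrite take_oversize.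
rewrite -(subKn h); move: (size w - k)%N; elim=> [|m IH]; first by rewrite subn0 take_size.
have [s0|s0] := eqVneq (size w - m)%N 0%N.
  by have -> : (size w - m.+1 = size w - m)%N by lia.
have := Wpar IH; rewrite /parent size_takel ?leq_subr // take_takel ?leq_pred //.
rewrite subnS; apply.
by rewrite -size_eq0 size_takel ?leq_subr.
Qed.

Lemma leaf_no_ext v w : is_leaf W v -> w \in W -> prefix v w -> w = v.
Proof.
move=> lv wW vw; apply/eqP/negPn/negP => ne.
have lt : (size v < size w)%N.
  rewrite ltn_neqAle size_prefix // andbT; apply/eqP => e.
  by move: vw; rewrite prefix_takeE e take_size (negbTE ne).
have := leaf_no_child lv (W_take (size v).+1 wW).
rewrite /is_child size_takel // eqxx prefix_takeE take_takel //.
by rewrite -prefix_takeE vw.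
Qed.

Lemma detached_not_prefix i j : i \in idx -> j \in idx -> i <> j ->
  ~~ attached (lab i) -> ~~ prefix (lab i) (lab j).
Proof.
move=> ii jj ij na; apply/negP => h; apply: ij.
apply: (detached_unique ii jj na).
by rewrite (leaf_no_ext (detached_leaf ii na) (labW jj) h).
Qed.

Lemma base_prefix i : prefix (base i) (lab i).
Proof. by rewrite /base; case: ifP => _; rewrite ?prefix_refl ?parent_prefix. Qed.

(** Moving from a detached leaf to its parent loses no meet, since no other label lies at or below
    that leaf. *)
Lemma prefix_lcp_base i j : i \in idx -> j \in idx -> i <> j ->
  prefix (lcp (lab i) (lab j)) (base i).
Proof.
move=> ii jj ij; rewrite /base; case: ifPn => ai; first exact: lcp_prefixl.
apply: prefix_parent; first exact: lcp_prefixl.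
move=> e; have := detached_not_prefix ii jj ij ai.
by rewrite -{1}e lcp_prefixr.
Qed.

Lemma lcp_base i j : i \in idx -> j \in idx -> i <> j ->
  lcp (base i) (base j) = lcp (lab i) (lab j).
Proof.
move=> ii jj ij; apply: prefix_antisym; apply: prefix_lcp.
- exact: prefix_trans (lcp_prefixl _ _) (base_prefix _).
- exact: prefix_trans (lcp_prefixr _ _) (base_prefix _).
- exact: prefix_lcp_base.
- by rewrite lcpC; apply: prefix_lcp_base => //; exact: nesym.
Qed.

(** [nbase] gives the masses in the trimmed tree, [nlab] the empirical masses of the samples. They
    agree at meets; at the neighbour of a leaf only inequalities remain. *)
Definition nbase p := count (fun k => prefix p (base k)) idx.
Definition nlab p := count (fun k => prefix p (lab k)) idx.

(** A sample k counted only by [nlab] would be a detached leaf labelled with the meet itself; but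
    the labels of i and j extend the meet, and one of i, j differs from k. *)
Lemma nbase_lcp i j : i \in idx -> j \in idx -> i <> j ->
  nbase (lcp (lab i) (lab j)) = nlab (lcp (lab i) (lab j)).
Proof.
move=> ii jj ij; apply: eq_in_count => k kk; apply/idP/idP => h.
  exact: prefix_trans h (base_prefix k).
rewrite /base; case: ifPn => // nk; apply: prefix_parent => // e.
have [ik|/eqP ik] := eqVneq i k.
  have /eqP jk : j != k by rewrite -ik; apply/eqP; exact: nesym.
  have := detached_not_prefix kk jj (nesym jk) nk; rewrite -e lcp_prefixr //.
by have := detached_not_prefix kk ii (nesym ik) nk; rewrite -e lcp_prefixl.
Qed.

Lemma nlab_le_nbase i : i \in idx -> (nlab (lab i) <= nbase (base i))%N.
Proof.
move=> ii; rewrite /nlab /nbase -!size_filter; rewrite !size_filter.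
(* As sums, the counts retain the membership of k in [idx], on which the comparison relies. *)
rewrite -!sum1_count big_seq_cond [X in (_ <= X)%N]big_seq_cond.
rewrite big_mkcond [X in (_ <= X)%N]big_mkcond /=; apply: leq_sum => k _.
case: ifP => // /andP[kk h]; case: ifP => // /negP[]; rewrite kk /=.
have [->|/eqP ik] := eqVneq k i; first exact: prefix_refl.
apply: prefix_trans (base_prefix i) _.
rewrite /base; case: ifPn => // nk; apply: prefix_parent => // e.
by have := detached_not_prefix kk ii ik nk; rewrite -e prefix_refl.
Qed.

Lemma nbase_le_nlab i j : i \in idx -> j \in idx -> i <> j ->
  (nbase (base i) <= nlab (lcp (lab i) (lab j)))%N.
Proof.
move=> ii jj ij; apply: sub_count => k h.
apply: prefix_trans (base_prefix k).
exact: prefix_trans (prefix_lcp_base ii jj ij) h.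
Qed.

Lemma attach_parent x : x \in attach -> (exists2 w, w \in W & x = newword w) \/
  (exists i, [/\ i \in idx, attached (lab i) & x = rcons (newword (lab i)) (rank_leaf i)]).
Proof.
rewrite in_fsetU => /orP[/imfsetP[w /= wW ->]|/imfsetP[i /=]].
  by left; exists w.
by rewrite inE /= => /andP[ii ai] ->; right; exists i.
Qed.

Lemma leafw_leaf i : i \in idx -> is_leaf attach (leafw i).
Proof.
move=> ii; have nz : leafw i != [::].
  rewrite /leafw; case: ifPn => ai; rewrite -size_eq0 ?size_rcons //.
  by rewrite size_newword size_eq0; case/and3P: (detached_leaf ii ai).
have inA : leafw i \in attach.
  rewrite in_fsetU /leafw; case: ifPn => ai; apply/orP; [right|left].
    by apply/imfsetP; exists i; rewrite //= inE /= ii.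
  by apply/imfsetP; exists (lab i); rewrite //= labW.
rewrite /is_leaf inA nz /deg nz /= addn1 eqSS eqn0Ngt -has_count.
apply/hasPn => x /attach_parent [[w wW ->]|[j [jj aj ->]]]; apply/negP => c.
  have := is_child_parent c; rewrite parent_newword /leafw; case: ifPn => ai.
    exact: newword_neq_leaf.
  move=> /newword_inj e; have := leaf_no_child (detached_leaf ii ai) wW.
  move: c; rewrite /leafw (negbTE ai) /is_child !size_newword prefix_newword.
  by move=> ->.
have := is_child_parent c; rewrite parent_rcons /leafw; case: ifPn => ai.
  exact: newword_neq_leaf.
by move=> /newword_inj e; move: aj; rewrite e (negbTE ai).
Qed.

Lemma leafw_inj i j : i \in idx -> j \in idx -> leafw i = leafw j -> i = j.
Proof.
move=> ii jj; rewrite /leafw; case: ifPn => ai; case: ifPn => aj.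
- by move=> /rcons_inj[/newword_inj e er]; exact: rank_leaf_inj.
- by move=> /esym/(newword_neq_leaf ii ai).
- by move=> /(newword_neq_leaf jj aj).
- by move=> /newword_inj e; exact: detached_unique.
Qed.

(* The n leaves [leafw i] are distinct, so they are all the leaves. *)
Lemma count_leaves (A : pred word) : nleaves attach = n ->
  count (fun x => is_leaf attach x && A (parent x)) attach =
  count (fun i => A (newword (base i))) idx.
Proof.
move=> hn.
have pe : perm_eq [seq leafw i | i <- idx] [seq x <- attach | is_leaf attach x].
  have un : uniq [seq leafw i | i <- idx].
    by rewrite map_inj_in_uniq ?iota_uniq // => i j; exact: leafw_inj.
  apply: uniq_perm => //; first by rewrite filter_uniq ?fset_uniq.
  have sub : {subset [seq leafw i | i <- idx] <= [seq x <- attach | is_leaf attach x]}.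
    move=> x /mapP[i ii ->]; rewrite mem_filter leafw_leaf //.
    by have /and3P[] := leafw_leaf ii.
  apply: (uniq_min_size un sub _).2.
  by rewrite size_map size_iota size_filter -/(nleaves _) hn.
rewrite (eq_count (a2 := predI (fun x => A (parent x)) (is_leaf attach))); last first.
  by move=> x /=; rewrite andbC.
rewrite -count_filter -(permP pe) count_map; apply: eq_count => i /=.
by rewrite parent_leafw.
Qed.

Lemma d_trim_attach i j : nleaves attach = n -> i \in idx -> j \in idx -> i <> j ->
  d_trim R n attach (newword (base i)) (newword (base j)) =
  (2 * (nlab (lcp (lab i) (lab j)))%:R - (nbase (base i))%:R - (nbase (base j))%:R) / n%:R.
Proof.
move=> hn ii jj ij; rewrite d_trimE lcp_newword lcp_base //.
have E p : muF_trim R n attach (newword p) = (nbase p)%:R / n%:R.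
  rewrite /muF_trim; congr (_%:R / _); rewrite (@count_leaves (prefix (newword p))) //.
  by apply: eq_count => k; rewrite /= prefix_newword.
by rewrite !E nbase_lcp // !mulrBl mulrA.
Qed.

End Attach.

(** * Couplings *)

Section Empirical.
Variables (R : realType) (T : Type) (n : nat) (x : nat -> T).

Definition empirical (A : set T) : R :=
  (count (fun i => `[< A (x i) >]) (iota 0 n))%:R / n%:R.

Lemma empirical_mono A B : A `<=` B -> empirical A <= empirical B.
Proof.
move=> AB; rewrite /empirical ler_wpM2r ?invr_ge0 // ler_nat.
by apply: sub_count => i /= /asboolP Ai; apply/asboolP; exact: AB.
Qed.

Lemma empirical01 A : 0 <= empirical A <= 1.
Proof.
rewrite /empirical divr_ge0 //=; have [->|n0] := posnP n.
  by rewrite invr0 mulr0.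
by rewrite ler_pdivrMr ?ltr0n // mul1r ler_nat (leq_trans (count_size _ _)) // size_iota.
Qed.

Lemma empirical_sum A : empirical A = \sum_(i < n) (`[< A (x i) >])%:R / n%:R.
Proof.
rewrite /empirical -mulr_suml; congr (_ / _).
rewrite -(big_mkord xpredT (fun i => (`[< A (x i) >])%:R)) -natr_sum; congr _%:R.
by rewrite /index_iota subn0 -sum1_count big_mkcond /=; apply: eq_bigr => i _; case: asboolP.
Qed.

End Empirical.

(** A maximal coupling of q and p, written as a kernel out of q because each sample will spread its
    own mass 1/n. *)
Lemma transport_plan (R : realType) (K : nat) (p q : nat -> R) :
  (forall k, 0 <= p k) -> (forall k, 0 <= q k) ->
  \sum_(k < K) p k = 1 -> \sum_(k < K) q k = 1 ->
  exists pi : nat -> nat -> R,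
    [/\ forall a b, 0 <= pi a b,
        forall a, (a < K)%N -> 0 < q a -> \sum_(b < K) pi a b = 1,
        forall b, (b < K)%N -> \sum_(a < K) q a * pi a b = p b &
        forall a, Num.min (p a) (q a) <= q a * pi a a].
Proof.
move=> p0 q0 p1 q1; pose mn k := Num.min (p k) (q k).
have mnp k : mn k <= p k by rewrite /mn ge_min lexx.
have mnq k : mn k <= q k by rewrite /mn ge_min lexx orbT.
have mn0 k : 0 <= mn k by rewrite /mn le_min p0 q0.
pose D := \sum_(k < K) (p k - mn k).
have Dq : D = \sum_(k < K) (q k - mn k) by rewrite /D !sumrB p1 q1.
have D0 : 0 <= D by apply: sumr_ge0 => k _; rewrite subr_ge0.
(* Keep the common mass min(p, q) in place, spread the excess proportionally. *)
pose pi a b := (if a == b then mn a / q a else 0) + (1 - mn a / q a) * ((p b - mn b) / D).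
have mq a : 0 <= mn a / q a <= 1.
  rewrite divr_ge0 //=; have [->|nz] := eqVneq (q a) 0; first by rewrite invr0 mulr0.
  by rewrite ler_pdivrMr ?mul1r // lt_neqAle eq_sym nz q0.
have mqq a : q a * (mn a / q a) = mn a.
  have [z|nz] := eqVneq (q a) 0; last by rewrite mulrC divfK.
  by rewrite z mul0r; apply/esym/eqP; rewrite eq_le mn0 -z mnq.
have qpi a b : q a * pi a b =
    (if a == b then mn a else 0) + (q a - mn a) * ((p b - mn b) / D).
  rewrite /pi mulrDr; congr (_ + _); first by case: ifP => _; rewrite ?mulr0.
  by rewrite [LHS]mulrA mulrBr mulr1 mqq.
have pick b (F : nat -> R) : (b < K)%N -> \sum_(a < K) (if a == b :> nat then F a else 0) = F b.
  move=> bK; rewrite (bigD1 (Ordinal bK)) //= eqxx big1 ?addr0 // => i ne.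
  by case: eqP => // e; case/negP: ne; apply/eqP/val_inj.
exists pi; split.
- move=> a b; have /andP[h1 h2] := mq a; rewrite /pi addr_ge0 //; first by case: ifP.
  by rewrite mulr_ge0 ?subr_ge0 // divr_ge0 // subr_ge0.
- move=> a aK qa; rewrite /pi big_split /= -mulr_sumr -mulr_suml -/D.
  under eq_bigr do rewrite eq_sym.
  (* For D = 0 the quotient by D vanishes, but then [mn a = q a] and there is no excess to
     spread. *)
  rewrite (pick a (fun=> mn a / q a)) //; have [Dz|Dn] := eqVneq D 0; last first.
    by rewrite divff //; ring.
  suff -> : mn a = q a by rewrite divff ?gt_eqF //; ring.
  apply/eqP; rewrite eq_le mnq /= -subr_le0 -Dz Dq (bigD1 (Ordinal aK)) //= lerDl.
  by apply: sumr_ge0 => k _; rewrite subr_ge0.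
- move=> b bK; under eq_bigr do rewrite qpi.
  rewrite big_split /= pick // -mulr_suml -Dq.
  have [Dz|Dn] := eqVneq D 0; last by rewrite mulrC divfK //; ring.
  suff -> : mn b = p b by rewrite Dz; ring.
  apply/eqP; rewrite eq_le mnp /= -subr_le0 -Dz /D (bigD1 (Ordinal bK)) //= lerDl.
  by apply: sumr_ge0 => k _; rewrite subr_ge0.
- move=> a; rewrite qpi eqxx lerDl mulr_ge0 ?subr_ge0 // divr_ge0 // subr_ge0 //.
Qed.

Section Coupling.
Variables (R : realType) (dT : measure_display) (T : measurableType dT).
Variable mu : probability T R.
Local Notation m A := (fine (mu A)).

(** These are the candidate couplings: c i k is the density, relative to mu, of the mass sent from u
    i into block k. *)
Lemma ex_mixed_measure (n K : nat) (c : nat -> nat -> R) (u : nat -> word)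
    (B : nat -> set T) : (forall i k, 0 <= c i k) -> (forall k, measurable (B k)) ->
  exists nu : {measure set (word * T) -> \bar R}, forall A, measurable A ->
    nu A = (\sum_(i < n) \sum_(k < K) c i k * m (B k `&` [set y | A (u i, y)]))%:E.
Proof.
move=> c0 mB.
(* The measure instance of [pushforward] needs the measurability proof, hence its explicit name. *)
pose N i k : {measure set (word * T) -> \bar R} :=
  mscale (NngNum (c0 i k))
    (measure_function_pushforward__canonical__measure_function_Measure
       (mrestr mu (mB k)) (@pair1_measurable _ _ word T (u i))).
pose N1 i : {measure set (word * T) -> \bar R} := msum (N i) K.
exists (msum N1 n) => A mA.
rewrite /= /msum -sumEFin; apply: eq_bigr => i _.
rewrite -sumEFin; apply: eq_bigr => k _.
rewrite /mscale /= /pushforward /mrestr EFinM fineK; first by rewrite setIC.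
apply: fin_num_measure; apply: measurableI => //.
rewrite -[X in measurable X]setTI; exact: pair1_measurable.
Qed.

Lemma sum_block (n K : nat) (kap : nat -> nat) (g : nat -> R) :
  (forall i, (i < n)%N -> (kap i < K)%N) ->
  \sum_(i < n) g (kap i) = \sum_(a < K) (\sum_(i < n) (kap i == a)%:R) * g a.
Proof.
move=> h; under [RHS]eq_bigr do rewrite mulr_suml.
rewrite exchange_big /=; apply: eq_bigr => i _.
rewrite (bigD1 (Ordinal (h _ (ltn_ord i)))) //= eqxx mul1r big1 ?addr0 // => a ne.
case: eqP => [e|_]; last by rewrite mul0r.
by case/negP: ne; apply/eqP/val_inj.
Qed.

Lemma sum_levels (K : nat) (kappa : T -> nat) (B : set T) :
  (forall k, measurable [set y | kappa y = k]) -> (forall y, (kappa y < K)%N) ->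
  measurable B -> \sum_(k < K) m ([set y | kappa y = k] `&` B) = m B.
Proof.
move=> mk hK mB.
have mkB k : measurable ([set y | kappa y = k] `&` B) by exact: measurableI.
apply: EFin_inj; rewrite -sumEFin fineK ?fin_num_measure //.
rewrite (eq_bigr (fun k : 'I_K => mu ([set y | kappa y = k] `&` B))); last first.
  by move=> k _; rewrite fineK ?fin_num_measure.
rewrite -(measure_bigsetU_ord mu xpredT (F := fun k : 'I_K => [set y | kappa y = k] `&` B)) //.
  congr (mu _); apply/seteqP; split=> y.
    by rewrite -bigcup_seq => -[k _ []].
  by move=> By; rewrite -bigcup_seq; exists (Ordinal (hK y)); rewrite /= ?mem_index_enum.
by apply/trivIsetP => i j _ _ ij; rewrite -subset0 => y [[/= -> _] [/= e _]]; case/eqP: ij; exact: val_inj.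
Qed.

End Coupling.

Section GpClose.
Variables (R : realType) (dT : measure_display) (T : measurableType dT).
Variable mu : probability T R.
Local Notation m A := (fine (mu A)).
Variables (d : T -> T -> R) (d1 : word -> word -> R).

(** Sample i spreads its mass 1/n over the blocks by the transport plan from empirical to true block
    masses, and inside a block proportionally to mu. Mass that stays in its own block below K lies
    in the relation; at most [del] is lost per block. *)
Lemma gp_close_blocks (n K : nat) (kappa : T -> nat) (x : nat -> T) (u : nat -> word)
    (mu1 : set word -> \bar R) (e del : R) :
  (0 < n)%N ->
  (forall k, measurable [set y | kappa y = k]) -> (forall y, (kappa y <= K)%N) ->
  (forall A, mu1 A = (empirical R n u A)%:E) ->
  (forall k, (k <= K)%N ->
     `|empirical R n x [set y | kappa y = k] - m [set y | kappa y = k]| <= del) ->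
  1 - e + del *+ K <= m [set y | (kappa y < K)%N] ->
  (forall i j y z, (i < n)%N -> (j < n)%N -> (kappa (x i) < K)%N -> (kappa (x j) < K)%N ->
     kappa y = kappa (x i) -> kappa z = kappa (x j) -> `|d1 (u i) (u j) - d y z| <= e) ->
  gp_close d1 d mu1 mu e.
Proof.
move=> n0 mk hK mu1E hdel hm hd.
have n0' : 0 < n%:R :> R by rewrite ltr0n.
have hK1 y : (kappa y < K.+1)%N by rewrite ltnS.
pose p k := m [set y | kappa y = k].
pose q k := empirical R n x [set y | kappa y = k].
have p0 k : 0 <= p k by apply: fine_ge0.
have q0 k : 0 <= q k by case/andP: (empirical01 R n x [set y | kappa y = k]).
have qE k : q k = (\sum_(i < n) (kappa (x i) == k)%:R) / n%:R.
  rewrite /q empirical_sum -mulr_suml; congr (_ / _); apply: eq_bigr => i _.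
  by congr (nat_of_bool _)%:R; apply/asboolP/eqP.
have p1 : \sum_(k < K.+1) p k = 1.
  rewrite -[RHS](_ : m setT = 1); last by rewrite probability_setT.
  rewrite -(sum_levels mu mk hK1 measurableT).
  by apply: eq_bigr => k _; rewrite setIT.
have sumq g : \sum_(i < n) g (kappa (x i)) / n%:R = \sum_(a < K.+1) q a * g a.
  rewrite (sum_block (K := K.+1) (kap := kappa \o x) (fun a => g a / n%:R)); last by move=> i _; exact: hK1.
  by apply: eq_bigr => a _; rewrite qE mulrAC mulrA.
have q1 : \sum_(k < K.+1) q k = 1.
  have <- : \sum_(k < K.+1) q k * 1 = \sum_(k < K.+1) q k.
    by apply: eq_bigr => k _; rewrite mulr1.
  rewrite -(sumq (fun=> 1)) sumr_const card_ord -[LHS]mulr_natl mulrA mulr1.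
  by rewrite divff // gt_eqF.
have [pi [pi0 pi1 pip pid]] := transport_plan p0 q0 p1 q1.
have qpos i : (i < n)%N -> 0 < q (kappa (x i)).
  move=> ni; rewrite qE divr_gt0 // (bigD1 (Ordinal ni)) //= eqxx.
  by rewrite ltr_pwDl // sumr_ge0.
(* In a null block the division by p k = 0 gives c i k = 0, which is harmless. *)
pose c i k := pi (kappa (x i)) k / n%:R / p k.
have c0 i k : 0 <= c i k by rewrite !divr_ge0 // ltW.
have cp i k : (i < n)%N -> (k < K.+1)%N -> c i k * p k = pi (kappa (x i)) k / n%:R.
  move=> ni kK; rewrite /c; have [pz|pn] := eqVneq (p k) 0; last by rewrite divfK.
  suff -> : pi (kappa (x i)) k = 0 by rewrite !mul0r.
  have := pip k kK; rewrite pz (bigD1 (Ordinal (hK1 (x i)))) //= => /eqP.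
  rewrite paddr_eq0 ?mulr_ge0 // ?sumr_ge0 // => [|a _]; last exact: mulr_ge0.
  by rewrite mulf_eq0 gt_eqF ?qpos //= => /andP[/eqP].
pose Rel := [set z : word * T | exists2 i, (i < n)%N &
  [/\ (kappa (x i) < K)%N, z.1 = u i & kappa z.2 = kappa (x i)]].
have [nu hnu] := ex_mixed_measure mu n K.+1 u c0 mk.
have mRel : measurable Rel.
  rewrite (_ : Rel = \bigcup_(i in [set i | (i < n)%N /\ (kappa (x i) < K)%N])
     ([set u i] `*` [set y | kappa y = kappa (x i)])).
    by apply: bigcup_measurable => i _; exact: measurableX.
  apply/seteqP; split=> [[w y] [i ni [h1 h2 h3]]|[w y] [i [ni h1] [h2 h3]]].
    by exists i.
  by exists i.
exists Rel, nu; split => //.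
- move=> A mA; rewrite hnu; last exact: measurableX.
  rewrite mu1E; congr EFin; rewrite empirical_sum; apply: eq_bigr => i _.
  rewrite (eq_bigr (fun k : 'I_K.+1 => (`[< A (u i) >])%:R * (pi (kappa (x i)) k / n%:R))).
    by rewrite -mulr_sumr -mulr_suml pi1 ?mul1r ?qpos.
  move=> k _; rewrite -cp //; case: asboolP => Ai /=.
    rewrite mul1r; congr (_ * fine (mu _)).
    by apply/seteqP; split=> y //= [].
  rewrite mul0r (_ : _ `&` _ = set0) ?measure0 ?mulr0 //.
  by apply/seteqP; split=> y //= [_ []].
- move=> B mB; rewrite hnu; last exact: measurableX.
  rewrite -[RHS]fineK ?fin_num_measure // -(sum_levels mu mk hK1 mB) exchange_big /=.
  congr EFin; apply: eq_bigr => k _.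
  rewrite (eq_bigr (fun i : 'I_n => c i k * m ([set y | kappa y = k] `&` B))); last first.
    move=> i _; congr (_ * fine (mu _)).
    by apply/seteqP; split=> y /= [h]; [case|].
  rewrite -mulr_suml; have [pz|pn] := eqVneq (p k) 0.
    suff -> : m ([set y | kappa y = k] `&` B) = 0 by rewrite mulr0.
    apply/eqP; rewrite eq_le fine_ge0 // andbT -pz.
    by apply: prob_le => //; exact: measurableI.
  by rewrite /c -mulr_suml (sumq (fun a => pi a k)) pip // divff ?mul1r.
- rewrite hnu // lee_fin.
  (* Blockwise, the smaller of p k and q k is at least p k - del. *)
  apply: (@le_trans _ _ (\sum_(k < K) Num.min (p k) (q k))).
    have -> : 1 - e = (1 - e + del *+ K) - \sum_(k < K) del.
      by rewrite sumr_const card_ord addrK.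
    rewrite lerBlDr -big_split /=; apply: le_trans hm _.
    rewrite -(sum_levels mu mk hK1); last first.
      rewrite (_ : [set _ | _] = \bigcup_(k in `I_K) [set y | kappa y = k]).
        by apply: bigcup_measurable.
      by apply/seteqP; split=> y /= => [h|[k /= kK ->] //]; exists (kappa y).
    rewrite big_ord_recr /= (_ : _ `&` _ = set0); last first.
      by apply/seteqP; split=> y //= [->]; rewrite ltnn.
    rewrite measure0 addr0; apply: ler_sum => k _.
    rewrite (_ : _ `&` _ = [set y | kappa y = k]); last first.
      by apply/seteqP; split=> y /= => [[]|h] //; rewrite h.
    have := hdel k (ltnW (ltn_ord k)); rewrite ler_norml -/(p k) -/(q k) => /andP[h1 h2].
    by have h0 := le_trans (normr_ge0 _) (hdel k (ltnW (ltn_ord k))); rewrite /Num.min; case: ifP => _; lra.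
  have -> : \sum_(k < K) Num.min (p k) (q k) =
      \sum_(k < K.+1) if (k < K)%N then Num.min (p k) (q k) else 0.
    rewrite big_ord_recr /= ltnn addr0; apply: eq_bigr => k _.
    by rewrite ltn_ord.
  apply: (@le_trans _ _ (\sum_(a < K.+1) q a * (if (a < K)%N then pi a a else 0))).
    by apply: ler_sum => k _; case: ifP => _; rewrite ?mulr0 ?pid.
  rewrite -(sumq (fun a => if (a < K)%N then pi a a else 0)); apply: ler_sum => i _.
  case: ifPn => kK; last first.
    by rewrite mul0r sumr_ge0 // => k _; rewrite mulr_ge0 ?fine_ge0.
  rewrite (bigD1 (Ordinal (hK1 (x i)))) //= -cp //.
  rewrite (_ : [set y | kappa y = kappa (x i)] `&` _ = [set y | kappa y = kappa (x i)]).
    by rewrite lerDl sumr_ge0 // => k _; rewrite mulr_ge0 ?fine_ge0.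
  by apply/seteqP; split=> y /= => [[]|h] //; split=> //; exists i.
- move=> [w y] [w' z] [i ni [/= ki -> ky]] [j nj [/= kj -> kz]].
  exact: hd.
Qed.

End GpClose.

(** * Trimmed samples are close to the tree *)

Lemma ex_pos_min (R : realType) (K : nat) (f : nat -> R) :
  exists2 c, 0 < c & forall k, (k <= K)%N -> 0 < f k -> c <= f k.
Proof.
elim: K => [|K [c c0 hc]].
  have [h|h] := ltrP 0 (f 0%N); first by exists (f 0%N) => // k; rewrite leqn0 => /eqP->.
  by exists 1 => // k; rewrite leqn0 => /eqP->; rewrite ltNge h.
have [h|h] := ltrP 0 (f K.+1).
  exists (Num.min c (f K.+1)); first by rewrite lt_min c0.
  move=> k; rewrite leq_eqVlt => /orP[/eqP-> _|kK fk]; first by rewrite ge_min lexx orbT.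
  by rewrite ge_min hc.
exists c => // k; rewrite leq_eqVlt => /orP[/eqP->|kK]; first by rewrite ltNge h.
exact: hc.
Qed.

Section SampleClose.
Variables (R : realType) (dT : measure_display) (T : measurableType dT).
Variable (d : T -> T -> R).
Hypothesis Ht : real_tree d.
Hypothesis Hb : borel_of_d d.
Variable r : T.
Variable mu : probability T R.
Hypothesis HIP : IP_tree d r mu.
Variable psi : forall n, ('I_n -> T) -> lptree n.
Hypothesis Hpsi : planar_order d r psi.
Variables (lam : T -> R) (beta : T -> set T -> R) (Ss : set T).
Local Notation m A := (fine (mu A)).
Local Notation massF := (massF d r mu).

(** This is [pos] in [sample], with tree and labels taken from [psi]. *)
Definition slot n (xs : nat -> T) (us : nat -> R) (i : nat) : nat :=
  let t := psi (fun i : 'I_n => xs i) in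
  let lab := lab_nat t.2 in
  let rep c := nth 0%N [seq j <- iota 0 n | prefix c (lab j)] 0 in
  let subtree_at a c := Defs.comp d (Fset d r a `\ a) (xs (rep c)) `|` [set a] in
  let a := xs i in let v := lab i in
  if `[< is_atom mu a >] then
    count (fun j => beta a (subtree_at a (rcons v j)) < us i) (iota 0 (nchildren t.1 v))
  else if `[< Ss a >] then (if us i <= lam a then 0%N else nchildren t.1 v)
  else nchildren t.1 v.

Lemma sampleE n xs us : sample d r mu psi lam beta Ss n xs us =
  attach (psi (fun i : 'I_n => xs i)).1 (lab_nat (psi (fun i : 'I_n => xs i)).2) n
    (slot n xs us) us.
Proof. by []. Qed.

Section Fixed.
Variables (n : nat) (xs : nat -> T) (us : nat -> R).
Let x := fun i : 'I_n => xs i.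
Let W := (psi x).1.
Let lab := lab_nat (psi x).2.
Let idx := iota 0 n.

Variable phi : T -> word.
Let V w := w \in W /\ (root_deg_gt1 d r x -> w != [::]).
Hypothesis phiV : forall z, span_vertex d r x z -> V (phi z).
Hypothesis phi_surj : forall w, V w -> exists z, span_vertex d r x z /\ phi z = w.
Hypothesis phi_prefix : forall z z', span_vertex d r x z -> span_vertex d r x z' ->
  (prefix (phi z) (phi z') <-> seg d r z' z).
Hypothesis phi_lab : forall i, phi (x i) = (psi x).2 i.

Lemma lab_phi i : (i < n)%N -> lab i = phi (xs i).
Proof. by move=> ni; rewrite /lab /lab_nat insubT /= -phi_lab. Qed.

Lemma vertex_sample i : (i < n)%N -> span_vertex d r x (xs i).
Proof. by move=> ni; right; left; exists (Ordinal ni). Qed.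

Lemma vertex_meet i j z : (i < n)%N -> (j < n)%N ->
  btw d r z (xs i) -> btw d r z (xs j) -> btw d (xs i) z (xs j) ->
  span_vertex d r x z.
Proof.
move=> ni nj zi zj zij.
have [e|/eqP nei] := eqVneq z (xs i); first by rewrite e; exact: vertex_sample.
have [e|/eqP nej] := eqVneq z (xs j); first by rewrite e; exact: vertex_sample.
have [e|/eqP ner] := eqVneq z r; first by left.
have sp y k : (k < n)%N -> btw d r y (xs k) -> Defs.span d r x y.
  by move=> nk b; exists (Ordinal nk); apply/(segP Ht).
right; right; split; first exact: sp zi.
exists (xs i), (xs j), r; split.
- by apply: sp ni _; exact: btw_end.
- by apply: sp nj _; exact: btw_end.
- by apply: sp ni _; exact: btw_root.
- by split; exact: nesym.
- by split; apply/(segP Ht) => //; move: zi zj; rewrite /btw !(dC Ht _ r) !(dC Ht _ z); lra.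
Qed.

Lemma nlab_empirical z : span_vertex d r x z ->
  (nlab lab n (phi z))%:R / n%:R = empirical R n xs (Fset d r z).
Proof.
move=> vz; rewrite /nlab /empirical; congr (_%:R / _); apply: eq_in_count => k.
rewrite mem_iota add0n => /= nk; rewrite lab_phi //.
by apply/idP/asboolP => /(phi_prefix vz (vertex_sample nk)).
Qed.

(** The map [phi] reflects ancestry only at words that represent vertices of the span. The common
    prefix is such a word: W is closed under prefixes, and an added root is excluded because [phi z]
    is a prefix and is then nonempty. *)
Lemma lcp_meet i j z : is_plane_tree W -> (i < n)%N -> (j < n)%N ->
  btw d r z (xs i) -> btw d r z (xs j) -> btw d (xs i) z (xs j) ->
  lcp (lab i) (lab j) = phi z.
Proof.
move=> [_ [Wpar _]] ni nj zi zj zij; rewrite !lab_phi //.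
have vz := vertex_meet ni nj zi zj zij.
have vi := vertex_sample ni; have vj := vertex_sample nj.
have zp : prefix (phi z) (lcp (phi (xs i)) (phi (xs j))).
  by apply: prefix_lcp; apply/phi_prefix => //; exact/(segP Ht).
have [y [vy ey]] : exists y, span_vertex d r x y /\ phi y = lcp (phi (xs i)) (phi (xs j)).
  apply: phi_surj; split.
    have := lcp_prefixl (phi (xs i)) (phi (xs j)); rewrite prefix_takeE => /eqP <-.
    by apply: W_take => //; case: (phiV vi).
  move=> hr; apply/eqP => e; move: zp; rewrite e prefixs0 => /eqP e'.
  by have [_ /(_ hr)] := phiV vz; rewrite e'.
apply: prefix_antisym => //; rewrite -ey; apply/phi_prefix => //; apply/(segP Ht).
apply: (meet_below Ht zi zj zij).
  by apply/(segP Ht)/phi_prefix => //; rewrite ey lcp_prefixl.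
by apply/(segP Ht)/phi_prefix => //; rewrite ey lcp_prefixr.
Qed.

End Fixed.

(* [N i] is the mass below the neighbour of leaf i. If xi_i is a leaf of the span,
   that neighbour lies strictly below xi_i, whence the sandwich instead of an equality. *)
Lemma sample_structure n xs us : (0 < n)%N ->
  nleaves (sample d r mu psi lam beta Ss n xs us) = n ->
  exists (u : nat -> word) (N : nat -> R),
  [/\ forall A, mu_trim R n (sample d r mu psi lam beta Ss n xs us) A = (empirical R n u A)%:E,
      forall i, (i < n)%N -> empirical R n xs (Fset d r (xs i)) <= N i,
      forall i j z, (i < n)%N -> (j < n)%N -> i <> j ->
        btw d r z (xs i) -> btw d r z (xs j) -> btw d (xs i) z (xs j) ->
        N i <= empirical R n xs (Fset d r z) &
      forall i j z, (i < n)%N -> (j < n)%N -> i <> j ->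
        btw d r z (xs i) -> btw d r z (xs j) -> btw d (xs i) z (xs j) ->
        d_trim R n (sample d r mu psi lam beta Ss n xs us) (u i) (u j) =
        2 * empirical R n xs (Fset d r z) - N i - N j] /\
  (forall i, d_trim R n (sample d r mu psi lam beta Ss n xs us) (u i) (u i) = 0).
Proof.
move=> n0; rewrite sampleE.
have [pW [phi []]] := Hpsi.1 n (fun i : 'I_n => xs i).
set W := (psi _).1; set lab := lab_nat _; set p := slot _ _ _.
move=> phiV phiS phiP phiL hn; have n0' : 0 < n%:R :> R by rewrite ltr0n.
have labE i : (i < n)%N -> lab i = phi (xs i) by move=> ?; exact: lab_phi.
have labW i : i \in iota 0 n -> lab i \in W.
  rewrite mem_iota add0n => /= ni; rewrite labE //.
  by case: (phiV _ (vertex_sample xs ni)).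
have Wpar := pW.2.1.
have mi i : (i < n)%N -> i \in iota 0 n by rewrite mem_iota add0n.
have nl z : span_vertex d r (fun i : 'I_n => xs i) z ->
    (nlab lab n (phi z))%:R / n%:R = empirical R n xs (Fset d r z).
  by move=> ?; exact: nlab_empirical.
have lcpE i j z : (i < n)%N -> (j < n)%N -> btw d r z (xs i) -> btw d r z (xs j) ->
    btw d (xs i) z (xs j) -> lcp (lab i) (lab j) = phi z.
  by move=> ? ? ? ? ?; exact: (lcp_meet phiV phiS phiP phiL pW).
have vs i : (i < n)%N -> span_vertex d r (fun i : 'I_n => xs i) (xs i) := @vertex_sample n xs i.
exists (fun i => newword W lab n p (base W lab n i)).
exists (fun i => (nbase W lab n (base W lab n i))%:R / n%:R).
split; [split|].
- move=> A; rewrite /mu_trim /empirical; congr EFin; congr (_%:R / _).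
  exact: (count_leaves labW (fun w => `[< A w >]) hn).
- move=> i ni; rewrite -(nl _ (vs _ ni)) -labE //.
  by rewrite ler_pM2r ?invr_gt0 // ler_nat; apply: nlab_le_nbase => //; exact: mi.
- move=> i j z ni nj ij zi zj zij.
  rewrite -(nl _ (vertex_meet ni nj zi zj zij)).
  rewrite -(lcpE _ _ _ ni nj zi zj zij).
  by rewrite ler_pM2r ?invr_gt0 // ler_nat; apply: nbase_le_nlab => //; exact: mi.
- move=> i j z ni nj ij zi zj zij.
  rewrite (d_trim_attach Wpar labW hn (mi _ ni) (mi _ nj) ij).
  rewrite -(nl _ (vertex_meet ni nj zi zj zij)).
  rewrite -(lcpE _ _ _ ni nj zi zj zij).
  by rewrite !mulrBl mulrA.
- move=> i; rewrite d_trimE.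
  have -> w : lcp w w = w.
    by apply: prefix_antisym; [exact: lcp_prefixl|apply: prefix_lcp; exact: prefix_refl].
  lra.
Qed.

Lemma sample_gp_close (e : R) : 0 < e ->
  exists (l : seq (set T)) (del : R) (n0 : nat),
  [/\ forall A, A \in l -> measurable A, 0 < del &
    forall n xs us, (n0 <= n)%N -> close_on mu (empirical R n xs) l del ->
      in_Tn n (sample d r mu psi lam beta Ss n xs us) ->
      gp_close (d_trim R n (sample d r mu psi lam beta Ss n xs us)) d
        (mu_trim R n (sample d r mu psi lam beta Ss n xs us)) mu e].
Proof.
(* For different leaves the error will be at most 8 eta from the meet, 5 eta from each leaf and 2
   eta from moving inside blocks, so 100 is generous. *)
move=> e0; pose eta := e / 100.
have eta0 : 0 < eta by rewrite /eta; lra.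
have [K [kappa [[mk kle kmass kS kd] [l [ml hl]]]]] := uniform_Fset Ht Hb HIP eta0.
have [c c0 hc] := ex_pos_min K (fun k => m [set y | kappa y = k]).
(* The three bounds serve [uniform_Fset], the sum over K blocks, and the lower bound c/2 on the
   frequency of each block of positive mass. *)
pose del := Num.min (Num.min eta (eta / K.+1%:R)) (c / 2).
have del0 : 0 < del by rewrite /del !lt_min eta0 !divr_gt0.
have del1 : del <= eta by rewrite /del !ge_min lexx.
have del2 : del *+ K <= eta.
  have h : del <= eta / K.+1%:R by rewrite /del !ge_min lexx orbT.
  apply: (@le_trans _ _ (del * K.+1%:R)).
    by rewrite -[leLHS]mulr_natr ler_pM2l // ler_nat.
  by rewrite -ler_pdivlMr.
have del3 : del <= c / 2 by rewrite /del !ge_min lexx orbT.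
exists (l ++ [seq [set y | kappa y = k] | k <- iota 0 K.+1]), del, (Num.truncn (4 / c)).+1.
split=> //.
  by move=> A; rewrite mem_cat => /orP[/ml //|/mapP[k _ ->]].
move=> n xs us nn0 cl inT.
have n0 : (0 < n)%N by exact: leq_trans nn0.
have n0' : 0 < n%:R :> R by rewrite ltr0n.
have [u [N [[hmu lo up dist] dist0]]] := sample_structure n0 (proj1 (proj2 inT)).
have clk k : (k <= K)%N ->
  `|empirical R n xs [set y | kappa y = k] - m [set y | kappa y = k]| <= del.
  move=> kK; apply: cl; rewrite mem_cat; apply/orP; right; apply/mapP.
  by exists k; rewrite // mem_iota add0n ltnS.
have emp_F x y := hl (empirical R n xs) (@empirical_mono R T n xs) (empirical01 R n xs) _ x y.
have {}emp_F x y : special d r mu x -> btw d r x y -> (kappa y < K)%N ->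
    `|empirical R n xs (Fset d r x) - massF x| <= 4 * eta.
  apply: emp_F => A Al; apply: le_trans del1; apply: cl.
  by rewrite mem_cat Al.
have sp y : (kappa y < K)%N -> special d r mu y.
  by move=> yK; apply: special_IP => //; right; exact: (kS y yK).1.
(* A block of positive mass has frequency at least c/2, while a single sample accounts only for 1/n
   <= c/4. The second sample is what bounds [N i] from above. *)
have mate i : (i < n)%N -> (kappa (xs i) < K)%N ->
    exists j, [/\ (j < n)%N, i <> j & kappa (xs j) = kappa (xs i)].
  move=> ni iK; apply: contrapT => nj.
  have [_ mpos] := kS _ iK.
  have := clk _ (ltnW iK); have := hc _ (ltnW iK) mpos; rewrite ler_norml.
  have : empirical R n xs [set y | kappa y = kappa (xs i)] <= n%:R^-1.
    rewrite /empirical -[leRHS]mul1r ler_pM2r ?invr_gt0 // (ler_nat R _ 1).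
    rewrite (@eq_in_count _ _ (pred1 i)) ?count_uniq_mem ?iota_uniq ?leq_b1 //.
    move=> j; rewrite mem_iota add0n => /= jn; apply/asboolP/eqP => [h|->] //.
    by apply/eqP/negPn/negP => /eqP ne; apply: nj; exists j; split=> //; exact: nesym.
  have : n%:R^-1 <= c / 4.
    rewrite -[leRHS]invrK lef_pV2 ?posrE ?invr_gt0 ?divr_gt0 // invf_div.
    have c4 : 0 <= 4 / c by rewrite divr_ge0 // ltW.
    have /andP[_ h] := truncn_itv c4.
    by apply: le_trans (ltW h) _; rewrite ler_nat.
  by move: (n%:R^-1 : R) del3 => v *; lra.
(* Uniform closeness gives 4 eta; one more eta arises because the meet with the mate is within the
   block diameter of [xs i]. *)
have N_close i : (i < n)%N -> (kappa (xs i) < K)%N -> `|N i - massF (xs i)| <= 5 * eta.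
  move=> ni iK; have [j [nj ij ej]] := mate i ni iK.
  have jK : (kappa (xs j) < K)%N by rewrite ej.
  have [z [zi zj zij]] := ex_meet Ht r (xs i) (xs j).
  have sz := special_meet Ht Hb HIP (sp _ iK) (sp _ jK) zi zj zij.
  have := emp_F _ _ (sp _ iK) (btw_end Ht r (xs i)) iK.
  have := emp_F _ _ sz zi iK; have := lo i ni.
  have := up i j z ni nj ij zi zj zij.
  have := kd _ _ (esym ej) iK.
  have : massF z <= massF (xs i) + d (xs i) (xs j).
    have := sp _ iK; move: sz zi zij; rewrite /special /btw (dC Ht (xs i) z).
    by have := d_ge0 Ht z (xs j); lra.
  by rewrite !ler_norml; lra.
apply: (@gp_close_blocks R dT T mu d _ n K kappa xs u _ e del) => //.
  move: kmass; rewrite /eta in del2 *; lra.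
have near i j y z : (i < n)%N -> (j < n)%N -> (kappa (xs i) < K)%N -> (kappa (xs j) < K)%N ->
    kappa y = kappa (xs i) -> kappa z = kappa (xs j) ->
    `|d (xs i) (xs j) - d y z| <= 2 * eta.
  move=> ni nj iK jK ey ez.
  have := kd (xs i) y (esym ey) iK; have := kd (xs j) z (esym ez) jK.
  have := d_tri Ht y (xs i) (xs j); have := d_tri Ht z y (xs j).
  have := d_tri Ht (xs i) y z; have := d_tri Ht (xs j) (xs i) z.
  rewrite (dC Ht z (xs j)) (dC Ht y (xs i)) ler_norml; lra.
move=> i j y z ni nj iK jK ey ez.
have := near i j y z ni nj iK jK ey ez.
(* Equal indices are treated apart: the distance formula holds only for different leaves. *)
have [->|/eqP ij] := eqVneq i j.
  rewrite dist0 dxx // !ler_norml /eta; lra.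
have [w [wi wj wij]] := ex_meet Ht r (xs i) (xs j).
have sw := special_meet Ht Hb HIP (sp _ iK) (sp _ jK) wi wj wij.
have := N_close _ ni iK; have := N_close _ nj jK.
have := emp_F _ _ sw wi iK.
rewrite (dist i j w ni nj ij wi wj wij).
rewrite (special_dist Ht Hb HIP (sp _ iK) (sp _ jK) wi wj wij).
rewrite !ler_norml /eta; lra.
Qed.

End SampleClose.

(** * Exponential concentration *)

Lemma measure_cover_le (R : realType) (dO : measure_display) (Om : measurableType dO)
    (P : {measure set Om -> \bar R}) (I : eqType) (l : seq I) (F : I -> set Om) (E : set Om) :
  measurable E -> (forall i, i \in l -> measurable (F i)) ->
  (forall x, E x -> exists2 i, i \in l & F i x) ->
  (P E <= \sum_(i <- l) P (F i))%E.
Proof.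
elim: l E => [|i l IH] E mE mF cov.
  rewrite big_nil (_ : E = set0) ?measure0 //.
  by apply/seteqP; split=> x // /cov[].
rewrite big_cons; have mFi : measurable (F i) by apply: mF; rewrite mem_head.
have mF' j : j \in l -> measurable (F j) by move=> jl; apply: mF; rewrite inE jl orbT.
apply: (@le_trans _ _ (P (F i) + P (E `\` F i))%E).
  apply: le_trans (measureU2 _ _ _) => //; last exact: measurableD.
  apply: le_measure; rewrite ?inE //.
    by apply: measurableU => //; exact: measurableD.
  by move=> x Ex; have [h|h] := pselect (F i x); [left|right].
apply: leeD => //; apply: IH => //; first exact: measurableD.
move=> x [Ex nFi]; have [j + Fj] := cov _ Ex.
by rewrite inE => /orP[/eqP e|jl]; [case: nFi; rewrite -e|exists j].
Qed.

(** Invert [1 - x <= expR (- x)] and note (1 + x + 2x^2)(1 - x) = 1 + x^2(1 - 2x) >= 1. *)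
Lemma expR_le_quadratic (R : realType) (x : R) : x <= 2^-1 -> expR x <= 1 + x + 2 * x ^+ 2.
Proof.
move=> x2; have h := expR_ge1Dx (- x).
have p : 0 < 1 - x by lra.
have e : expR x = (expR (- x))^-1 by rewrite expRN invrK.
rewrite e; apply: (@le_trans _ _ (1 - x)^-1).
  by rewrite lef_pV2 ?posrE ?expR_gt0.
rewrite -[leLHS]mul1r ler_pdivrMr //.
have : 0 <= x ^+ 2 * (1 - 2 * x) by rewrite mulr_ge0 ?sqr_ge0 //; lra.
by rewrite (_ : (1 + x + 2 * x ^+ 2) * (1 - x) = 1 + x ^+ 2 * (1 - 2 * x)); [lra|ring].
Qed.

Section Deviation.
Variables (R : realType) (dT : measure_display) (T : measurableType dT).
Variable mu : probability T R.
Variables (dO : measure_display) (Om : measurableType dO) (P : probability Om R).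
Variables (xi : nat -> Om -> T) (U : nat -> Om -> R).
Hypothesis iid : iid_sample mu P xi U.
Local Notation m A := (fine (mu A)).
Local Notation emp n A om := (empirical R n (xi^~ om) A).

Section OneSet.
Variable A : set T.
Hypothesis mA : measurable A.

(** Pattern probabilities come straight from the product formula in [iid_sample], and an expectation
    over patterns is a finite sum. *)
Definition pattern n (s : {ffun 'I_n -> bool}) : set Om :=
  [set om | forall i : 'I_n, `[< A (xi i om) >] = s i].

(** Extends s to all indices, as [iid_sample] asks for; the default beyond n is arbitrary. *)
Definition pattern_side n (s : {ffun 'I_n -> bool}) (i : nat) : set T :=
  if oapp s true (insub i) then A else ~` A.

Lemma pattern_preimage n (s : {ffun 'I_n -> bool}) :
  pattern s = [set om | forall i, (i < n)%N ->
    pattern_side s i (xi i om) /\ [set: R] (U i om)].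
Proof.
apply/seteqP; split=> om /= h.
  move=> i ni; split=> //; rewrite /pattern_side insubT /= -(h (Ordinal ni)) /=.
  by case: asboolP.
move=> i; have [+ _] := h i (ltn_ord i); rewrite /pattern_side valK /=.
by case: (s i) => ?; [exact: asboolT|exact: asboolF].
Qed.

Lemma pattern_measurable n (s : {ffun 'I_n -> bool}) : measurable (pattern s).
Proof.
rewrite (_ : pattern s = \bigcap_(i in [set: 'I_n])
    (xi i @^-1` (if s i then A else ~` A))); last first.
  apply/seteqP; split=> om h i.
    by move=> _ /=; rewrite -h; case: asboolP.
  by have /= := h i Logic.I; case: (s i) => ?; [exact: asboolT|exact: asboolF].
apply: fin_bigcap_measurable; first exact: finite_finset.
move=> i _; rewrite -[X in measurable X]setTI; apply: (proj1 iid) => //.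
by case: (s i) => //; exact: measurableC.
Qed.

Lemma pattern_prob n (s : {ffun 'I_n -> bool}) :
  P (pattern s) = (\prod_(i < n) (if s i then m A else 1 - m A))%:E.
Proof.
rewrite pattern_preimage (proj2 (proj2 iid) n (pattern_side s) (fun=> setT)) //; last first.
  by move=> i; rewrite /pattern_side; case: ifP => // _; exact: measurableC.
have leb1 : fine (lebesgue_measure ([set: R] `&` [set t : R | 0 <= t <= 1])) = 1.
  rewrite setTI (_ : [set t | _] = `[0, 1]%classic).
    by rewrite lebesgue_measure_itv /= lte_fin ltr01 oppr0 adde0.
  by apply/seteqP; split=> t /=; rewrite in_itv.
congr EFin; apply: eq_bigr => i _; rewrite leb1 mulr1 /pattern_side valK /=; case: (s i) => //.
by rewrite probability_setC // fineB // fin_num_measure.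
Qed.

Variable del : R.
Hypotheses (del0 : 0 < del) (del1 : del <= 1).

Lemma upper_deviation n : (0 < n)%N -> measurable [set om | m A + del < emp n A om] /\
  (P [set om | (m A + del < emp n A om)%R] <= ((1 - del ^+ 2 / 32) ^+ n)%R%:E)%E.
Proof.
move=> n0; have n0' : 0 < n%:R :> R by rewrite ltr0n.
set p := m A; set rho := 1 - _.
have p0 : 0 <= p by apply: fine_ge0.
have p1 : p <= 1 by apply: prob_le1.
pose bad (s : {ffun 'I_n -> bool}) := p + del < (\sum_(i < n) (s i)%:R) / n%:R.
pose l := [seq s <- enum {: {ffun 'I_n -> bool}} | bad s].
have badE om (s : {ffun 'I_n -> bool}) : pattern s om -> bad s = (p + del < emp n A om).
  move=> h; rewrite /bad empirical_sum -mulr_suml; congr (_ < _ / _).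
  by apply: eq_bigr => i _; rewrite (h i).
have E : [set om | p + del < emp n A om] = \bigcup_(s in [set s | s \in l]) pattern s.
  apply/seteqP; split=> om /=.
    move=> h; exists [ffun i : 'I_n => `[< A (xi i om) >]] => /=; last first.
      by move=> i; rewrite ffunE.
    rewrite mem_filter mem_enum andbT (badE om) //.
    by move=> i; rewrite ffunE.
  by move=> [s /=]; rewrite mem_filter => /andP[bs _] /badE <-.
have mE : measurable [set om | p + del < emp n A om].
  rewrite E; apply: fin_bigcup_measurable; first exact: finite_seq.
  by move=> s _; exact: pattern_measurable.
split=> //.
(* Chernoff bound with tilt t = del / 16. *)
have [t tE] : exists t, t = del / 16 by exists (del / 16).
have t0 : 0 <= t by rewrite tE divr_ge0 // ltW.
have t1 : t <= 16^-1 by rewrite tE -[leRHS]mul1r ler_wpM2r.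
pose f (b : bool) := if b then p * expR (t * (1 - p - del)) else (1 - p) * expR (t * (- p - del)).
have H := @measure_cover_le _ _ _ P _ l (@pattern n) _ mE. apply: le_trans (H _ _) _.
- by move=> s _; exact: pattern_measurable.
- by rewrite E => om [s sl h]; exists s.
rewrite (eq_bigr (fun s : {ffun 'I_n -> bool} => (\prod_(i < n) (if s i then p else 1 - p))%:E)); last first.
  by move=> s _; exact: pattern_prob.
rewrite sumEFin lee_fin.
apply: (@le_trans _ _ (\sum_(s : {ffun 'I_n -> bool}) \prod_(i < n) f (s i))).
  have pos (s : {ffun 'I_n -> bool}) : 0 <= \prod_(i < n) f (s i).
    apply: prodr_ge0 => i _; rewrite /f; case: ifP => _; rewrite mulr_ge0 ?expR_ge0 //; lra.
  rewrite /l big_filter [X in X <= _]big_mkcond big_enum /=; apply: ler_sum => s _.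
  case: ifPn => // bs.
  have -> : \prod_(i < n) f (s i) = (\prod_(i < n) (if s i then p else 1 - p)) *
      expR (\sum_(i < n) t * ((s i)%:R - p - del)).
    rewrite expR_sum -big_split /=; apply: eq_bigr => i _; rewrite /f.
    by case: (s i); rewrite ?sub0r.
  rewrite -[leLHS]mulr1 ler_wpM2l //.
    by apply: prodr_ge0 => i _; case: ifP => _ //; lra.
  (* On a bad pattern the exponent is nonnegative, so the exponential weight is at least 1. *)
  rewrite -[leLHS](expR0 R) ler_expR -mulr_sumr mulr_ge0 //.
  rewrite !sumrB !sumr_const card_ord.
  by move: bs; rewrite /bad ltr_pdivlMr // mulrDl !mulr_natr -addrA -opprD subr_ge0 => /ltW.
(* The sum over patterns of products factors into an n-th power. *)
rewrite -(bigA_distr_bigA (fun (_ : 'I_n) b => f b)) /= prodr_const card_ord.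
rewrite big_bool /=; apply: lerXn2r; rewrite ?nnegrE.
- by rewrite /f addr_ge0 // mulr_ge0 ?expR_ge0 //; lra.
- have dd : del ^+ 2 <= 1 by rewrite exprn_ile1 // ltW.
  by rewrite /rho; move: (del ^+ 2) dd => v; lra.
have h1 : expR (t * (1 - p - del)) <= 1 + t * (1 - p - del) + 2 * (t * (1 - p - del)) ^+ 2.
  apply: expR_le_quadratic; have h : 1 - p - del <= 1 by lra.
  by have := ler_wpM2l t0 h; move: (t * (1 - p - del)) => v; lra.
have h2 : expR (t * (- p - del)) <= 1 + t * (- p - del) + 2 * (t * (- p - del)) ^+ 2.
  apply: expR_le_quadratic; have h : - p - del <= 1 by lra.
  by have := ler_wpM2l t0 h; move: (t * (- p - del)) => v; lra.
have q1 : (t * (1 - p - del)) ^+ 2 <= 4 * t ^+ 2.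
  by rewrite exprMn mulrC ler_wpM2r ?sqr_ge0 //; nra.
have q2 : (t * (- p - del)) ^+ 2 <= 4 * t ^+ 2.
  by rewrite exprMn mulrC ler_wpM2r ?sqr_ge0 //; nra.
have k1 := ler_wpM2l p0 h1.
have p1' : 0 <= 1 - p by lra.
have k2 := ler_wpM2l p1' h2.
have k3 := ler_wpM2l p0 q1.
have k4 := ler_wpM2l p1' q2.
(* The factor per sample is bounded by 1 - t del + 8 t^2. This is least at t = del/16, where it
   equals 1 - del^2/32. *)
have tt : t ^+ 2 = del ^+ 2 / 256 by rewrite tE; field.
have td : t * del = del ^+ 2 / 16 by rewrite tE; field.
rewrite /f /rho.
have id : p * (1 + t * (1 - p - del) + 2 * (t * (1 - p - del)) ^+ 2) +
  (1 - p) * (1 + t * (- p - del) + 2 * (t * (- p - del)) ^+ 2) =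
  1 - t * del + 2 * (p * (t * (1 - p - del)) ^+ 2) + 2 * ((1 - p) * (t * (- p - del)) ^+ 2).
  by ring.
have id2 : p * (4 * t ^+ 2) + (1 - p) * (4 * t ^+ 2) = 4 * t ^+ 2 by ring.
lra.
Qed.

End OneSet.

(** The lower deviation of A is the upper deviation of its complement. *)
Lemma deviation (A : set T) (del : R) n : measurable A -> 0 < del -> del <= 1 -> (0 < n)%N ->
  measurable [set om | ~ `|emp n A om - m A| <= del] /\
  (P [set om | ~ (`|emp n A om - m A| <= del)%R] <= (2 * (1 - del ^+ 2 / 32) ^+ n)%R%:E)%E.
Proof.
move=> mA d0 d1 n0; have n0' : 0 < n%:R :> R by rewrite ltr0n.
have [m1 b1] := upper_deviation mA d0 d1 n0.
have [m2 b2] := upper_deviation (measurableC mA) d0 d1 n0.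
have empC om : emp n (~` A) om = 1 - emp n A om.
  suff <- : emp n (~` A) om + emp n A om = 1 by rewrite addrK.
  rewrite !empirical_sum -big_split /= (eq_bigr (fun=> n%:R^-1)) => [|i _].
    by rewrite sumr_const card_ord -[LHS]mulr_natl divff // gt_eqF.
  by rewrite asbool_neg; case: asboolP => _; rewrite mul0r mul1r ?addr0 ?add0r.
have mC : m (~` A) = 1 - m A by rewrite probability_setC // fineB // fin_num_measure.
have E : [set om | ~ `|emp n A om - m A| <= del] =
    [set om | m A + del < emp n A om] `|` [set om | m (~` A) + del < emp n (~` A) om].
  apply/seteqP; split=> om /=; rewrite empC mC.
    move/negP; rewrite ler_norml negb_and -!ltNge => /orP[h|h]; [right|left]; lra.
  by move=> h; apply/negP; rewrite ler_norml negb_and -!ltNge; apply/orP; case: h => h; [right|left]; lra.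
split; rewrite E; first exact: measurableU.
apply: le_trans (measureU2 _ _ _) _ => //.
by rewrite mulrDl mul1r EFinD leeD.
Qed.

Lemma close_on_prob (l : seq (set T)) (del : R) n :
  (forall A, A \in l -> measurable A) -> 0 < del -> del <= 1 -> (0 < n)%N ->
  measurable [set om | ~ close_on mu (empirical R n (xi^~ om)) l del] /\
  (P [set om | ~ close_on mu (empirical R n (xi^~ om)) l del] <=
   ((size l)%:R * (2 * (1 - del ^+ 2 / 32) ^+ n))%R%:E)%E.
Proof.
move=> ml d0 d1 n0.
have E : [set om | ~ close_on mu (empirical R n (xi^~ om)) l del] =
    \bigcup_(A in [set A | A \in l]) [set om | ~ `|emp n A om - m A| <= del].
  apply/seteqP; split=> om /=.
    move=> h; apply: contrapT => h'; apply: h => A Al; apply: contrapT => h.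
    by apply: h'; exists A.
  by move=> [A /= Al h] h'; apply: h; exact: h'.
have mE : measurable [set om | ~ close_on mu (empirical R n (xi^~ om)) l del].
  rewrite E; apply: fin_bigcup_measurable; first exact: finite_seq.
  by move=> A /= Al; exact: (deviation (ml A Al) d0 d1 n0).1.
split=> //.
have H := @measure_cover_le _ _ _ P _ l
  (fun A => [set om | ~ `|emp n A om - m A| <= del]) _ mE.
apply: le_trans (H _ _) _.
- by move=> A Al; exact: (deviation (ml A Al) d0 d1 n0).1.
- by move=> om; rewrite E => -[A Al h]; exists A.
have -> c : (size l)%:R * c = \sum_(A <- l) c :> R.
  by rewrite big_const_seq count_predT iter_addr addr0 mulr_natl.
rewrite -sumEFin big_seq [leRHS]big_seq; apply: lee_sum => A Al.
exact: (deviation (ml A Al) d0 d1 n0).2.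
Qed.

End Deviation.

(** * Measurability of the sampled trees *)

Section Fibers.
Variables (dO : measure_display) (Om : measurableType dO).

(** Measurability into a countable set, stated through fibres so that the target carries no
    sigma-algebra. *)
Definition fiber_measurable (Y : Type) (D : Om -> Y) : Prop :=
  forall y, measurable [set om | D om = y].

Lemma countable_preimage (Y : Type) (code : Y -> nat) (D : Om -> Y) (Q : set Y) :
  injective code -> fiber_measurable D -> measurable [set om | Q (D om)].
Proof.
move=> inj mD.
rewrite (_ : [set om | Q (D om)] = \bigcup_k [set om | Q (D om) /\ code (D om) = k]).
  apply: bigcupT_measurable => k.
  have [[om0 [Q0 c0]]|h] := pselect (exists om, Q (D om) /\ code (D om) = k).
    rewrite (_ : [set _ | _] = [set om | D om = D om0]); first exact: mD.
    by apply/seteqP; split=> om /= => [[_ c]|->//]; apply: inj; rewrite c.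
  rewrite (_ : [set _ | _] = set0) //.
  by apply/seteqP; split=> om //= h'; apply: h; exists om.
by apply/seteqP; split=> om /= => [h|[k _ []//]]; exists (code (D om)).
Qed.

Lemma countType_preimage (Y : countType) (D : Om -> Y) (Q : set Y) :
  fiber_measurable D -> measurable [set om | Q (D om)].
Proof.
exact: (countable_preimage Q (pcan_inj (@choice.pickleK Y))).
Qed.

Lemma fiber_comp (Y : countType) (Z : Type) (D : Om -> Y) (g : Y -> Z) :
  fiber_measurable D -> fiber_measurable (fun om => g (D om)).
Proof. by move=> mD z; exact: (@countType_preimage Y D (fun y => g y = z)). Qed.

Lemma fiber_map (I Y : Type) (f : I -> Om -> Y) (l : seq I) :
  (forall i, fiber_measurable (f i)) -> fiber_measurable (fun om => [seq f i om | i <- l]).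
Proof.
move=> mf; elim: l => [|i l IH] [|a y] /=.
- by rewrite (_ : [set _ | _] = setT) //; apply/seteqP; split.
- by rewrite (_ : [set _ | _] = set0) //; apply/seteqP; split.
- by rewrite (_ : [set _ | _] = set0) //; apply/seteqP; split.
rewrite (_ : [set _ | _] = [set om | f i om = a] `&` [set om | [seq f i om | i <- l] = y]).
  by apply: measurableI; [exact: mf|exact: IH].
by apply/seteqP; split=> om /= => [[-> ->]|[-> ->]].
Qed.

Lemma fiber_bool (b : Om -> bool) : measurable [set om | b om] -> fiber_measurable b.
Proof.
move=> mb [|]; first exact: mb.
rewrite (_ : [set _ | _] = ~` [set om | b om]); first exact: measurableC.
by apply/seteqP; split=> om /=; [move=> ->|move/negP/negbTE].
Qed.

Lemma fiber_count (I : Type) (b : I -> Om -> bool) (l : seq I) :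
  (forall i, measurable [set om | b i om]) -> fiber_measurable (fun om => count (b^~ om) l).
Proof.
move=> mb.
have := @fiber_comp _ _ _ (count id) (fiber_map l (fun i => fiber_bool (mb i))).
by move=> h k; have := h k; under eq_fun do rewrite count_map.
Qed.

Lemma fiber_if (Y : Type) (b : Om -> bool) (f g : Om -> Y) :
  measurable [set om | b om] -> fiber_measurable f -> fiber_measurable g ->
  fiber_measurable (fun om => if b om then f om else g om).
Proof.
move=> mb mf mg y.
rewrite (_ : [set _ | _] = ([set om | b om] `&` [set om | f om = y]) `|`
   (~` [set om | b om] `&` [set om | g om = y])).
  apply: measurableU; apply: measurableI;
    [exact: mb|exact: mf|exact: measurableC|exact: mg].
apply/seteqP; split=> om /=.
  by case: ifPn => [h <-|/negP h <-]; [left|right].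
by case=> -[+ <-]; [move=> ->|move/negP/negbTE ->].
Qed.

Lemma fiber_cst (Y : Type) (y : Y) : fiber_measurable (fun=> y).
Proof.
move=> z; have [->|ne] := pselect (y = z).
  by rewrite (_ : [set _ | _] = setT) //; apply/seteqP; split.
by rewrite (_ : [set _ | _] = set0) //; apply/seteqP; split.
Qed.

Lemma lt_measurable (R : realType) (f g : Om -> R) :
  (forall t, measurable [set om | f om < t]) -> (forall t, measurable [set om | t < g om]) ->
  measurable [set om | f om < g om].
Proof.
move=> mf mg.
rewrite (_ : [set _ | _] = \bigcup_(q : rat) ([set om | f om < ratr q] `&` [set om | ratr q < g om])).
  by apply: bigcupT_measurable_rat => q; exact: measurableI.
apply/seteqP; split=> om /=; last by move=> [q _ [/= h1 h2]]; exact: lt_trans h1 h2.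
by move=> h; have [q] := rat_in_itvoo h; rewrite in_itv /= => /andP[h1 h2]; exists q.
Qed.

Lemma fun_lt_measurable (R : realType) (f : Om -> R) t :
  measurable_fun setT f -> measurable [set om | f om < t].
Proof.
move=> mf; have := mf measurableT `]-oo, t[%classic (measurable_itv _); rewrite setTI.
by rewrite (_ : _ @^-1` _ = [set om | f om < t]) //; apply/seteqP; split=> om /=; rewrite in_itv.
Qed.

Lemma fun_gt_measurable (R : realType) (f : Om -> R) t :
  measurable_fun setT f -> measurable [set om | t < f om].
Proof.
move=> mf; have := mf measurableT `]t, +oo[%classic (measurable_itv _); rewrite setTI.
by rewrite (_ : _ @^-1` _ = [set om | t < f om]) //; apply/seteqP; split=> om /=; rewrite in_itv /= andbT.
Qed.

End Fibers.

(** The numbers [us] enter only through their order; this reduces the sampled tree to countably many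
    data. *)
Lemma attach_ext (R : realType) (W : ptree) (lab : nat -> word) (n : nat)
    (pos pos' : nat -> nat) (us us' : nat -> R) :
  (forall i, (i < n)%N -> pos i = pos' i) ->
  (forall i j, (i < n)%N -> (j < n)%N -> (us i < us j) = (us' i < us' j)) ->
  attach W lab n pos us = attach W lab n pos' us'.
Proof.
move=> hp hu.
have rc v j : rank_child W lab n pos v j = rank_child W lab n pos' v j.
  congr (_ + _)%N; apply: eq_in_count => i; rewrite mem_iota add0n => /= ni.
  by rewrite hp.
have nw w : newword W lab n pos w = newword W lab n pos' w by apply: eq_map => k; rewrite rc.
have he i j : (i < n)%N -> (j < n)%N -> (us i == us j) = (us' i == us' j).
  by move=> ni nj; rewrite !eq_le !leNgt !hu.
have rl i : (i < n)%N -> rank_leaf lab n pos us i = rank_leaf lab n pos' us' i.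
  move=> ni; rewrite /rank_leaf hp //; congr (_ + _)%N; apply: eq_in_count => j.
  by rewrite mem_iota add0n => /= nj; rewrite /before !hp // hu // he.
rewrite /attach; congr (_ `|` _)%fset.
  by apply: eq_in_imfset => // w _; rewrite nw.
apply: eq_in_imfset => // i; rewrite inE /= mem_iota add0n => /andP[/= ni _].
by rewrite nw rl.
Qed.

(** * Countably many atoms and open branches *)

Section TreeFibers.
Variables (R : realType) (dT : measure_display) (T : measurableType dT).
Variable (d : T -> T -> R).
Hypothesis Ht : real_tree d.
Hypothesis Hb : borel_of_d d.
Variable r : T.
Variable mu : probability T R.
Local Notation m A := (fine (mu A)).

Lemma set1_measurable x : measurable [set x : T].
Proof.
rewrite -[X in measurable X]setCK; apply: measurableC.
rewrite (_ : ~` _ = [set y | 0 < d x y]).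
  exact: (lip_gt_measurable Hb (dist_lip Ht x)).
apply/seteqP; split=> y /= h; first by rewrite lt_neqAle d_ge0 // andbT eq_sym; apply/eqP => /(d0P Ht) /esym.
by move=> e; move: h; rewrite e dxx // ltxx.
Qed.

Lemma ex_heavy_atoms (c : R) : 0 < c ->
  exists l : seq T, forall x, c <= m [set x] -> x \in l.
Proof.
move=> c0; apply: contrapT => nl.
have UC y (l : seq T) : [set` y :: l] = [set y] `|` [set` l].
  apply/seteqP; split=> z; rewrite /= inE; first by case/orP => [/eqP|]; [left|right].
  by case=> [/= ->|/= ->]; rewrite ?eqxx ?orbT.
have ms (l : seq T) : measurable [set` l].
  elim: l => [|y l IH]; first by rewrite (_ : [set` _] = set0) //; apply/seteqP; split.
  by rewrite UC; apply: measurableU => //; exact: set1_measurable.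
have step N : exists l : seq T, size l = N /\ c * N%:R <= m [set` l].
  elim: N => [|N [l [sl ml]]]; first by exists [::]; split=> //; rewrite mulr0 fine_ge0.
  have [x cx xl] : exists2 x, c <= m [set x] & x \notin l.
    apply: contrapT => h; apply: nl; exists l => x cx.
    by apply: contrapT => /negP xl; apply: h; exists x.
  exists (x :: l); split; first by rewrite /= sl.
  rewrite UC measureU //; last first.
  - by rewrite -subset0 => y [/= ->]; rewrite /= (negbTE xl).
  - exact: set1_measurable.
  rewrite fineD ?fin_num_measure //; last exact: set1_measurable.
  by rewrite -natr1 mulrDr mulr1 addrC lerD.
have [l [_ h]] := step (Num.truncn c^-1).+1.
have h1 := prob_le1 mu (ms l).
have /andP[_ h2] := truncn_itv (ltW (etrans (invr_gt0 c) c0)).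
have := le_trans h h1; apply/negP; rewrite -ltNge.
by rewrite -ltr_pdivrMl // mulr1.
Qed.

(** For each k only finitely many points have mass at least 1/(k+1). Countability matters because
    [beta a] may depend on a in any way, so events at atoms are split over the atoms one by one. *)
Lemma ex_atom_enum : exists a : nat -> T, forall x, is_atom mu x -> exists k, a k = x.
Proof.
have ex k := ex_heavy_atoms (etrans (invr_gt0 _) (ltr0Sn R k)).
have [L HL] := choice ex.
exists (fun n => let p := odflt (0%N, 0%N) (choice.unpickle n) in nth r (L p.1) p.2) => x ax.
have mx : 0 < m [set x].
  by rewrite -lte_fin fineK ?fin_num_measure //; exact: set1_measurable.
have [k hk] := ex_inv_lt mx; have xk := HL k x (ltW hk).
by exists (choice.pickle (k, index x (L k))); rewrite choice.pickleK /= nth_index.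
Qed.

Lemma btw_sym x y z : btw d x y z -> btw d z y x.
Proof. by rewrite /btw (dC Ht z y) (dC Ht y x) (dC Ht z x) addrC. Qed.

(** The three sides of a geodesic triangle share the point p, and v lies on the y side or on the w
    side of it. *)
Lemma btw_tripod y w z v : btw d y v w -> btw d y v z \/ btw d z v w.
Proof.
move=> yvw; have [p [pzy pzw ypw]] := ex_meet Ht z y w.
case: (leP (d y v) (d y p)) => h.
  left; apply: (btw_trans Ht (btw_chain Ht yvw ypw h)); exact: btw_sym.
right; apply: btw_sym.
have h' : d w v <= d w p.
  by move: yvw ypw; rewrite /btw (dC Ht w v) (dC Ht w p); lra.
apply: (btw_trans Ht (btw_chain Ht (btw_sym yvw) (btw_sym ypw) h')).
exact: btw_sym.
Qed.

Lemma comp_eq (O : set T) y z : seg d y z `<=` O -> Defs.comp d O y = Defs.comp d O z.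
Proof.
have half a b : seg d a b `<=` O -> Defs.comp d O a `<=` Defs.comp d O b.
  move=> ab w [Ow aw]; split=> // v /(segP Ht) bvw.
  have [bva|avw] := btw_tripod a bvw.
    by apply: ab; apply/(segP Ht); exact: btw_sym.
  by apply: aw; apply/(segP Ht).
move=> yz; apply/seteqP; split; first exact: half.
by apply: half => v /(segP Ht) /btw_sym /(segP Ht); exact: yz.
Qed.

Lemma comp_empty (O : set T) y : ~ O y -> Defs.comp d O y = set0.
Proof.
move=> nO; rewrite -subset0 => z [_ h]; apply: nO; apply: h; apply/(segP Ht).
by rewrite /btw dxx // add0r.
Qed.

(** A segment from y shorter than [d y a] leaves [r, y] before it reaches a. *)
Lemma seg_in_open_branch a y z : (Fset d r a `\ a) y -> d y z < d y a ->
  seg d y z `<=` Fset d r a `\ a.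
Proof.
move=> [/(FsetP Ht) ay nay] lt v /(segP Ht) yvz.
have yv : d y v < d y a.
  by move: yvz; rewrite /btw; have := d_ge0 Ht v z; lra.
have [p [py pv ypv]] := ex_meet Ht r y v.
split; last by move=> /= e; move: yv; rewrite e ltxx.
apply/(FsetP Ht).
have ha : d r a <= d r p.
  move: ay py ypv; rewrite /btw (dC Ht a y) (dC Ht p y).
  by have := d_ge0 Ht p v; lra.
exact: (btw_trans Ht (btw_chain Ht ay py ha) pv).
Qed.

(** The branches at a are open, so the branch containing y is locally constant in y and any function
    h of it is continuous there. Off the branches [comp] is empty and the value is constant. *)
Lemma branch_fun_measurable (a : T) (h : set T -> R) t :
  measurable [set y | h (Defs.comp d (Fset d r a `\ a) y `|` [set a]) < t].
Proof.
set O := Fset d r a `\ a; set S := [set y | _].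
have mO : measurable O.
  by apply: measurableD; [exact: Fset_measurable|exact: set1_measurable].
rewrite (_ : S = (S `&` O) `|` (S `&` ~` O)); last by rewrite -setIUr setUCr setIT.
apply: measurableU.
  apply: (d_open_measurable Hb) => y [Sy Oy].
  have ya : 0 < d y a.
    by rewrite lt_neqAle d_ge0 // andbT eq_sym; apply/eqP => /(d0P Ht); case: Oy.
  exists (d y a); split=> // z yz; have sub := seg_in_open_branch Oy yz.
  split; first by rewrite /S /= -(comp_eq sub).
  by apply: sub; apply/(segP Ht); exact: btw_end.
have [h0|h0] := pselect (h (set0 `|` [set a]) < t).
  rewrite (_ : S `&` _ = ~` O); first exact: measurableC.
  by apply/seteqP; split=> y => [[]//|nO]; split=> //; rewrite /S /= comp_empty.
rewrite (_ : S `&` _ = set0) //; rewrite -subset0 => y [+ nO].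
by rewrite /S /= comp_empty.
Qed.

End TreeFibers.

(** * The sampled tree as a random variable *)

Section SampleMeasurable.
Variables (R : realType) (dT : measure_display) (T : measurableType dT).
Variable (d : T -> T -> R).
Hypothesis Ht : real_tree d.
Hypothesis Hb : borel_of_d d.
Variable r : T.
Variable mu : probability T R.
Variable psi : forall n, ('I_n -> T) -> lptree n.
Hypothesis Hpsi : planar_order d r psi.
Variables (lam : T -> R) (beta : T -> set T -> R) (Ss : set T).
Hypothesis mlam : measurable_fun setT lam.
Hypothesis mSs : measurable Ss.
Variables (dO : measure_display) (Om : measurableType dO).
Variables (xi : nat -> Om -> T) (U : nat -> Om -> R).
Hypothesis mxi : forall i, measurable_fun setT (xi i).
Hypothesis mU : forall i, measurable_fun setT (U i).

Lemma xi_preimage i (A : set T) : measurable A -> measurable [set om | A (xi i om)].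
Proof. by move=> mA; have := mxi i measurableT mA; rewrite setTI. Qed.

(** The sets of n-tuples with measurable preimage form a sigma-algebra that contains the
    cylinders. *)
Lemma psi_fiber n : fiber_measurable (fun om => psi (fun i : 'I_n => xi i om)).
Proof.
move=> v; have := proj1 (proj2 Hpsi) n v.
suff H : <<s cylinders (T := T) (n := n) >> `<=`
    [set S | measurable [set om | S (fun i : 'I_n => xi i om)]] by exact: H.
apply: smallest_sub.
  split=> /=.
  - by rewrite (_ : [set _ | _] = set0) //; apply/seteqP; split.
  - move=> S mS; rewrite (_ : [set _ | _] = ~` [set om | S (fun i : 'I_n => xi i om)]).
      exact: measurableC.
    by apply/seteqP; split=> om /= => [[_ //]|nS]; split.
  - move=> F mF; rewrite (_ : [set _ | _] = \bigcup_k [set om | F k (fun i : 'I_n => xi i om)]).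
      exact: bigcupT_measurable.
    by apply/seteqP; split=> om /= [k _ h]; exists k.
move=> _ [A mA <-] /=.
rewrite (_ : [set _ | _] = \bigcap_(i in [set: 'I_n]) [set om | A i (xi i om)]).
  apply: fin_bigcap_measurable; first exact: finite_finset.
  by move=> i _; apply: xi_preimage; exact: mA.
apply/seteqP; split=> om /= h i; first by move=> _; exact: h.
exact: (h i Logic.I).
Qed.

Lemma atom_event (i : nat) (B : T -> set Om) :
  (forall a, is_atom mu a -> measurable (B a)) ->
  measurable [set om | is_atom mu (xi i om) /\ B (xi i om) om].
Proof.
move=> mB; have [a Ha] := ex_atom_enum Ht Hb r mu.
rewrite (_ : [set _ | _] = \bigcup_k
    (if `[< is_atom mu (a k) >] then [set om | [set a k] (xi i om)] `&` B (a k) else set0)).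
  apply: bigcupT_measurable => k; case: asboolP => // ak; apply: measurableI; last exact: mB.
  by apply: xi_preimage; exact: (set1_measurable Ht Hb).
apply/seteqP; split=> om /=.
  move=> [ax Bx]; have [k ek] := Ha _ ax; exists k => //.
  by rewrite ek asboolT //; split.
by move=> [k _]; case: asboolP => // ak [/= -> ?].
Qed.

Lemma order_event i j : measurable [set om | U i om < U j om].
Proof. by apply: lt_measurable => t; [exact: fun_lt_measurable|exact: fun_gt_measurable]. Qed.

Lemma branch_event i j : measurable [set om | is_atom mu (xi i om) /\
  beta (xi i om) (Defs.comp d (Fset d r (xi i om) `\ xi i om) (xi j om) `|` [set xi i om]) < U i om].
Proof.
apply: (@atom_event i (fun a => [set om |
  beta a (Defs.comp d (Fset d r a `\ a) (xi j om) `|` [set a]) < U i om])) => a _.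
apply: lt_measurable => t; last exact: fun_gt_measurable.
exact: (xi_preimage (A := [set y | beta a (Defs.comp d (Fset d r a `\ a) y `|` [set a]) < t]) j
  (branch_fun_measurable Ht Hb r a (beta a) t)).
Qed.

(** With the tree frozen at v, the slot depends on finitely many events. Repeating [is_atom] inside
    the count makes each of them measurable on its own ([branch_event]), and the comparison with
    [lam] is written strictly to suit [lt_measurable]. *)
Definition fixed_slot n (v : lptree n) (i : nat) (om : Om) : nat :=
  let lab := lab_nat v.2 in
  let rep c := nth 0%N [seq j <- iota 0 n | prefix c (lab j)] 0 in
  let k := nchildren v.1 (lab i) in
  if `[< is_atom mu (xi i om) >] then
    count (fun j => `[< is_atom mu (xi i om) /\ beta (xi i om)
      (Defs.comp d (Fset d r (xi i om) `\ xi i om) (xi (rep (rcons (lab i) j)) om)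
        `|` [set xi i om]) < U i om >]) (iota 0 k)
  else if `[< Ss (xi i om) >] then (if ~~ (lam (xi i om) < U i om) then 0%N else k) else k.

Lemma fixed_slotE n (v : lptree n) i om : psi (fun i : 'I_n => xi i om) = v ->
  slot d r mu psi lam beta Ss n (xi^~ om) (U^~ om) i = fixed_slot v i om.
Proof.
move=> e; rewrite /slot /fixed_slot e; case: asboolP => [ax|_]; last by rewrite -leNgt.
by apply: eq_count => j; apply/idP/asboolP => [|[]].
Qed.

Lemma fixed_slot_fiber n (v : lptree n) i : fiber_measurable (fixed_slot v i).
Proof.
have asb (B : set Om) : measurable B -> measurable [set om | `[< B om >]].
  by move=> mB; rewrite (_ : [set _ | _] = B) //; apply/seteqP; split=> om /= /asboolP.
apply: fiber_if.
- apply: asb; rewrite (_ : (fun om => _) = [set om | is_atom mu (xi i om) /\ setT om]).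
    exact: (@atom_event i (fun=> setT)).
  by apply/seteqP; split=> om /= [].
- by apply: fiber_count => j; apply: asb; exact: branch_event.
apply: fiber_if; first by apply: asb; exact: xi_preimage.
  apply: fiber_if; [|exact: fiber_cst|exact: fiber_cst].
  rewrite (_ : [set _ | _] = ~` [set om | lam (xi i om) < U i om]); last first.
    by apply/seteqP; split=> om /= /negP.
  apply: measurableC; apply: lt_measurable => t; last exact: fun_gt_measurable.
  by apply: fun_lt_measurable; exact: measurableT_comp.
exact: fiber_cst.
Qed.

(* The sampled tree is a function of these data, which range over a countable set. *)
Definition sample_data n (om : Om) : (lptree n * seq nat * seq bool)%type :=
  (psi (fun i : 'I_n => xi i om),
   [seq slot d r mu psi lam beta Ss n (xi^~ om) (U^~ om) i | i <- iota 0 n],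
   [seq U p.1 om < U p.2 om | p <- allpairs pair (iota 0 n) (iota 0 n)]).

Lemma sample_data_fiber n : fiber_measurable (@sample_data n).
Proof.
move=> [[v ps] cs].
rewrite (_ : [set _ | _] = ([set om | psi (fun i : 'I_n => xi i om) = v] `&`
    [set om | [seq fixed_slot v i om | i <- iota 0 n] = ps]) `&`
    [set om | [seq U p.1 om < U p.2 om | p <- allpairs pair (iota 0 n) (iota 0 n)] = cs]).
  apply: measurableI; first apply: measurableI.
  - exact: psi_fiber.
  - by apply: fiber_map => i; exact: fixed_slot_fiber.
  - apply: (@fiber_map _ _ _ _ (fun p om => U p.1 om < U p.2 om)) => p.
    by apply: fiber_bool; exact: order_event.
apply/seteqP; split=> om; rewrite /sample_data /=.
  move=> [e1 e2 e3]; split=> //; split=> //=.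
  by rewrite -e2; apply: eq_map => i; rewrite (fixed_slotE _ e1).
move=> [[e1 e2] e3]; rewrite e1 e3 -e2; congr (_, _, _).
by apply: eq_map => i; rewrite (fixed_slotE _ e1).
Qed.

Lemma sample_data_eq n om om' : sample_data n om = sample_data n om' ->
  sample d r mu psi lam beta Ss n (xi^~ om) (U^~ om) =
  sample d r mu psi lam beta Ss n (xi^~ om') (U^~ om').
Proof.
move=> [e1 e2 e3]; rewrite !sampleE e1; apply: attach_ext.
  move=> i ni; have := congr1 (nth 0%N ^~ i) e2.
  by rewrite !(nth_map 0%N) ?size_iota // !nth_iota // add0n.
move=> i j ni nj; move/eq_in_map: e3 => /(_ (i, j)); apply.
by apply/allpairsP; exists (i, j); rewrite /= !mem_iota !add0n.
Qed.

Definition ptree_code (W : ptree) : seq (seq nat) := enum_fset W.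

Lemma ptree_code_inj : injective ptree_code.
Proof. by move=> V W e; apply/fsetP => w; rewrite -[w \in V]/(w \in ptree_code V) e. Qed.

Lemma sample_data_code n : exists code : lptree n * seq nat * seq bool -> nat, injective code.
Proof.
exists (fun y => choice.pickle (ptree_code y.1.1.1, [seq (y.1.1.2 i : seq nat) | i <- enum 'I_n], y.1.2, y.2)).
move=> [[[V l] ps] cs] [[[V' l'] ps'] cs'] /(pcan_inj (@choice.pickleK _)) /= [e1 e2 -> ->].
rewrite (ptree_code_inj e1) (_ : l = l') //.
apply/funext => i; apply: (eq_in_map l l' (enum 'I_n)).2 => //; rewrite mem_enum //.
Qed.

Lemma sample_fiber n :
  fiber_measurable (fun om => sample d r mu psi lam beta Ss n (xi^~ om) (U^~ om)).
Proof.
move=> t; have [code inj] := sample_data_code n.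
(* The predicate selects the data of outcomes with tree t; by [sample_data_eq] every outcome with
   such data has tree t. *)
have := countable_preimage (fun y => exists om', sample_data n om' = y /\
  sample d r mu psi lam beta Ss n (xi^~ om') (U^~ om') = t) inj (@sample_data_fiber n).
rewrite (_ : [set om | _] = [set om | sample d r mu psi lam beta Ss n (xi^~ om) (U^~ om) = t]) //.
apply/seteqP; split=> om /=; last by exists om.
by move=> [om' [/sample_data_eq <-]].
Qed.

End SampleMeasurable.

(** * Transfer to the chain *)

Definition path_code (s : seq ptree) : nat := choice.pickle [seq ptree_code W | W <- s].

Lemma path_code_inj : injective path_code.
Proof.
by move=> s t /(pcan_inj (@choice.pickleK _)) /(inj_map ptree_code_inj).
Qed.

Lemma fdd_measurable (dO : measure_display) (Om : measurableType dO)
    (X : nat -> Om -> ptree) (s : seq ptree) :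
  (forall n, fiber_measurable (X n)) -> measurable (fdd_event X s).
Proof.
move=> mX.
rewrite (_ : fdd_event X s = \bigcap_(k in `I_(size s)) [set om | X k.+1 om = nth fset0 s k]) //.
by apply: fin_bigcap_measurable => [|k _]; [exact: finite_II|exact: mX].
Qed.

Section Transfer.
Variables (n : nat) (Bad : set ptree).
Hypothesis n0 : (0 < n)%N.

(** Splits the bad event by the code of the path of the first n trees, since the laws are compared
    only on finite paths. Each piece is one [fdd_event] or empty, for the same code alike in all
    processes. *)
Definition path_event (Om : Type) (X : nat -> Om -> ptree) (k : nat) : set Om :=
  [set om | exists s, [/\ path_code s = k, size s = n, Bad (last fset0 s) & fdd_event X s om]].

Lemma path_event_cases k :
  (exists s, forall (Om : Type) (X : nat -> Om -> ptree), path_event X k = fdd_event X s) \/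
  (forall (Om : Type) (X : nat -> Om -> ptree), path_event X k = set0).
Proof.
have [[s [ks sn bs]]|h] := pselect (exists s, [/\ path_code s = k, size s = n & Bad (last fset0 s)]).
  left; exists s => Om X; apply/seteqP; split=> om; last by exists s.
  by move=> [t [kt _ _]]; rewrite (path_code_inj (etrans kt (esym ks))).
right=> Om X; apply/seteqP; split=> om // [t [kt tn bt _]].
by apply: h; exists t.
Qed.

Lemma fdd_event_path (Om : Type) (X : nat -> Om -> ptree) s om : size s = n ->
  fdd_event X s om -> s = [seq X i.+1 om | i <- iota 0 n].
Proof.
move=> sn h; apply: (@eq_from_nth _ fset0); first by rewrite size_map size_iota.
by move=> i ni; rewrite (nth_map 0%N) ?size_iota -?sn // nth_iota // add0n h.
Qed.

Lemma path_event_cover (Om : Type) (X : nat -> Om -> ptree) :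
  [set om | Bad (X n om)] = \bigcup_k path_event X k.
Proof.
have lastE om : last fset0 [seq X i.+1 om | i <- iota 0 n] = X n om.
  rewrite -nth_last size_map size_iota (nth_map 0%N) ?size_iota ?ltn_predL //.
  by rewrite nth_iota ?ltn_predL // add0n prednK.
apply/seteqP; split=> om /=.
  move=> b; exists (path_code [seq X i.+1 om | i <- iota 0 n]) => //.
  exists [seq X i.+1 om | i <- iota 0 n]; split=> //.
  - by rewrite size_map size_iota.
  - by rewrite lastE.
  - move=> k; rewrite size_map size_iota => kn.
    by rewrite (nth_map 0%N) ?size_iota // nth_iota.
by move=> [k _ [s [_ sn + /(fdd_event_path sn) e]]]; rewrite e lastE.
Qed.

Lemma path_event_triv (Om : Type) (X : nat -> Om -> ptree) : trivIset setT (path_event X).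
Proof.
apply/trivIsetP => i j _ _ /eqP ij; rewrite -subset0 => om.
move=> [[s [si sn _ /(fdd_event_path sn) es]] [t [tj tn _ /(fdd_event_path tn) et]]].
by apply: ij; rewrite -si -tj es et.
Qed.

(** On the sample side only a measurable superset [B] of the bad event is estimated; in the
    application it is the failure of [close_on]. *)
Lemma law_transfer (R : realType) (dO : measure_display) (Om : measurableType dO)
    (P : probability Om R) (X : nat -> Om -> ptree)
    (dO' : measure_display) (Om' : measurableType dO')
    (P' : probability Om' R) (X' : nat -> Om' -> ptree) (B : set Om') :
  (forall k, fiber_measurable (X k)) -> (forall k, fiber_measurable (X' k)) ->
  (forall s, P (fdd_event X s) = P' (fdd_event X' s)) ->
  measurable B -> (forall om, Bad (X' n om) -> B om) ->
  measurable [set om | Bad (X n om)] /\ (P [set om | Bad (X n om)] <= P' B)%E.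
Proof.
move=> mX mX' law mB sub.
have mE k : measurable (path_event X k).
  by have [[s ->]|->] := path_event_cases k; [exact: fdd_measurable|].
have mE' k : measurable (path_event X' k).
  by have [[s ->]|->] := path_event_cases k; [exact: fdd_measurable|].
have mU := bigcupT_measurable _ mE; have mU' := bigcupT_measurable _ mE'.
rewrite path_event_cover; split=> //.
rewrite measure_semi_bigcup //; last exact: path_event_triv.
apply: (@le_trans _ _ (P' (\bigcup_k path_event X' k))).
  rewrite measure_semi_bigcup //; last exact: path_event_triv.
  rewrite (@eq_eseriesr _ _ (fun k => P' (path_event X' k))) // => k _.
  have [[s e]|e] := path_event_cases k; rewrite !e; first exact: law.
  by rewrite !measure0.
by apply: le_measure; rewrite ?inE // -path_event_cover => om /sub.
Qed.

End Transfer.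

(** * Borel-Cantelli and conclusion *)

Lemma geometric_series_lty (R : realType) (f : nat -> \bar R) (C rho : R) :
  0 <= C -> 0 <= rho -> rho < 1 -> (forall n, 0 <= f n)%E ->
  (forall n, f n <= (C * rho ^+ n)%:E)%E -> (\sum_(n <oo) f n < +oo)%E.
Proof.
move=> C0 r0 r1 f0 fle; apply: (@le_lt_trans _ _ (C / (1 - rho))%:E); last exact: ltry.
have p : 0 < 1 - rho by lra.
have bound M : \sum_(0 <= n < M) C * rho ^+ n <= C / (1 - rho).
  rewrite -mulr_sumr ler_wpM2l // -[leRHS]mul1r ler_pdivlMr // mulrC.
  suff -> : (1 - rho) * \sum_(0 <= n < M) rho ^+ n = 1 - rho ^+ M.
    by rewrite gerBl exprn_ge0.
  elim: M => [|M IH]; first by rewrite big_geq // mulr0 expr0 subrr.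
  by rewrite big_nat_recr //= mulrDr IH exprS; ring.
apply: lime_le; first by apply: is_cvg_nneseries => n _ _; exact: f0.
apply: nearW => M; apply: (@le_trans _ _ (\sum_(0 <= n < M) (C * rho ^+ n)%:E)%E).
  by apply: lee_sum => n _; exact: fle.
by rewrite sumEFin lee_fin.
Qed.

Theorem theorem4p2
  (R : realType) (dT : measure_display) (T : measurableType dT)
  (d : T -> T -> R) (r : T) (mu : probability T R)
  (Htree : real_tree d) (Hborel : borel_of_d d) (HIP : IP_tree d r mu)
  (Ss : set T) (HSs : mus_support d r mu Ss)
  (psi : forall n, ('I_n -> T) -> lptree n) (Hpsi : planar_order d r psi)
  (lam : T -> R) (Hlam : branch_weight lam)
  (beta : T -> set T -> R) (Hbeta : branchpoint_weights d r mu beta)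
  (dO : measure_display) (Om : measurableType dO) (P : probability Om R)
  (Tn : nat -> Om -> ptree) (Hchain : extremal_ubd_chain P Tn)
  (dO' : measure_display) (Om' : measurableType dO') (P' : probability Om' R)
  (xi : nat -> Om' -> T) (U : nat -> Om' -> R) (Hiid : iid_sample mu P' xi U)
  (Hlaw : forall s : seq ptree,
     P (fdd_event Tn s) =
     P' (fdd_event (fun n om => sample d r mu psi lam beta Ss n
                                  (fun i => xi i om) (fun i => U i om)) s)) :
  exists N : set Om, [/\ measurable N, P N = 0%E &
    forall om, ~ N om ->
      (fun n => gp_dist (d_trim R n (Tn n om)) [::] (mu_trim R n (Tn n om)) d r mu)
        @ \oo --> (0 : R)].
Proof.
have [inTn [mTn _]] := Hchain.1.
have [mxi [mU _]] := Hiid.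
pose X' n om := sample d r mu psi lam beta Ss n (fun i => xi i om) (fun i => U i om).
have mX' n : fiber_measurable (X' n).
  by apply: sample_fiber => //; [exact: Hlam.1|exact: HSs.1].
pose close e n t := gp_close (d_trim R n t) d (mu_trim R n t) mu e.
(* The conjunct [in_Tn] holds everywhere for the chain, and on the sample side it provides the leaf
   count on which [sample_gp_close] relies. *)
pose bad e n : set ptree := [set t | in_Tn n t /\ ~ close e n t].
have key (e : R) : 0 < e -> exists n0 : nat, (0 < n0)%N /\
    exists C rho : R, [/\ 0 <= C, 0 <= rho, rho < 1 & forall n, (n0 <= n)%N ->
      measurable [set om | bad e n (Tn n om)] /\
      (P [set om | bad e n (Tn n om)] <= (C * rho ^+ n)%:E)%E].
  move=> e0.
  have [l [del [n0 [ml d0 hl]]]] := sample_gp_close Htree Hborel HIP Hpsi lam beta Ss e0.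
  (* The Chernoff bound is stated for deviations of at most 1. *)
  have [del' [d0' d1' dd]] : exists del', [/\ 0 < del', del' <= 1 & del' <= del].
    by exists (Num.min del 1); rewrite lt_min d0 ltr01 !ge_min !lexx orbT.
  exists n0.+1; split=> //; exists ((size l)%:R * 2), (1 - del' ^+ 2 / 32).
  have q1 : del' ^+ 2 <= 1 by rewrite exprn_ile1 // ltW.
  have q0 : 0 < del' ^+ 2 by rewrite exprn_gt0.
  split.
  - by rewrite mulr_ge0.
  - by move: (del' ^+ 2) q1 => v; lra.
  - by move: (del' ^+ 2) q0 => v; lra.
  move=> n nn; have npos : (0 < n)%N by exact: leq_trans nn.
  have [mB pB] := close_on_prob Hiid ml d0' d1' npos.
  have [m1 p1] := @law_transfer n (bad e n) npos R _ Om P Tn _ Om' P' X' _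
    (fun k t => mTn k t) mX' Hlaw mB (fun om b => fun c =>
      b.2 (hl n (xi^~ om) (U^~ om) (ltnW nn) (fun A Al => le_trans (c A Al) dd) b.1)).
  by split=> //; apply: le_trans p1 _; rewrite -mulrA.
(* Countably many tolerances, so that the exceptional sets have a null union. *)
pose ek (k : nat) : R := k.+1%:R^-1.
have ek0 k : 0 < ek k by rewrite /ek invr_gt0.
have key1 k : exists p : nat * R * R, (0 < p.1.1)%N /\
    [/\ 0 <= p.1.2, 0 <= p.2, p.2 < 1 & forall n, (p.1.1 <= n)%N ->
      measurable [set om | bad (ek k) n (Tn n om)] /\
      (P [set om | bad (ek k) n (Tn n om)] <= (p.1.2 * p.2 ^+ n)%:E)%E].
  by have [n0 [n00 [C [rho H]]]] := key _ (ek0 k); exists (n0, C, rho).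
have [p Hp] := choice key1.
(* Emptying the events below the threshold makes the geometric bound valid for every n. *)
pose F k n := if ((p k).1.1 <= n)%N then [set om | bad (ek k) n (Tn n om)] else set0.
have mF k n : measurable (F k n).
  rewrite /F; case: ifP => // h; have [_ [_ _ _ H]] := Hp k; exact: (H n h).1.
have PF k : P (lim_sup_set (F k)) = 0%E.
  apply: lim_sup_set_cvg0; first exact: mF.
  have [_ [C0 r0 r1 H]] := Hp k.
  apply: (geometric_series_lty C0 r0 r1) => // n.
  rewrite /F; case: ifP => h; first exact: (H n h).2.
  by rewrite measure0 lee_fin mulr_ge0 // exprn_ge0.
have mN k : measurable (lim_sup_set (F k)).
  apply: bigcapT_measurable => n; apply: bigcup_measurable => j _; exact: mF.
exists (\bigcup_k lim_sup_set (F k)); split.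
- exact: bigcupT_measurable.
- exact: measure_bigcup0.
move=> om nN; apply/cvgrPdist_le => e e0; have [k ke] := ex_inv_lt e0.
have [n1 Hn1] : exists n1, forall n, (n1 <= n)%N -> ~ F k n om.
  apply: contrapT => h; apply: nN; exists k => // n _.
  apply: contrapT => h'; apply: h; exists n => j nj Fj.
  by apply: h'; exists j.
near=> n.
have n0n : ((p k).1.1 <= n)%N by near: n; exact: nbhs_infty_ge.
have n1n : (n1 <= n)%N by near: n; exact: nbhs_infty_ge.
have npos : (0 < n)%N by apply: leq_trans n0n; case: (Hp k).
have cl : close (ek k) n (Tn n om).
  apply: contrapT => h; apply: (Hn1 n n1n); rewrite /F n0n; split=> //.
  exact: inTn.
rewrite sub0r normrN /gp_dist; set S := [set e | _].
have Sk : S (ek k) by split.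
have lb0 : lbound S 0 by move=> x [/ltW].
rewrite ger0_norm; last by apply: lb_le_inf => //; exists (ek k).
by apply: le_trans (ltW ke); apply: ge_inf => //; exists 0.
Unshelve. all: by end_near.
Qed.
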